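(* There is a universal constant $c'>0$ such that the following holds. Let $(\mathcal X,Q,\pi)$ be an irreducible reversible finite Markov chain and let $D>0$. If $\mathrm{Ric}(\mathcal X,Q,\pi)\ge0$ (non-negative entropic Ricci curvature) and the diameter of $(\mathcal X,d_{\mathcal W})$ is bounded by $D$, then the modified logarithmic Sobolev inequality $\mathrm{MLSI}(\lambda)$ holds with constant $\lambda=\frac{c'}{D^2}$.
   Context: Setting. $\mathcal X$ is a finite set and $Q:\mathcal X\times\mathcal X\to[0,\infty)$ is a collection of transition rates with $Q(x,x)=0$, irreducible: any $x,y$ are joined by a sequence $x=x_1,\dots,x_n=y$ with $Q(x_i,x_{i+1})>0$. $\pi$ is the unique (strictly positive) stationary probability measure of the associated continuous time Markov chain, assumed reversible: $Q(x,y)\pi(x)=Q(y,x)\pi(y)$ for all $x,y$. Transport distance. $\mathcal P(\mathcal X)=\{\rho:\mathcal X\to[0,\infty): \sum_x\rho(x)\pi(x)=1\}$ is the set of probability densities, $\mathcal P_*(\mathcal X)$ the subset of strictly positive ones. Let $\theta(s,t)=\int_0^1 s^{1-p}t^p\,dp$ (logarithmic mean) and $\hat\rho(x,y)=\theta(\rho(x),\rho(y))$. For $\rho_0,\rho_1\in\mathcal P(\mathcal X)$, $$\mathcal W(\rho_0,\rho_1)^2=\inf\Big\{\tfrac12\int_0^1\sum_{x,y}(\psi_t(x)-\psi_t(y))^2\hat\rho_t(x,y)Q(x,y)\pi(x)\,dt\Big\},$$ the infimum being over absolutely continuous curves $\rho:[0,1]\to\mathcal P(\mathcal X)$ with endpoints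 $\rho_0,\rho_1$ and measurable $\psi:[0,1]\to\mathbb R^{\mathcal X}$ such that for a.e. $t$ and all $x$: $\frac{d}{dt}\rho_t(x)+\sum_y(\psi_t(y)-\psi_t(x))\hat\rho_t(x,y)Q(x,y)=0$. $\mathcal W$ is a metric on $\mathcal P(\mathcal X)$. On $\mathcal X$ one sets $d_{\mathcal W}(x,y)=\mathcal W(\delta_x,\delta_y)$, where $\delta_x$ is identified with the density $\mathbf 1_{\{x\}}/\pi(x)$. Curvature. Let $\mathcal H(\rho)=\sum_x\pi(x)\rho(x)\log\rho(x)$ (with $0\log0=0$). A constant speed geodesic is a curve $(\rho_t)_{t\in[0,1]}$ with $\mathcal W(\rho_s,\rho_t)=|s-t|\mathcal W(\rho_0,\rho_1)$. For $\kappa\in\mathbb R$, $\mathrm{Ric}(\mathcal X,Q,\pi)\ge\kappa$ means that for every constant speed geodesic $(\rho_t)$ in $(\mathcal P(\mathcal X),\mathcal W)$ and $t\in[0,1]$: $\mathcal H(\rho_t)\le(1-t)\mathcal H(\rho_0)+t\mathcal H(\rho_1)-\frac\kappa2t(1-t)\mathcal W(\rho_0,\rho_1)^2$. MLSI. With $\mathcal E(\phi,\psi)=\frac12\sum_{x,y}(\phi(y)-\phi(x))(\psi(y)-\psi(x))Q(x,y)\pi(x)$, $\mathrm{MLSI}(\lambda)$ means $\mathcal H(\rho)\le\frac1{2\lambda}\mathcal E(\rho,\log\rho)$ for all $\rho\in\mathcal P_*(\mathcal X)$. ''Universal'' means independent of $\mathcal X,Q,\pi,D$. *)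

(* Defs.v *)
From mathcomp Require Export all_boot all_order all_algebra.
From mathcomp Require Export all_classical all_reals all_analysis.
Export Order.TTheory GRing.Theory Num.Theory.
Export numFieldNormedType.Exports.

Set Implicit Arguments.
Unset Strict Implicit.
Unset Printing Implicit Defensive.

Local Open Scope classical_set_scope.
Local Open Scope ring_scope.

Section MarkovChain.
Context {R : realType} {X : finType}.
Implicit Types (Q : X -> X -> R) (pi f g : X -> R).

Definition irreducible_rates Q : Prop :=
  forall x y, connect (fun a b => 0 < Q a b) x y.

Record probability_vector pi : Prop := ProbabilityVector {
  pv_ge0 : forall x, 0 <= pi x;
  pv_sum1 : \sum_(x : X) pi x = 1 }.

(* Stationarity for the generator (L f)(x) = \sum_y (f y - f x) * Q x y. *)
Definition stationary Q pi : Prop :=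
  forall y, \sum_(x : X) pi x * Q x y = pi y * \sum_(x : X) Q y x.

Definition reversible Q pi : Prop :=
  forall x y, Q x y * pi x = Q y x * pi y.

(* Positivity of [pi] is not a field: it follows from irreducibility. *)
Record irreducible_reversible_chain Q pi : Prop := IrreducibleReversibleChain {
  irc_rate_ge0 : forall x y, 0 <= Q x y;
  irc_rate_diag : forall x, Q x x = 0;
  irc_irreducible : irreducible_rates Q;
  irc_prob : probability_vector pi;
  irc_stationary : stationary Q pi;
  irc_reversible : reversible Q pi }.

(* Densities are taken with respect to [pi]. *)
Definition densities pi : set (X -> R) :=
  [set rho | (forall x, 0 <= rho x) /\ \sum_(x : X) rho x * pi x = 1].

Definition positive_densities pi : set (X -> R) :=
  [set rho | densities pi rho /\ forall x, 0 < rho x].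

Definition dirac_density pi (x : X) : X -> R := fun z => (z == x)%:R / pi x.

(* [ln 0 = 0] in the library, hence the convention 0 log 0 = 0. *)
Definition entropy pi (rho : X -> R) : R :=
  \sum_(x : X) pi x * rho x * ln (rho x).

Definition dirichlet_form Q pi f g : R :=
  2^-1 * \sum_(x : X) \sum_(y : X) (f y - f x) * (g y - g x) * Q x y * pi x.

Definition MLSI Q pi (lambda : R) : Prop :=
  forall rho, positive_densities pi rho ->
    entropy pi rho <=
    (2 * lambda)^-1 * dirichlet_form Q pi rho (fun x => ln (rho x)).

End MarkovChain.

Section TransportDistance.
Context {R : realType}.

Definition log_mean (s t : R) : R :=
  Rintegral lebesgue_measure `[0, 1] (fun p : R => s `^ (1 - p) * t `^ p).

Definition absolutely_continuous_on (a b : R) (f : R -> R) : Prop :=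
  forall eps : R, 0 < eps -> exists2 delta : R, 0 < delta &
    forall (n : nat) (u v : 'I_n -> R),
      (forall i, [&& a <= u i, u i <= v i & v i <= b]) ->
      (forall i j, i != j ->
         `]u i, v i[%classic `&` `]u j, v j[%classic = set0) ->
      \sum_(i < n) (v i - u i) < delta ->
      \sum_(i < n) `|f (v i) - f (u i)| < eps.

Context {X : finType}.
Implicit Types (Q : X -> X -> R) (pi : X -> R) (rho psi : R -> X -> R).

(* Curves on [0, 1] are functions on [R]; values outside [0, 1] play no role,
   the endpoints being negligible in the a.e. continuity equation. *)
Record transport_path Q pi (rho0 rho1 : X -> R) rho psi : Prop :=
  TransportPath {
  tp_density : forall t : R, 0 <= t <= 1 -> densities pi (rho t);
  tp_abs_cont : forall x, absolutely_continuous_on 0 1 (fun t => rho t x);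
  tp_start : rho 0 = rho0;
  tp_end : rho 1 = rho1;
  tp_measurable : forall x, measurable_fun (`[0, 1]%classic : set R)
      (fun t => psi t x);
  tp_continuity_eq : {ae lebesgue_measure, forall t : R, 0 <= t <= 1 ->
    forall x, derivable (fun s => rho s x) t 1 /\
      derive1 (fun s => rho s x) t +
      \sum_(y : X) (psi t y - psi t x) * log_mean (rho t x) (rho t y) * Q x y
      = 0} }.

Definition action Q pi rho psi : \bar R :=
  ((2^-1)%:E * \int[lebesgue_measure]_(t in `[0%R, 1%R])
    (\sum_(x : X) \sum_(y : X) (psi t x - psi t y) ^+ 2 *
       log_mean (rho t x) (rho t y) * Q x y * pi x)%:E)%E.

(* Extended-real valued, so that no junk value is attached to an empty or
   infinite infimum; it is finite on the densities of an irreducible chain. *)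
Definition transport_dist_sqr Q pi (rho0 rho1 : X -> R) : \bar R :=
  ereal_inf [set a | exists rho psi,
    transport_path Q pi rho0 rho1 rho psi /\ a = action Q pi rho psi].

Definition transport_dist Q pi (rho0 rho1 : X -> R) : \bar R :=
  sqrte (transport_dist_sqr Q pi rho0 rho1).

Definition vertex_dist Q pi (x y : X) : \bar R :=
  transport_dist Q pi (dirac_density pi x) (dirac_density pi y).

Definition vertex_diameter Q pi : \bar R :=
  ereal_sup [set d | exists x y, d = vertex_dist Q pi x y].

Definition constant_speed_geodesic Q pi rho : Prop :=
  (forall t : R, 0 <= t <= 1 -> densities pi (rho t)) /\
  (forall s t : R, 0 <= s <= 1 -> 0 <= t <= 1 ->
    transport_dist Q pi (rho s) (rho t) =
    (`|s - t|%:E * transport_dist Q pi (rho 0%R) (rho 1%R))%E).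

Definition Ric_ge Q pi (kappa : R) : Prop :=
  forall rho, constant_speed_geodesic Q pi rho ->
  forall t : R, 0 <= t <= 1 ->
    ((entropy pi (rho t))%:E <=
     ((1 - t) * entropy pi (rho 0) + t * entropy pi (rho 1))%:E -
     (kappa / 2 * t * (1 - t))%:E * transport_dist Q pi (rho 0%R) (rho 1%R) ^+ 2)%E.

End TransportDistance.

(* Main.v *)
(* Write H for the entropy, I for the Dirichlet form of (rho, log rho), P_t for
   the heat semigroup and dist for the transport distance.

   - Convexity of H along geodesics, differentiated at the starting point, gives
     the HWI inequality 2 (H rho - H sigma) <= a I rho + dist(rho, sigma)^2 / a
     for all a > 0. The derivative is bounded through the tangent of H at rho,
     integrated along near-optimal paths; geodesics exist because the distance
     is continuous.
   - Joint convexity of the action gives dist(rho, 1) <= D. With sigma = 1, HWI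
     reads H^2 <= D^2 I; since (H (P_t rho))' = - I (P_t rho), it follows that
     H (P_t rho) <= D^2 / t.
   - At t = 4 D^2 two heated densities are Hellinger-close to 1, so they have
     correlation at least 1/4. Hence the kernel of P_T, T = 8 D^2, is at least
     1/4, and a Doeblin argument yields H (P_T rho) <= 3/4 H rho.
   - The heat flow from rho to P_T rho has potential - log, whence
     dist(rho, P_T rho)^2 <= T (H rho - H (P_T rho)). HWI with sigma = P_T rho
     and a = T gives H rho - H (P_T rho) <= T I rho, so H rho <= 32 D^2 I rho. *)

From mathcomp Require Import ring lra.
From mathcomp Require Import measurable_realfun.
Require Import Defs.
Set Implicit Arguments.
Unset Strict Implicit.
Unset Printing Implicit Defensive.
Local Open Scope classical_set_scope.
Local Open Scope ring_scope.

(** * Real analysis *)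

Section PointwiseDerivatives.
Context {R : realType}.
Implicit Types (f g : R -> R) (t a b : R).

(** The distance is defined through potentials, whereas interpolating or mixing paths produces only
    fluxes, and the potentials of near-optimal paths are merely measurable and uncontrolled near the
    boundary of the simplex. Fluxes are therefore turned back into potentials by an explicit
    solution of a Poisson equation, which does not increase the energy but needs a positive density.
    This is why the interpolations and mixtures below carry a small multiple of the constant density
    [1]. Paths are only absolutely continuous, so the continuity equation is exploited through
    integral bounds on increments.

    With target [1], HWI yields [H^2 <= D^2 I], which is weaker than an inequality linear in [H]
    when [H] is small. The decay it implies is used only to reach a fixed entropy level. From there
    the kernel has a uniform lower bound, hence the entropy contracts by a fixed factor whatever its
    initial size. HWI between [rho] and its own evolution then controls a fixed fraction of the
    entropy linearly. *)

Lemma deriv_cst t a : is_derive t (1 : R) (fun=> a) (0 : R).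
Proof. exact: is_derive_cst. Qed.

Lemma deriv_id t : is_derive t (1 : R) (fun s => s) (1 : R).
Proof. exact: is_derive_id. Qed.

Lemma derivD f g t a b : is_derive t (1 : R) f a -> is_derive t (1 : R) g b ->
  is_derive t (1 : R) (fun s => f s + g s) (a + b).
Proof. by move=> hf hg; exact: is_deriveD. Qed.

Lemma derivM f g t a b : is_derive t (1 : R) f a -> is_derive t (1 : R) g b ->
  is_derive t (1 : R) (fun s => f s * g s) (f t * b + g t * a).
Proof. by move=> hf hg; exact: (@is_deriveM R _ f g). Qed.

Lemma derivZ f k t a : is_derive t (1 : R) f a ->
  is_derive t (1 : R) (fun s => k * f s) (k * a).
Proof. by move=> hf; exact: (@is_deriveZ R _ _ f k). Qed.

Lemma deriv_comp f g t a b : is_derive (g t) (1 : R) f a -> is_derive t (1 : R) g b ->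
  is_derive t (1 : R) (fun s => f (g s)) (a * b).
Proof. exact: is_derive1_comp. Qed.

Lemma deriv_sum (I : Type) (r : seq I) (f : I -> R -> R) (a : I -> R) t :
  (forall i, is_derive t (1 : R) (f i) (a i)) ->
  is_derive t (1 : R) (fun s => \sum_(i <- r) f i s) (\sum_(i <- r) a i).
Proof.
move=> h; elim: r => [|i r ih].
  rewrite big_nil (_ : (fun s => _) = fun=> 0); first exact: deriv_cst.
  by apply/funext => s; rewrite big_nil.
rewrite big_cons (_ : (fun s => _) = fun s => f i s + \sum_(i <- r) f i s).
  exact: derivD.
by apply/funext => s; rewrite big_cons.
Qed.

(** Lets the calculus rules produce a derivative in whatever form they give, to be normalised
    afterwards by [ring] or [field]. *)
Lemma deriv_eq f t a b : is_derive t (1 : R) f a -> a = b -> is_derive t (1 : R) f b.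
Proof. by move=> h <-. Qed.

Lemma deriv_affine t a b : is_derive t (1 : R) (fun s => a + s * b) b.
Proof.
apply: (deriv_eq (derivD (deriv_cst t a) (derivM (deriv_id t) (deriv_cst t b)))).
by rewrite mulr0 !add0r mulr1.
Qed.

Lemma deriv_continuous f t a : is_derive t (1 : R) f a -> {for t, continuous f}.
Proof.
by move=> [df _]; apply: differentiable_continuous; apply/derivable1_diffP.
Qed.

Lemma deriv_derive1 f t a : is_derive t (1 : R) f a ->
  derivable f t 1 /\ derive1 f t = a.
Proof. by move=> [df fa]; rewrite derive1E. Qed.

Lemma derive1_deriv f t : derivable f t 1 -> is_derive t (1 : R) f (derive1 f t).
Proof. by move=> df; split; rewrite ?derive1E. Qed.

Lemma mvt f (f' : R -> R) a b : a <= b ->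
  (forall t, a <= t <= b -> is_derive t (1 : R) f (f' t)) ->
  exists2 c, a <= c <= b & f b - f a = f' c * (b - a).
Proof.
move=> ab df.
have [t tab||c cab ->] := @MVT_segment R f f' a b ab.
- by apply: df; move: tab; rewrite in_itv/= => /andP[/ltW -> /ltW ->].
- apply: derivable_within_continuous => t tab.
  by case: (df t _) => //; move: tab; rewrite in_itv.
- by exists c => //; move: cab; rewrite in_itv.
Qed.

Lemma deriv_le_sub f g (f' g' : R -> R) a b : a <= b ->
  (forall t, a <= t <= b -> is_derive t (1 : R) f (f' t)) ->
  (forall t, a <= t <= b -> is_derive t (1 : R) g (g' t)) ->
  (forall t, a <= t <= b -> f' t <= g' t) ->
  f b - f a <= g b - g a.
Proof.
move=> ab df dg fg.
have [t tab|c cab] := @mvt (fun t => g t + (-1) * f t) (fun t => g' t + (-1) * f' t) a b ab.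
  by apply: derivD; [exact: dg|apply: derivZ; exact: df].
have := fg c cab; rewrite -subr_ge0 => h.
have : 0 <= (g' c + (-1) * f' c) * (b - a) by rewrite mulN1r mulr_ge0// subr_ge0.
move=> /[swap] <-; lra.
Qed.

Lemma integral_deriv f (f' : R -> R) a b : a < b ->
  (forall t, a <= t <= b -> is_derive t (1 : R) f (f' t)) ->
  {within `[a, b], continuous f'} ->
  (\int[lebesgue_measure]_(t in `[a, b]) (f' t)%:E = (f b - f a)%:E)%E.
Proof.
move=> ab df cf; rewrite EFinB; apply: continuous_FTC2 => //.
- split.
  + move=> x; rewrite in_itv/= => /andP[ax xb].
    by case: (df x _); rewrite // !ltW.
  + apply: cvg_at_right_filter; apply: deriv_continuous; apply: df.
    by rewrite lexx ltW.
  + apply: cvg_at_left_filter; apply: deriv_continuous; apply: df.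
    by rewrite lexx ltW.
- move=> x; rewrite in_itv/= => /andP[ax xb].
  by apply: (deriv_derive1 _).2; apply: df; rewrite !ltW.
Qed.

End PointwiseDerivatives.

Section AlmostEverywhere.
Context {R : realType}.
Implicit Types (P Q S : R -> Prop).
Local Notation mu := (@lebesgue_measure R).

Lemma aeS P Q : (forall t, P t -> Q t) -> {ae mu, forall t, P t} -> {ae mu, forall t, Q t}.
Proof.
by move=> PQ; apply: (@filterS _ _ (ae_filter_ringOfSetsType mu)).
Qed.

Lemma aeS2 P Q S : (forall t, P t -> Q t -> S t) ->
  {ae mu, forall t, P t} -> {ae mu, forall t, Q t} -> {ae mu, forall t, S t}.
Proof.
by move=> PQ; apply: (@filterS2 _ _ (ae_filter_ringOfSetsType mu)).
Qed.

Lemma ae_neq (a : R) : {ae mu, forall t, t != a}.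
Proof.
exists [set a]; split => //; first exact: lebesgue_measure_set1.
by move=> t /= /negP; rewrite negbK => /eqP.
Qed.

End AlmostEverywhere.

(** * Logarithmic mean: closed form, supporting planes, concavity *)

Section LogMean.
Context {R : realType}.
Implicit Types (s t p : R).
Local Notation mu := (@lebesgue_measure R).

Lemma log_mean_integrandE s t p : 0 < s -> 0 < t ->
  s `^ (1 - p) * t `^ p = expR (ln s + p * (ln t - ln s)).
Proof.
move=> s0 t0; rewrite /powR !gt_eqF// -expRD; congr expR; ring.
Qed.

Lemma deriv_expR_affine (a b p : R) :
  is_derive p (1 : R) (fun p => expR (a + p * b)) (expR (a + p * b) * b).
Proof. exact: (deriv_comp (is_derive_expR _) (deriv_affine _ _ _)). Qed.

Lemma continuous_expR_affine (a b : R) : continuous (fun p : R => expR (a + p * b)).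
Proof. by move=> p; exact: deriv_continuous (deriv_expR_affine a b p). Qed.

Lemma integrable_01 (f : R -> R) : continuous f ->
  mu.-integrable `[0, 1] (EFin \o f).
Proof.
move=> cf; apply: continuous_compact_integrable; first exact: segment_compact.
exact: continuous_subspaceT.
Qed.

Lemma log_mean_gt0E s t : 0 < s -> 0 < t ->
  log_mean s t = Rintegral mu `[0, 1] (fun p => expR (ln s + p * (ln t - ln s))).
Proof.
move=> s0 t0; rewrite /log_mean; apply: eq_Rintegral => p _.
exact: log_mean_integrandE.
Qed.

Lemma log_mean_ge0 s t : 0 <= log_mean s t.
Proof. by apply: Rintegral_ge0 => p _; rewrite mulr_ge0// powR_ge0. Qed.

Lemma log_mean_eq0 s t : (s == 0) || (t == 0) -> log_mean s t = 0.
Proof.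
move=> st; rewrite /log_mean.
have mf : measurable_fun setT (fun p : R => s `^ (1 - p) * t `^ p).
  apply: measurable_funM; last exact: measurable_powRr.
  apply: (measurableT_comp (measurable_powRr s)).
  by apply: measurable_funB.
rewrite /Rintegral -(@integral_itv_obnd_cbnd R 0%R (BRight 1%R)); last first.
  by apply/measurable_EFinP; apply: measurable_funTS.
rewrite -(@integral_itv_bndo_bndc R (BRight 0%R) 1%R); last first.
  by apply/measurable_EFinP; apply: measurable_funTS.
rewrite integral0_eq// => p /=; rewrite in_itv/= => /andP[p0 p1].
case/orP: st => /eqP ->; first by rewrite powR0 ?mul0r// gt_eqF// subr_gt0.
by rewrite powR0 ?mulr0// gt_eqF.
Qed.

Lemma log_mean_neqE s t : 0 < s -> 0 < t -> s != t ->
  log_mean s t = (t - s) / (ln t - ln s).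
Proof.
move=> s0 t0 st; rewrite log_mean_gt0E//.
have d0 : ln t - ln s != 0.
  rewrite subr_eq0; apply: contra st => /eqP /ln_inj; rewrite !posrE => -> //.
set a := ln s; set b := ln t - ln s.
pose F p := expR (a + p * b) / b.
have dF p : is_derive p (1 : R) F (expR (a + p * b)).
  apply: (deriv_eq (derivM (deriv_expR_affine a b p) (deriv_cst p b^-1))).
  by rewrite mulr0 add0r mulrCA mulVf// mulr1.
rewrite /Rintegral (@integral_deriv _ F _ 0 1)//.
- rewrite /F /= mul1r mul0r addr0 /a (_ : ln s + b = ln t) ?lnK ?posrE ?mulrBl//.
  by rewrite /b addrC subrK.
- by apply: continuous_subspaceT; exact: continuous_expR_affine.
Qed.

Lemma log_mean_diag s : 0 <= s -> log_mean s s = s.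
Proof.
rewrite le_eqVlt => /predU1P[<-|s0]; first by rewrite log_mean_eq0 ?eqxx.
rewrite log_mean_gt0E// subrr.
under eq_Rintegral do rewrite mulr0 addr0 lnK ?posrE//.
by rewrite Rintegral_cst//= lebesgue_measure_itv/= lte_fin ltr01 oppr0 adde0 mulr1.
Qed.

Lemma log_meanC s t : 0 <= s -> 0 <= t -> log_mean s t = log_mean t s.
Proof.
rewrite le_eqVlt => /predU1P[<- _|s0]; first by rewrite !log_mean_eq0 ?eqxx ?orbT.
rewrite le_eqVlt => /predU1P[<-|t0]; first by rewrite !log_mean_eq0 ?eqxx ?orbT.
have [->//|st] := eqVneq s t.
by rewrite !log_mean_neqE// 1?eq_sym// -(opprB s t) -(opprB (ln s)) invrN mulrNN.
Qed.

(** The chain rule for which this mean is chosen: the continuity equation with potential [- ln rho]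
    becomes the heat equation. *)
Lemma log_mean_ln s t : 0 < s -> 0 < t -> (ln t - ln s) * log_mean s t = t - s.
Proof.
move=> s0 t0; have [->|st] := eqVneq s t; first by rewrite !subrr mul0r.
rewrite log_mean_neqE// mulrC divfK// subr_eq0.
by apply: contra st => /eqP /ln_inj; rewrite !posrE => ->.
Qed.

(** The right side is the tangent plane at [(S, T)] of the concave, 1-homogeneous map [s^(1-p) t^p].
    The inequality is [1 + x <= exp x] applied to the deviations of the two log-ratios from their
    weighted mean [w]. *)
Lemma weighted_amgm (p s t S T : R) : 0 <= p <= 1 -> 0 < s -> 0 < t -> 0 < S -> 0 < T ->
  expR (ln s + p * (ln t - ln s)) <=
  expR (ln S + p * (ln T - ln S)) * ((1 - p) / S) * s +
  expR (ln S + p * (ln T - ln S)) * (p / T) * t.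
Proof.
move=> /andP[p0 p1] s0 t0 S0 T0.
set m := ln s + _; set M := ln S + _.
pose u := ln s - ln S; pose v := ln t - ln T.
have -> : m = M + ((1 - p) * u + p * v) by rewrite /m /M /u /v; ring.
have sE : s / S = expR u by rewrite /u expRB !lnK ?posrE.
have tE : t / T = expR v by rewrite /v expRB !lnK ?posrE.
have -> : expR M * ((1 - p) / S) * s + expR M * (p / T) * t =
  expR M * ((1 - p) * expR u + p * expR v).
  by rewrite -sE -tE; ring.
rewrite expRD ler_pM2l ?expR_gt0//.
set w := _ + p * v.
have hu : expR w * (1 + (u - w)) <= expR u.
  have -> : expR u = expR w * expR (u - w) by rewrite -expRD addrC subrK.
  by rewrite ler_pM2l ?expR_gt0// expR_ge1Dx.
have hv : expR w * (1 + (v - w)) <= expR v.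
  have -> : expR v = expR w * expR (v - w) by rewrite -expRD addrC subrK.
  by rewrite ler_pM2l ?expR_gt0// expR_ge1Dx.
have := lerD (ler_wpM2l (_ : 0 <= 1 - p) hu) (ler_wpM2l p0 hv).
rewrite subr_ge0 => /(_ p1); apply: le_trans.
rewrite le_eqVlt; apply/orP; left; apply/eqP.
by rewrite /w; ring.
Qed.

(** Integrating the tangent planes of [weighted_amgm] over [p] gives a supporting plane with
    nonnegative slopes. Monotonicity and concavity are both read off from it, including at zero
    arguments. *)
Lemma log_mean_tangent (S T : R) : 0 < S -> 0 < T ->
  exists2 ab : R * R, [/\ 0 <= ab.1, 0 <= ab.2 &
    ab.1 * S + ab.2 * T = log_mean S T] &
    forall s t, 0 <= s -> 0 <= t -> log_mean s t <= ab.1 * s + ab.2 * t.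
Proof.
move=> S0 T0.
pose g p := expR (ln S + p * (ln T - ln S)).
have cg : continuous g by exact: continuous_expR_affine.
have cid : continuous (fun p : R => p) by move=> ?; exact: cvg_id.
have c1 : continuous (fun p : R => g p * ((1 - p) / S)).
  move=> p; apply: continuousM; first exact: cg.
  by apply: continuousM; [apply: continuousB => //; exact: cst_continuous|exact: cst_continuous].
have c2 : continuous (fun p : R => g p * (p / T)).
  move=> p; apply: continuousM; first exact: cg.
  by apply: continuousM; [exact: cid|exact: cst_continuous].
pose al := Rintegral mu `[0, 1] (fun p => g p * ((1 - p) / S)).
pose be := Rintegral mu `[0, 1] (fun p => g p * (p / T)).
have cM (f : R -> R) k : continuous f -> continuous (fun p => f p * k).
  by move=> cf p; apply: continuousM; [exact: cf|exact: cst_continuous].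
have abE s t : al * s + be * t =
   Rintegral mu `[0, 1] (fun p => g p * ((1 - p) / S) * s + g p * (p / T) * t).
  rewrite RintegralD//; last 2 first.
    by apply: integrable_01; exact: cM.
    by apply: integrable_01; exact: cM.
  by rewrite !RintegralZr//; exact: integrable_01.
have g0 p : 0 <= g p by exact: expR_ge0.
exists (al, be) => /=; first split.
- apply: Rintegral_ge0 => p /=; rewrite in_itv/= => /andP[p0 p1].
  by rewrite mulr_ge0// divr_ge0// ?subr_ge0// ltW.
- apply: Rintegral_ge0 => p /=; rewrite in_itv/= => /andP[p0 p1].
  by rewrite mulr_ge0// divr_ge0// ltW.
- rewrite abE log_mean_gt0E//; apply: eq_Rintegral => p _.
  rewrite -/(g p) -!mulrA mulVf ?gt_eqF// mulVf ?gt_eqF// !mulr1; ring.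
- move=> s t s0 t0.
  have al0 : 0 <= al.
    apply: Rintegral_ge0 => p /=; rewrite in_itv/= => /andP[p0 p1].
    by rewrite mulr_ge0// divr_ge0// ?subr_ge0// ltW.
  have be0 : 0 <= be.
    apply: Rintegral_ge0 => p /=; rewrite in_itv/= => /andP[p0 p1].
    by rewrite mulr_ge0// divr_ge0// ltW.
  have [st|] := boolP ((s == 0) || (t == 0)).
    by rewrite log_mean_eq0// addr_ge0// mulr_ge0.
  rewrite negb_or => /andP[sn tn].
  have {}s0 : 0 < s by rewrite lt_neqAle eq_sym sn.
  have {}t0 : 0 < t by rewrite lt_neqAle eq_sym tn.
  rewrite abE log_mean_gt0E//; apply: le_Rintegral => //.
  + by apply: integrable_01; exact: continuous_expR_affine.
  + apply: integrable_01 => p.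
    exact: (@continuousD _ _ _ (fun x => g x * ((1 - x) / S) * s)
      (fun x => g x * (x / T) * t) p (cM _ s c1 p) (cM _ t c2 p)).
  + by move=> p /=; rewrite in_itv/= => p01; exact: weighted_amgm.
Qed.

Lemma log_mean_le (s t S T : R) : 0 <= s <= S -> 0 <= t <= T ->
  log_mean s t <= log_mean S T.
Proof.
move=> /andP[s0 sS] /andP[t0 tT].
have [st|] := boolP ((s == 0) || (t == 0)).
  by rewrite log_mean_eq0// log_mean_ge0.
rewrite negb_or => /andP[sn tn].
have S0 : 0 < S by rewrite (lt_le_trans _ sS)// lt_neqAle eq_sym sn.
have T0 : 0 < T by rewrite (lt_le_trans _ tT)// lt_neqAle eq_sym tn.
have [[a b] /= [a0 b0 <-]] := log_mean_tangent S0 T0.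
move=> /(_ s t s0 t0) /le_trans; apply.
by apply: lerD; apply: ler_wpM2l.
Qed.

Lemma log_mean_ge_min (m s t : R) : 0 <= m -> m <= s -> m <= t -> m <= log_mean s t.
Proof. by move=> m0 ms mt; rewrite -{1}(log_mean_diag m0) log_mean_le// m0. Qed.

Lemma log_mean_gt0 s t : 0 < s -> 0 < t -> 0 < log_mean s t.
Proof.
move=> s0 t0; apply: (@lt_le_trans _ _ (Num.min s t)).
  by rewrite lt_min s0.
by apply: log_mean_ge_min; rewrite ?ge_min ?lexx ?orbT// le_min !ltW.
Qed.

Lemma log_mean_le_max (m s t : R) : 0 <= s <= m -> 0 <= t <= m -> log_mean s t <= m.
Proof.
move=> s0 t0; rewrite -[leRHS](@log_mean_diag m) ?log_mean_le//.
by case/andP: s0 => a b; exact: le_trans b.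
Qed.

Lemma log_meanZ c s t : 0 < c -> 0 <= s -> 0 <= t ->
  log_mean (c * s) (c * t) = c * log_mean s t.
Proof.
move=> c0 s0 t0.
have [st|] := boolP ((s == 0) || (t == 0)).
  by rewrite !log_mean_eq0 ?mulr0//; case/orP: st => /eqP->; rewrite mulr0 eqxx ?orbT.
rewrite negb_or => /andP[sn tn].
have {}s0 : 0 < s by rewrite lt_neqAle eq_sym sn.
have {}t0 : 0 < t by rewrite lt_neqAle eq_sym tn.
have [->|st] := eqVneq s t; first by rewrite !log_mean_diag// ?mulr_ge0 ?ltW.
rewrite !log_mean_neqE ?mulr_gt0//; last first.
  by apply: contra st => /eqP /mulfI => /(_ (lt0r_neq0 c0)) ->.
by rewrite !lnM ?posrE// opprD addrACA subrr add0r -mulrBr mulrA.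
Qed.

(** The supporting plane passes through the origin, so it can be summed against the weights
    directly. The slack between the sums and [S], [T] leaves room for a constant added to keep a
    mixture positive. *)
Lemma log_mean_concave (I : finType) (a s t : I -> R) (S T : R) :
  (forall i, 0 <= a i) -> (forall i, 0 <= s i) -> (forall i, 0 <= t i) ->
  0 < S -> 0 < T ->
  \sum_i a i * s i <= S -> \sum_i a i * t i <= T ->
  \sum_i a i * log_mean (s i) (t i) <= log_mean S T.
Proof.
move=> a0 s0 t0 S0 T0 hS hT.
have [[al be] /= [al0 be0 <-] tg] := log_mean_tangent S0 T0.
apply: (@le_trans _ _ (al * (\sum_i a i * s i) + be * (\sum_i a i * t i))); last first.
  by apply: lerD; apply: ler_wpM2l.
rewrite !mulr_sumr -big_split/=; apply: ler_sum => i _.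
have := ler_wpM2l (a0 i) (tg _ _ (s0 i) (t0 i)).
by congr (_ <= _); rewrite /=; ring.
Qed.

Lemma measurable_invr (D : set R) : measurable_fun D (@GRing.inv R).
Proof.
apply: measurable_funTS.
rewrite (_ : @GRing.inv R = fun x => if x == 0 then 0 else x^-1); last first.
  by apply/funext => x; case: eqVneq => // ->; rewrite invr0.
rewrite -(setUv [set (0:R)]).
apply/measurable_funU => //; first exact: measurableC.
split.
  apply: (eq_measurable_fun (cst (0:R))) => [x|].
    by rewrite inE/= => ->; rewrite eqxx.
  exact: measurable_cst.
apply: (eq_measurable_fun (fun x : R => x^-1)).
  by move=> x; rewrite inE/= => /eqP/negbTE ->.
apply: open_continuous_measurable_fun.
  by apply: closed_openC; apply: accessible_closed_set1; apply: hausdorff_accessible; exact: Rhausdorff.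
by move=> x; rewrite inE/= => /eqP x0; exact: inv_continuous.
Qed.

(** The closed formula replaces the parametric integral, and measurability reduces to a case
    split. *)
Lemma measurable_log_mean d (T : measurableType d) (D : set T) (f g : T -> R) :
  measurable D -> measurable_fun D f -> measurable_fun D g ->
  (forall x, D x -> 0 <= f x) -> (forall x, D x -> 0 <= g x) ->
  measurable_fun D (fun x => log_mean (f x) (g x)).
Proof.
move=> mD mf mg f0 g0.
pose h x := if f x == g x then f x
   else if (0 < f x) && (0 < g x) then (g x - f x) * (ln (g x) - ln (f x))^-1 else 0.
apply: (eq_measurable_fun h) => [x|].
  rewrite inE => Dx; rewrite /h; case: eqVneq => [<-|fg].
    by rewrite log_mean_diag ?f0.
  case: ifPn => [/andP[? ?]|]; first by rewrite log_mean_neqE.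
  rewrite negb_and -!leNgt => hh; rewrite log_mean_eq0//.
  by case/orP: hh => h0; apply/orP; [left|right]; rewrite eq_le h0 ?f0 ?g0.
apply: measurable_fun_if => //.
- exact: measurable_fun_eqr.
- by apply: measurable_funS mf => //; exact: subIsetl.
- have mE : measurable (D `&` (fun x : T => f x == g x) @^-1` [set false]).
    exact: measurable_fun_eqr.
  have sub : (D `&` (fun x : T => f x == g x) @^-1` [set false]) `<=` D by exact: subIsetl.
  apply: measurable_fun_if => //.
  + apply: measurable_and.
      by apply: measurable_fun_ltr => //; exact: measurable_funS mf.
    by apply: measurable_fun_ltr => //; exact: measurable_funS mg.
  + set E := _ `&` _.
    have subE : E `<=` D by move=> x [[]].
    have mf' : measurable_fun E f by exact: measurable_funS mf.
    have mg' : measurable_fun E g by exact: measurable_funS mg.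
    apply: measurable_funM; first exact: measurable_funB.
    apply: (measurableT_comp (@measurable_invr setT)).
    by apply: measurable_funB; apply: (measurableT_comp (@measurable_ln R)).
Qed.

End LogMean.

(** * Absolutely continuous functions on an interval *)

Section AbsoluteContinuity.
Context {R : realType}.
Implicit Types (f g : R -> R) (a b c d : R).
Local Notation AC := absolutely_continuous_on.

Lemma ac_eq a b f g : (forall t, a <= t <= b -> f t = g t) -> AC a b f -> AC a b g.
Proof.
move=> fg acf e e0; have [del del0 h] := acf e e0; exists del => // n u v uv dis lt.
have := h n u v uv dis lt; congr (_ < _); apply: eq_bigr => i _.
have /and3P[h1 h2 h3] := uv i.
by rewrite !fg//; apply/andP; split; rewrite // ?(le_trans h1 h2) ?(le_trans h2 h3).
Qed.

Lemma ac_sub a b c d f : a <= c -> d <= b -> AC a b f -> AC c d f.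
Proof.
move=> ac db acf e e0; have [del del0 h] := acf e e0; exists del => // n u v uv.
apply: h => i; have /and3P[? ? ?] := uv i; apply/and3P; split => //.
  exact: le_trans ac _.
exact: le_trans db.
Qed.

Lemma ac_lipschitz a b f (K : R) :
  (forall s t, a <= s -> s <= t -> t <= b -> `|f t - f s| <= K * (t - s)) -> AC a b f.
Proof.
move=> lip e e0; exists (e / (`|K| + 1)).
  by rewrite divr_gt0// ltr_wpDl.
move=> n u v uv dis lt.
apply: (@le_lt_trans _ _ (\sum_(i < n) (`|K| + 1) * (v i - u i))).
  apply: ler_sum => i _; have /and3P[ui uvi vi] := uv i.
  apply: (le_trans (lip _ _ ui uvi vi)); apply: ler_wpM2r.
    by rewrite subr_ge0.
  by rewrite (le_trans (ler_norm K))// lerDl.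
by rewrite -mulr_sumr mulrC -ltr_pdivlMr// ltr_wpDl.
Qed.

Lemma ac_cst a b (k : R) : AC a b (fun=> k).
Proof. by apply: (@ac_lipschitz _ _ _ 0) => s t _ _ _; rewrite subrr normr0 mul0r. Qed.

Lemma ac_deriv a b f (f' : R -> R) (K : R) :
  (forall t, a <= t <= b -> is_derive t (1 : R) f (f' t)) ->
  (forall t, a <= t <= b -> `|f' t| <= K) -> AC a b f.
Proof.
move=> df bf; apply: (@ac_lipschitz _ _ _ K) => s t sa st tb.
have [r /andP[sr rt]|r /andP[sr rt] ->] := @mvt R f f' s t st.
  by apply: df; rewrite (le_trans sa)//= (le_trans rt).
rewrite normrM (ger0_norm (_ : 0 <= t - s)) ?subr_ge0//; apply: ler_wpM2r.
  by rewrite subr_ge0.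
by apply: bf; rewrite (le_trans sa)//= (le_trans rt).
Qed.

Lemma acD a b f g : AC a b f -> AC a b g -> AC a b (fun t => f t + g t).
Proof.
move=> acf acg e e0.
have e20 : 0 < e / 2 by rewrite divr_gt0.
have [d1 d10 h1] := acf _ e20; have [d2 d20 h2] := acg _ e20.
exists (Num.min d1 d2); first by rewrite lt_min d10.
move=> n u v uv dis; rewrite lt_min => /andP[lt1 lt2].
apply: (@le_lt_trans _ _ (\sum_(i < n) `|f (v i) - f (u i)| +
    \sum_(i < n) `|g (v i) - g (u i)|)).
  rewrite -big_split/=; apply: ler_sum => i _.
  by rewrite opprD addrACA ler_normD.
by rewrite [ltRHS]splitr; apply: ltrD; [exact: h1|exact: h2].
Qed.

Lemma acZ a b f (k : R) : AC a b f -> AC a b (fun t => k * f t).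
Proof.
move=> acf e e0.
have k0 : 0 < `|k| + 1 by rewrite ltr_wpDl.
have [d1 d10 h1] := acf _ (divr_gt0 e0 k0).
exists d1 => // n u v uv dis lt.
apply: (@le_lt_trans _ _ ((`|k| + 1) * (\sum_(i < n) `|f (v i) - f (u i)|))).
  rewrite mulr_sumr; apply: ler_sum => i _.
  by rewrite -mulrBr normrM; apply: ler_wpM2r => //; rewrite lerDl.
by rewrite mulrC -ltr_pdivlMr// h1.
Qed.

Lemma ac_sum (I : Type) (r : seq I) a b (F : I -> R -> R) :
  (forall i, AC a b (F i)) -> AC a b (fun t => \sum_(i <- r) F i t).
Proof.
move=> h; elim: r => [|i r ih].
  by apply: (@ac_eq _ _ (fun=> 0)) (@ac_cst _ _ _) => t _; rewrite big_nil.
by apply: ac_eq (acD (h i) ih) => t _; rewrite big_cons.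
Qed.

Lemma ac_affine a b c d (p k : R) f : k != 0 ->
  (forall t, c <= t <= d -> a <= p + t * k <= b) ->
  AC a b f -> AC c d (fun t => f (p + t * k)).
Proof.
move=> k0 cdab acf e e0; have [del del0 h] := acf e e0.
have nk : 0 < `|k| by rewrite normr_gt0.
exists (del / `|k|); first by rewrite divr_gt0.
move=> n u v uv dis lt.
pose al t := p + t * k.
(* For [k < 0] the map reverses order, so each image interval is reoriented. *)
pose u' i := Num.min (al (u i)) (al (v i)).
pose v' i := Num.max (al (u i)) (al (v i)).
have E i : `|f (v' i) - f (u' i)| = `|f (al (v i)) - f (al (u i))|.
  by rewrite /u' /v'; case: leP => // _; rewrite distrC.
rewrite [ltLHS](_ : _ = \sum_(i < n) `|f (v' i) - f (u' i)|); last first.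
  by apply: eq_bigr => i _; rewrite E.
apply: h => [i|i j ij|].
- have /and3P[cu uvi vd] := uv i.
  have /andP[? ?] := cdab (u i) (introT andP (conj cu (le_trans uvi vd))).
  have /andP[? ?] := cdab (v i) (introT andP (conj (le_trans cu uvi) vd)).
  rewrite /u' /v' /al le_min ge_max; apply/and3P; split; try exact/andP.
  by rewrite ge_min !le_max !lexx.
- apply/seteqP; split => // x [/=]; rewrite !in_itv/= => /andP[x1 x2] /andP[x3 x4].
  have inv s t : Num.min (al s) (al t) < x -> x < Num.max (al s) (al t) -> s <= t ->
      s < (x - p) / k < t.
    move=> h1 h2 st.
    case: (ltgtP k 0) => [kn|kp|ke]; last by rewrite ke eqxx in k0.
      have als : al t <= al s by rewrite /al lerD2l ler_wnM2r// ltW.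
      rewrite /al in h1 h2 als.
      move: h1 h2; rewrite min_r// max_l// => h1 h2.
      by rewrite ltr_ndivrMr// ltr_ndivlMr//; apply/andP; split; lra.
    have als : al s <= al t by rewrite /al lerD2l ler_wpM2r// ltW.
    rewrite /al in h1 h2 als.
    move: h1 h2; rewrite min_l// max_r// => h1 h2.
    by rewrite ltr_pdivrMr// ltr_pdivlMr//; apply/andP; split; lra.
  have /and3P[_ uvi _] := uv i; have /and3P[_ uvj _] := uv j.
  have := dis i j ij; rewrite -subset0 => /(_ ((x - p) / k)); apply.
  by split => /=; rewrite in_itv/=; exact: inv.
- rewrite [ltLHS](_ : _ = \sum_(i < n) `|k| * (v i - u i)); last first.
    apply: eq_bigr => i _; have /and3P[_ uvi _] := uv i.
    rewrite /u' /v' /al.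
    case: (ltgtP k 0) => [kn|kp|ke]; last by rewrite ke eqxx in k0.
      have als : p + v i * k <= p + u i * k by rewrite lerD2l ler_wnM2r// ltW.
      by rewrite min_r// max_l// ltr0_norm//; ring.
    have als : p + u i * k <= p + v i * k by rewrite lerD2l ler_wpM2r// ltW.
    by rewrite min_l// max_r// gtr0_norm//; ring.
  by rewrite -mulr_sumr mulrC -ltr_pdivlMr.
Qed.

Lemma ac_glue a c b f : a <= c <= b -> AC a c f -> AC c b f -> AC a b f.
Proof.
move=> /andP[ac cb] acf acg e e0.
have e20 : 0 < e / 2 by rewrite divr_gt0.
have [d1 d10 h1] := acf _ e20; have [d2 d20 h2] := acg _ e20.
exists (Num.min d1 d2); first by rewrite lt_min d10.
move=> n u v uv dis; rewrite lt_min => /andP[lt1 lt2].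
(* Truncating by [min] and [max] with [c] cuts an interval that straddles [c] in two; for any other
   interval one of the two pieces is degenerate. *)
have mM i : `|f (v i) - f (u i)| <= `|f (Num.min (v i) c) - f (Num.min (u i) c)| +
    `|f (Num.max (v i) c) - f (Num.max (u i) c)|.
  have /and3P[_ uvi _] := uv i.
  case: (leP (v i) c) => vc; case: (leP (u i) c) => uc.
  - by rewrite subrr normr0 addr0.
  - by have := lt_le_trans uc (le_trans uvi vc); rewrite ltxx.
  - by rewrite -[leLHS](_ : `|(f c - f (u i)) + (f (v i) - f c)| = _) ?ler_normD//; congr `|_|; ring.
  - by rewrite subrr normr0 add0r.
have len i : Num.min (v i) c - Num.min (u i) c <= v i - u i /\
             Num.max (v i) c - Num.max (u i) c <= v i - u i.
  have /and3P[_ uvi _] := uv i.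
  move: uvi; move: (u i) (v i) => x y; clear => xy.
  by case: (leP y c) => vc; case: (leP x c) => uc; split; lra.
apply: (le_lt_trans (ler_sum _ (fun i _ => mM i))).
rewrite big_split/= [ltRHS]splitr; apply: ltrD.
- apply: h1 => [i|i j ij|].
  + have /and3P[aui uvi _] := uv i; apply/and3P; split.
    * by rewrite le_min aui.
    * by rewrite le_min !ge_min uvi lexx orbT.
    * by rewrite ge_min lexx orbT.
  + apply/seteqP; split => // x [/=]; rewrite !in_itv/= => /andP[x1 x2] /andP[x3 x4].
    have := dis i j ij; rewrite -subset0 => /(_ x); apply.
    move: x1 x2 x3 x4; rewrite !gt_min !lt_min => x1 /andP[x2 xc] x3 /andP[x4 _].
    move: x1 x3; rewrite [c < x]ltNge (ltW xc)/= !orbF => x1 x3.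
    by split => /=; rewrite in_itv/=; apply/andP.
  + apply: le_lt_trans lt1; apply: ler_sum => i _; exact: (len i).1.
- apply: h2 => [i|i j ij|].
  + have /and3P[_ uvi vib] := uv i; apply/and3P; split.
    * by rewrite le_max lexx orbT.
    * by rewrite ge_max !le_max uvi lexx !orbT.
    * by rewrite ge_max vib.
  + apply/seteqP; split => // x [/=]; rewrite !in_itv/= => /andP[x1 x2] /andP[x3 x4].
    have := dis i j ij; rewrite -subset0 => /(_ x); apply.
    move: x1 x2 x3 x4; rewrite !gt_max !lt_max => /andP[x1 xc] x2 /andP[x3 _] x4.
    move: x2 x4; rewrite [x < c]ltNge (ltW xc)/= !orbF => x2 x4.
    by split => /=; rewrite in_itv/=; apply/andP.
  + apply: le_lt_trans lt2; apply: ler_sum => i _; exact: (len i).2.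
Qed.

Lemma ac1 a b f : AC a b f -> forall e : R, 0 < e -> exists2 del : R, 0 < del &
  forall s t, a <= s -> s <= t -> t <= b -> t - s < del -> `|f t - f s| < e.
Proof.
move=> acf e e0; have [del del0 h] := acf e e0; exists del => // s t sa st tb ts.
have := h 1%N (fun=> s) (fun=> t); rewrite !big_ord1; apply => //.
  by move=> _; rewrite sa st.
by move=> i j; rewrite !ord1 eqxx.
Qed.

(** Precomposition with the clamp onto [[a, b]] gives a function continuous on the whole line. *)
Lemma ac_measurable a b f : AC a b f -> measurable_fun (`[a, b]%classic : set R) f.
Proof.
move=> acf; have [ab|ba] := leP a b; last first.
  rewrite set_itv_ge; last by rewrite bnd_simp -ltNge.
  exact: measurable_fun_set0.
pose cl (t : R) := Num.max a (Num.min t b).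
have clab t : a <= cl t <= b by rewrite /cl le_max lexx/= ge_max ab ge_min lexx orbT.
have cll s t : s <= t -> cl s <= cl t /\ cl t - cl s <= t - s.
  rewrite /cl => st.
  move: ab st; clear => ab st.
  by case: (leP t b) => tb; case: (leP s b) => sb; case: (leP a s) => h1; case: (leP a t) => h2;
    rewrite ?(max_r ab); split; lra.
have cg : continuous (fun t => f (cl t)).
  move=> x; apply/cvgrPdist_lt => e e0.
  have [del del0 h] := ac1 acf e0.
  near=> t.
  have xt : `|x - t| < del by near: t; exact: cvgr_dist_lt.
  case: (leP x t) => [xlet|/ltW tlex].
    have [h1 h2] := cll _ _ xlet.
    rewrite distrC; apply: h => //; [by case/andP: (clab x)|by case/andP: (clab t)|].
    by apply: (le_lt_trans h2); move: xt; rewrite distrC ger0_norm// subr_ge0.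
  have [h1 h2] := cll _ _ tlex.
  apply: h => //; [by case/andP: (clab t)|by case/andP: (clab x)|].
  by apply: (le_lt_trans h2); move: xt; rewrite ger0_norm// subr_ge0.
apply: (eq_measurable_fun (fun t => f (cl t))).
  move=> x; rewrite inE/= in_itv/= => /andP[ax xb].
  by rewrite /cl min_l// max_r.
by apply: measurable_funTS; exact: continuous_measurable_fun.
Unshelve. all: by end_near. Qed.

End AbsoluteContinuity.

(** * Increments of absolutely continuous functions bounded by integrals *)

Section ACIntegral.
Context {R : realType}.
Implicit Types (f g Phi : R -> R) (a b t : R) (U N : set R) (s : seq (R * R)).
Local Notation mu := (@lebesgue_measure R).
Local Notation AC := absolutely_continuous_on.

(** Listed from right to left, so that a sweep to the right extends a chain by [cons]. *)
Definition interval_chain U a t s :=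
  [/\ pairwise (fun p q : R * R => q.2 <= p.1) s,
      all (fun p : R * R => [&& a <= p.1, p.1 <= p.2 & p.2 <= t]) s &
      forall p, p \in s -> `]p.1, p.2[ `<=` U].

(** The cut at [t] drives the induction: the tail is measured up to the left end of the head
    interval, hence disjointly from it. *)
Lemma interval_chain_length U a t s : open U -> interval_chain U a t s ->
  ((\sum_(p <- s) (p.2 - p.1))%:E <= mu (U `&` `]-oo, t]))%E.
Proof.
move=> oU; have mU : measurable U by exact: open_measurable.
elim: s t => [|p s ih] t [/=]; first by rewrite big_nil measure_ge0.
move=> /andP[/allP ps pw] /andP[/and3P[ap pp pt] /allP al] sU.
rewrite big_cons EFinD.
have /ih h : interval_chain U a p.1 s.
  split => //; last by move=> q qs; apply: sU; rewrite inE qs orbT.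
  by apply/allP => q qs; have /and3P[-> -> _] := al q qs; rewrite /= ps.
apply: (le_trans (leeD2l _ h)).
have -> : ((p.2 - p.1)%:E = mu `]p.1, p.2[)%E.
  rewrite lebesgue_measure_itv/= lte_fin; case: ltP => // pp'.
  by congr EFin; apply/eqP; rewrite subr_eq0 eq_le pp pp'.
rewrite -measureU//; last 2 first.
- by apply: measurableI.
- rewrite -subset0 => x [/=]; rewrite !in_itv/= => /andP[px _] [_ xp].
  by have := lt_le_trans px xp; rewrite ltxx.
apply: le_measure; rewrite ?inE.
- by apply: measurableU => //; exact: measurableI.
- exact: measurableI.
- move=> x [/= xp|[Ux /=]].
    split; first by apply: (sU p) => //; rewrite inE eqxx.
    by move: xp; rewrite /= !in_itv/= => /andP[_ /ltW/le_trans]; apply.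
  rewrite !in_itv/= => xp; split => //.
  by apply: (le_trans xp); exact: le_trans pt.
Qed.

Lemma interval_chain_variation U a b f (e : R) : 0 < e -> AC a b f ->
  exists2 del : R, 0 < del & forall U, open U -> (mu U < del%:E)%E ->
    forall t s, t <= b -> interval_chain U a t s ->
      \sum_(p <- s) `|f p.2 - f p.1| < e.
Proof.
move=> e0 acf; have [del del0 h] := acf e e0; exists del => // V oV Vdel t s tb ch.
have len : \sum_(p <- s) (p.2 - p.1) < del.
  rewrite -lte_fin; apply: le_lt_trans Vdel.
  apply: (le_trans (interval_chain_length oV ch)).
  have mV := open_measurable oV.
  by apply: le_measure; rewrite ?inE//; exact: measurableI.
case: ch => pw /allP al _.
pose nt i := nth (0, 0) s i.
have ns i : (i < size s)%N -> nt i \in s by move=> ?; exact: mem_nth.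
have H := h (size s) (fun i => (nt i).1) (fun i => (nt i).2).
rewrite (big_nth (0, 0)) big_mkord in len.
rewrite (big_nth (0, 0)) big_mkord; apply: H => //.
- by move=> i; have /and3P[-> -> /=] := al _ (ns i (ltn_ord i)); move/le_trans; apply.
- move=> i j ij; rewrite -subset0 => x [/=]; rewrite !in_itv/=.
  move=> /andP[x1 x2] /andP[x3 x4].
  have /(pairwiseP (0, 0)) pw' := pw.
  have [lt|lt|eq] := ltngtP i j; last by move/eqP: ij; apply; exact: val_inj.
  + have := pw' i j (ltn_ord i) (ltn_ord j) lt.
    by move=> /= /(lt_le_trans x4) /(lt_trans x1); rewrite ltxx.
  + have := pw' j i (ltn_ord j) (ltn_ord i) lt.
    by move=> /= /(lt_le_trans x2) /(lt_trans x3); rewrite ltxx.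
Qed.

(* Real induction on [t]: near a point of the null set [N] the increments of
   [f] are charged to an interval chain inside a small open neighbourhood of
   [N], elsewhere they are controlled by those of [Phi]. *)
Lemma ac_local_growth a b f Phi N : a <= b -> AC a b f ->
  measurable N -> mu N = 0 ->
  (forall t u, a <= t -> t <= u -> u <= b -> Phi t <= Phi u) ->
  (forall t, a <= t <= b -> ~ N t -> forall e : R, 0 < e ->
     exists2 r : R, 0 < r & forall u, `|u - t| < r -> a <= u <= b ->
       (t <= u -> f u - f t <= Phi u - Phi t + e * (u - t)) /\
       (u <= t -> f t - f u <= Phi t - Phi u + e * (t - u))) ->
  f b - f a <= Phi b - Phi a.
Proof.
move=> ab acf mN N0 ndPhi loc.
suff key (e : R) : 0 < e -> f b - f a <= Phi b - Phi a + e * (b - a) + e.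
  apply/ler_addgt0Pr => e e0.
  have k0 : 0 < b - a + 1 by rewrite ltr_wpDl// subr_ge0.
  have := key (e / (b - a + 1)) (divr_gt0 e0 k0); congr (_ <= _).
  rewrite -addrA; congr (_ + _).
  by rewrite -[X in _ + X]mulr1 -mulrDr divfK ?gt_eqF.
move=> e0; have [del del0 hdel] := interval_chain_variation setT e0 acf.
have [U [oU NU Ulte]] : exists U : set R, [/\ open U, N `<=` U & (mu U < del%:E)%E].
  have [|U [oU NU Ue]] := @lebesgue_regularity_outer R N del mN _ del0.
    exact: (eq_ind_r (fun z => z < +oo)%E (ltry 0) N0).
  exists U; split => //; apply: le_lt_trans Ue.
  have mU := open_measurable oU.
  have {1}-> : U = N `|` (U `\` N) by rewrite setDE setUIr setUv setIT; apply/seteqP; split => x; [right|case=> // /NU].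
  apply: (@le_trans _ _ (mu N + mu (U `\` N))%E).
    by apply: measureU2 => //; exact: (@measurableD _ (measurableTypeR R)).
  by rewrite [X in (X + _ <= _)%E]N0 add0e.
pose var s := \sum_(p <- s) `|f p.2 - f p.1|.
pose A := [set t | a <= t <= b /\ exists2 s, interval_chain U a t s &
   f t - f a <= Phi t - Phi a + e * (t - a) + var s].
have Aa : A a.
  split; first by rewrite lexx.
  by exists [::] => //; rewrite /var big_nil !subrr mulr0 !addr0.
have step t : a <= t <= b -> exists2 r : R, 0 < r &
    forall u w, `|u - t| < r -> `|w - t| < r -> u <= t -> t <= w -> w <= b -> A u -> A w.
  move=> tab.
  have [Ut|NUt] := pselect (U t).
    have [r r0 rU] : exists2 r : R, 0 < r & forall u, `|u - t| < r -> U u.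
      have [r /= r0 rU] := oU t Ut.
      by exists r => // u ur; apply: rU; rewrite /ball /= distrC.
    exists r => // u w ur wr ut tw wb [/andP[au ub] [s [pw al sU] hs]].
    have uw := le_trans ut tw.
    split; first by rewrite (le_trans au uw).
    exists ((u, w) :: s); first split => //=.
    - rewrite pw andbT; apply: sub_all al => p; by case/and3P.
    - rewrite au uw lexx/=; apply: sub_all al => p /and3P[-> -> /=].
      by move/le_trans; apply.
    - move=> p; rewrite inE => /predU1P[->|/sU//] x /=; rewrite in_itv/= => /andP[ux xw].
      apply: rU; move: ur wr; rewrite !ltr_norml => /andP[h1 h2] /andP[h3 h4].
      by apply/andP; split; lra.
    - rewrite /var big_cons/= -/(var s).
      have h1 := ler_norm (f w - f u).
      have h2 := ndPhi u w au uw wb.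
      have h3 : e * (u - a) <= e * (w - a) by rewrite ler_pM2l// lerD2r.
      by move: h1 h2 h3 hs; clear; lra.
  have nNt : ~ N t by move/NU.
  have [r r0 hr] := loc t tab nNt e e0.
  exists r => // u w ur wr ut tw wb [/andP[au ub] [s [pw al sU] hs]].
  have uw := le_trans ut tw.
  split; first by rewrite (le_trans au uw).
  exists s; first split => //.
    apply: sub_all al => p /and3P[-> -> /=].
    by move/le_trans; apply.
  have [_ /(_ ut) h1] := hr u ur (introT andP (conj au ub)).
  have [/(_ tw) h2 _] := hr w wr (introT andP (conj (le_trans au uw) wb)).
  by move: h1 h2 hs; clear; lra.
have hsA : has_sup A by split; [exists a|exists b => t [/andP[]]].
have ac : a <= sup A by exact: sup_upper_bound.
have cb : sup A <= b by apply: sup_le_ub => [|t [/andP[]]//]; exists a.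
have [r r0 hr] := step (sup A) (introT andP (conj ac cb)).
(* The local step carries a point of [A] near [sup A] to [w], which would exceed [sup A] unless
   [w = b]. *)
have [t At tr] := sup_adherent r0 hsA.
have tA : t <= sup A by exact: sup_upper_bound.
pose w := Num.min (sup A + r / 2) b.
have r20 : 0 < r / 2 by rewrite divr_gt0.
have wA : A w.
  apply: (hr t) => //.
  - by rewrite ler0_norm ?subr_le0//; move: tr; clear; lra.
  - rewrite /w; case: (leP (sup A + r / 2) b) => h; first by rewrite addrC addKr gtr0_norm//; move: r0; clear; lra.
    by rewrite ger0_norm ?subr_ge0//; move: h r0; clear; lra.
  - by rewrite /w le_min cb andbT lerDl ltW.
  - by rewrite /w ge_min lexx orbT.
have wsup : w <= sup A by exact: sup_upper_bound.
have wb : w = b.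
  by move: wsup; rewrite /w; case: (leP (sup A + r / 2) b) => // _; rewrite gerDl leNgt r20.
move: wA; rewrite wb => -[_ [s ch]] /le_trans; apply.
by rewrite lerD2l ltW//; exact: (hdel U oU Ulte b).
Qed.

Lemma deriv_le0_growth f t (d e : R) : is_derive t (1 : R) f d -> d <= 0 -> 0 < e ->
  exists2 r : R, 0 < r & forall u, `|u - t| < r ->
    (t <= u -> f u - f t <= e * (u - t)) /\ (u <= t -> f t - f u <= e * (t - u)).
Proof.
move=> [df fd] d0 e0.
have := df; rewrite /derivable => /cvg_ex[l hl].
have ld : l = d by rewrite -fd; apply/esym/cvg_lim.
move: hl; rewrite ld => /cvgrPdist_lt /(_ e e0) [r /= r0 hr].
have key u : `|u - t| < r -> u != t -> (u - t)^-1 * (f u - f t) < e.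
  move=> ur ut; have h0 : u - t != 0 by rewrite subr_eq0.
  have := hr (u - t); rewrite /= sub0r normrN => /(_ ur h0).
  rewrite /GRing.scale/= mulr1 subrK => h.
  have := le_lt_trans (ler_norm _) h; rewrite ltrBlDr.
  rewrite distrC in h; have := le_lt_trans (ler_norm _) h.
  by move: d0; clear; lra.
exists r => // u ur; have [->|ut] := eqVneq u t.
  by rewrite !subrr mulr0.
have := key u ur ut; split => tu.
  have h0 : 0 < u - t by rewrite subr_gt0 lt_neqAle eq_sym ut.
  by rewrite -ler_pdivrMr// mulrC ltW.
have h0 : 0 < t - u by rewrite subr_gt0 lt_neqAle ut.
rewrite -ler_pdivrMr// ltW//; apply: le_lt_trans (key u ur ut).
by rewrite -(opprB u t) -(opprB (f u)) invrN mulrNN mulrC.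
Qed.

(** Compare [f] with the primitive [F] of [g] extended by zero. Lebesgue differentiation gives
    [F' = g] almost everywhere on the interval, so [f - F] has nonpositive derivative off a null
    set, and [ac_local_growth] applies with the nondecreasing [F] as [Phi]. *)
Lemma ac_le_integral a b f g : a <= b -> AC a b f ->
  measurable_fun (`[a, b]%classic : set R) g -> (forall t, a <= t <= b -> 0 <= g t) ->
  {ae mu, forall t, a <= t <= b -> derivable f t 1 /\ derive1 f t <= g t} ->
  ((f b - f a)%:E <= \int[mu]_(t in `[a, b]) (g t)%:E)%E.
Proof.
move=> ab acf mg g0 hae.
have g0' t : `[a, b]%classic t -> (0 <= (g t)%:E)%E.
  by rewrite /= in_itv/= lee_fin => ?; exact: g0.
have [|gfin] := leP (+oo)%E (\int[mu]_(t in `[a, b]) (g t)%:E)%E.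
  by rewrite leye_eq => /eqP ->; rewrite leey.
have ig : mu.-integrable `[a, b] (EFin \o g).
  apply/integrableP; split; first exact/measurable_EFinP.
  rewrite (_ : (\int[_]_(x in _) _)%E = (\int[mu]_(t in `[a, b]) (g t)%:E)%E)//.
  by apply: eq_integral => t; rewrite inE => /g0' h /=; rewrite ger0_norm// -lee_fin.
pose gg := g \_ `[a, b].
have gg0 t : 0 <= gg t.
  by rewrite /gg patchE; case: ifPn => //; rewrite inE/= in_itv => /g0.
have igg : mu.-integrable setT (EFin \o gg).
  by rewrite -restrict_EFin; apply/integrable_restrict => //; rewrite setTI.
have iggD D : measurable D -> mu.-integrable D (EFin \o gg).
  by move=> mD; apply: integrableS igg.
have locgg : locally_integrable setT gg by exact: open_integrable_locally openT igg.
pose F x := Rintegral mu `]-oo, x] gg.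
have aeF := @FTC1Ny R gg (fun y => iggD _ (measurable_itv _)) locgg.
have Fnd t u : t <= u -> F t <= F u.
  move=> tu; rewrite /F /Rintegral fine_le//.
  - exact: integrable_fin_num (iggD _ _).
  - exact: integrable_fin_num (iggD _ _).
  apply: ge0_subset_integral => //.
  - by have /integrableP[] := iggD _ (measurable_itv `]-oo, u]).
  - by move=> x _; rewrite lee_fin.
  - by apply: subset_itvl; rewrite bnd_simp.
have Fab : F b - F a <= fine (\int[mu]_(t in `[a, b]) (g t)%:E).
  have Fa : 0 <= F a by apply: Rintegral_ge0 => x _; exact: gg0.
  apply: (@le_trans _ _ (F b)); first by rewrite gerBl.
  rewrite /F /Rintegral integral_mkcond [in leRHS]integral_mkcond fine_le//.
  - by rewrite -integral_mkcond; exact: integrable_fin_num (iggD _ _).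
  - by rewrite -integral_mkcond; exact: integrable_fin_num.
  apply: ge0_le_integral => //.
  - move=> x _; rewrite patchE; case: ifP => // _; by rewrite lee_fin.
  - apply/(measurable_restrictT _ _).1 => //.
    by have /integrableP[] := iggD _ (measurable_itv `]-oo, b]).
  - by apply/(measurable_restrictT _ _).1 => //; exact/measurable_EFinP.
  - move=> x _; rewrite !patchE; case: ifP => // _; last first.
      by case: ifPn => //; rewrite inE => /g0'.
    by rewrite /gg patchE; case: ifP.
rewrite -(@fineK _ (\int[mu]_(t in `[a, b]) (g t)%:E)%E); last exact: integrable_fin_num.
rewrite lee_fin; apply: le_trans Fab.
have [N [mN N0 hN]] : {ae mu, forall t, (a <= t <= b -> derivable f t 1 /\ derive1 f t <= g t) /\
    (derivable F t 1 /\ derive1 F t = gg t)}.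
  by apply: aeS2 hae aeF.
apply: (ac_local_growth ab acf mN N0) => [t u _ tu _|t tab nNt e e0]; first exact: Fnd.
have [hfg [dF Fg]] : (a <= t <= b -> derivable f t 1 /\ derive1 f t <= g t) /\
    (derivable F t 1 /\ derive1 F t = gg t).
  by apply: contrapT => h; apply: nNt; exact: hN.
have [df fg] := hfg tab.
have dd := derivD (derive1_deriv df) (derivZ (-1) (derive1_deriv dF)).
have [|r r0 hr] := deriv_le0_growth dd _ e0.
  rewrite Fg /gg patchE mem_set; last by rewrite /= in_itv.
  by rewrite mulN1r subr_le0.
exists r => // u ur _; have [h1 h2] := hr u ur; split => tu.
  by have := h1 tu; clear; lra.
by have := h2 tu; clear; lra.
Qed.

Lemma ac_norm_le_integral a b f g : a <= b -> AC a b f ->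
  measurable_fun (`[a, b]%classic : set R) g -> (forall t, a <= t <= b -> 0 <= g t) ->
  {ae mu, forall t, a <= t <= b -> derivable f t 1 /\ `|derive1 f t| <= g t} ->
  (`|f b - f a|%:E <= \int[mu]_(t in `[a, b]) (g t)%:E)%E.
Proof.
move=> ab acf mg g0 hae.
have h1 : ((f b - f a)%:E <= \int[mu]_(t in `[a, b]) (g t)%:E)%E.
  apply: ac_le_integral => //; apply: aeS hae => t h /h[df fg]; split => //.
  exact: le_trans (ler_norm _) fg.
have h2 : ((- f b - - f a)%:E <= \int[mu]_(t in `[a, b]) (g t)%:E)%E.
  apply: (@ac_le_integral a b (fun t => - f t)) => //.
    by apply: ac_eq (acZ (-1) acf) => t _; rewrite mulN1r.
  apply: aeS hae => t h /h[df fg].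
  have := derivZ (-1) (derive1_deriv df).
  rewrite (_ : (fun x => -1 * f x) = fun x => - f x); last by apply/funext => x; rewrite mulN1r.
  move=> /deriv_derive1[? ->]; split => //; rewrite mulN1r.
  by apply: le_trans fg; rewrite -normrN ler_norm.
have [h|h] := leP 0 (f b - f a); first by rewrite ger0_norm.
by rewrite ltr0_norm// opprB addrC -[f a]opprK.
Qed.

End ACIntegral.

(** * Affine change of variables, for reparametrised paths *)

Section AffineChangeOfVariables.
Context {R : realType}.
Implicit Types (p k t : R).
Local Notation mu := (@lebesgue_measure R).

Lemma measurable_affine p k : measurable_fun [set: measurableTypeR R]
  (fun t : measurableTypeR R => (p + t * k : measurableTypeR R)).
Proof. by apply: continuous_measurable_fun => t; exact: deriv_continuous (deriv_affine t p k). Qed.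

Lemma affine_preimage_itv p k (a b : R) : 0 < k ->
  (fun t : R => p + t * k) @^-1` `]a, b] = `](a - p) / k, (b - p) / k]%classic.
Proof.
move=> k0; apply/seteqP; split => t /=; rewrite !in_itv/= ltr_pdivrMr// ler_pdivlMr//;
  by rewrite ltrBlDl lerBrDl.
Qed.

Lemma affine_preimage_itvN p k (a b : R) : k < 0 ->
  (fun t : R => p + t * k) @^-1` `]a, b] = `[(b - p) / k, (a - p) / k[%classic.
Proof.
move=> k0; apply/seteqP; split => t /=; rewrite !in_itv/= ltr_ndivlMr// ler_ndivrMr//;
  by rewrite ltrBlDl lerBrDl andbC.
Qed.

(** Scaled by [|k|], the pushforward agrees with Lebesgue measure on half-open intervals, which
    characterises it. *)
Lemma lebesgue_measure_affine p k (A : set R) : k != 0 -> measurable A ->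
  (pushforward mu (fun t : measurableTypeR R => (p + t * k)%R : measurableTypeR R) A =
   (`|k|^-1)%:E * mu A)%E.
Proof.
move=> k0 mA.
pose al (t : measurableTypeR R) : measurableTypeR R := p + t * k.
have nk : 0 < `|k| by rewrite normr_gt0.
pose nk' := NngNum (ltW nk).
have h : mu A = mscale nk' (pushforward mu al) A.
  move=> mal; apply: lebesgue_measure_unique => //= _ [[a b]] _ <-.
  rewrite /mscale /pushforward /=.
  rewrite [X in (_ = _ * X)%E](_ : _ = (`|k|^-1)%:E * mu `]a, b]%classic)%E; last first.
    rewrite lebesgue_measure_itv/= lte_fin.
    case: (ltgtP k 0) => [kn|kp|ke]; last by rewrite ke eqxx in k0.
    - rewrite /pushforward [X in mu X](affine_preimage_itvN p a b kn) lebesgue_measure_itv/= lte_fin.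
      rewrite ltr_ndivrMr// divfK ?lt_eqF// ltrD2r.
      case: ifPn => _; last by rewrite mule0.
      by rewrite -!EFinB -EFinM ltr0_norm// invrN; congr EFin; ring.
    - rewrite /pushforward [X in mu X](affine_preimage_itv p a b kp) lebesgue_measure_itv/= lte_fin.
      rewrite ltr_pdivrMr// divfK ?gt_eqF// ltrD2r.
      case: ifPn => _; last by rewrite mule0.
      by rewrite -!EFinB -EFinM gtr0_norm//; congr EFin; ring.
  by rewrite muleA -EFinM divff ?gt_eqF// mul1e.
rewrite (h (measurable_affine p k)) /mscale/= muleA -EFinM mulVf ?gt_eqF// mul1e.
by [].
Qed.

Lemma ge0_integral_affine p k (D : set R) (f : R -> \bar R) : k != 0 -> measurable D ->
  measurable_fun D f -> (forall t, D t -> (0 <= f t)%E) ->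
  (\int[mu]_(t in (fun t => p + t * k)%R @^-1` D) f (p + t * k)%R =
   (`|k|^-1)%:E * \int[mu]_(t in D) f t)%E.
Proof.
move=> k0 mD mf f0.
have f0' : {in D, forall y, (0 <= f y)%E} by move=> y; rewrite inE; exact: f0.
rewrite -(@ge0_integral_pushforward _ _ (measurableTypeR R) (measurableTypeR R) R _
  (measurable_affine p k) mu D f mD mf f0').
have nk : 0 <= `|k|^-1 by rewrite invr_ge0.
pose nk' := NngNum nk.
rewrite (@eq_measure_integral _ (measurableTypeR R) R D (mscale nk' mu))/=; last first.
  by move=> A mA AD; rewrite lebesgue_measure_affine.
- exact: measurable_affine.
- by rewrite ge0_integral_mscale.
Qed.

Lemma ae_affine p k (P : R -> Prop) : k != 0 ->
  {ae mu, forall t, P t} -> {ae mu, forall t, P (p + t * k)}.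
Proof.
move=> k0 [N [mN N0 hN]]; exists ((fun t : R => p + t * k) @^-1` N); split.
- by rewrite -[X in measurable X]setTI; apply: (measurable_affine p k).
- have := lebesgue_measure_affine p k0 mN; rewrite /pushforward => ->.
  by rewrite [X in (_ * X)%E]N0 mule0.
- by move=> t /= nP; exact: hN.
Qed.

End AffineChangeOfVariables.

(** * Weighted graph Laplacian *)

Section GraphLaplacian.
Context {R : realType} {X : finType}.
Variables (Q : X -> X -> R) (pi : X -> R).
Hypothesis chain : irreducible_reversible_chain Q pi.
Implicit Types (f g psi rho : X -> R) (V w : X -> X -> R).

Lemma irreducible_ind (P : X -> Prop) x y :
  (forall a b, 0 < Q a b -> P a -> P b) -> P x -> P y.
Proof.
move=> PQ Px; have /connectP[p pth ->] := irc_irreducible chain x y.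
by elim: p x Px pth => //= a p ih x Px /andP[xa /ih]; apply; exact: PQ xa Px.
Qed.

(** Some vertex has positive mass because the total is [1], and detailed balance carries positivity
    along edges. *)
Lemma pi_gt0 x : 0 < pi x.
Proof.
have [pi0 pi1] := irc_prob chain.
have [x0 x0P] : exists x0, 0 < pi x0.
  apply: contrapT => h; have : \sum_x pi x = 0.
    apply: big1 => a _; apply/eqP; rewrite eq_le pi0 andbT leNgt.
    by apply/negP => ?; apply: h; exists a.
  by rewrite pi1 => /eqP; rewrite oner_eq0.
apply: (@irreducible_ind (fun x => 0 < pi x) x0) => // a b Qab pa.
have := mulr_gt0 Qab pa; rewrite (irc_reversible chain) => h.
rewrite lt_neqAle pi0 andbT eq_sym.
by apply: contraTN h => /eqP ->; rewrite mulr0 ltxx.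
Qed.

Lemma pi_sum1 : \sum_x pi x = 1.
Proof. by have [] := irc_prob chain. Qed.

Lemma rate_ge0 x y : 0 <= Q x y.
Proof. exact: irc_rate_ge0 chain x y. Qed.

Lemma flow_ge0 x y : 0 <= Q x y * pi x.
Proof. by rewrite mulr_ge0 ?rate_ge0 ?ltW ?pi_gt0. Qed.

Lemma flowC x y : Q x y * pi x = Q y x * pi y.
Proof. exact: irc_reversible chain x y. Qed.

Lemma sum_antisym (F : X -> X -> R) : (forall x y, F x y = - F y x) ->
  \sum_x \sum_y F x y = 0.
Proof.
move=> antiF; have : \sum_x \sum_y F x y = - \sum_x \sum_y F x y.
  rewrite {1}exchange_big -sumrN; apply: eq_bigr => x _.
  by rewrite -sumrN; apply: eq_bigr => y _; exact: antiF.
by move=> h; lra.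
Qed.

Lemma sum_div0 V : (forall x y, V x y = - V y x) ->
  \sum_x (\sum_y V x y * Q x y) * pi x = 0.
Proof.
move=> aV; under eq_bigr do rewrite mulr_suml.
apply: sum_antisym => x y.
by rewrite -mulrA flowC (aV x y) mulNr mulrA.
Qed.

(** Summation by parts: detailed balance makes [Q x y * pi x] symmetric, and exchanging [x] and [y]
    produces the factor [1/2]. *)
Lemma green V f : (forall x y, V x y = - V y x) ->
  \sum_x f x * (\sum_y V x y * Q x y) * pi x =
  - 2^-1 * \sum_x \sum_y (f y - f x) * V x y * Q x y * pi x.
Proof.
move=> aV.
have -> : \sum_x f x * (\sum_y V x y * Q x y) * pi x =
    \sum_x \sum_y f x * V x y * (Q x y * pi x).
  apply: eq_bigr => x _; rewrite mulr_sumr mulr_suml.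
  by apply: eq_bigr => y _; rewrite !mulrA.
have E : \sum_x \sum_y f y * V x y * (Q x y * pi x) =
    - \sum_x \sum_y f x * V x y * (Q x y * pi x).
  rewrite exchange_big -sumrN; apply: eq_bigr => x _.
  rewrite -sumrN; apply: eq_bigr => y _.
  by rewrite (aV y x) mulrN mulNr flowC.
rewrite [X in _ * X](_ : _ = \sum_x \sum_y f y * V x y * (Q x y * pi x) -
   \sum_x \sum_y f x * V x y * (Q x y * pi x)); last first.
  rewrite -sumrB; apply: eq_bigr => x _; rewrite -sumrB; apply: eq_bigr => y _.
  by ring.
by rewrite E; field.
Qed.

(** Minus the Laplacian with conductances [w], acting on row vectors, plus the mean against [pi].
    The rank-one term removes the kernel of constants. *)
Definition poisson_mx w : 'M[R]_#|X| := \matrix_(i, j)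
  ((i == j)%:R * (\sum_z w (enum_val j) z * Q (enum_val j) z) -
   w (enum_val j) (enum_val i) * Q (enum_val j) (enum_val i) + pi (enum_val i)).

Lemma poisson_mxE w (v : 'rV[R]_#|X|) x :
  let psi y := v 0 (enum_rank y) in
  (v *m poisson_mx w) 0 (enum_rank x) =
  - (\sum_y (psi y - psi x) * w x y * Q x y) + \sum_y psi y * pi y.
Proof.
move=> psi; rewrite mxE.
rewrite (reindex (@enum_rank X)) /=; last by apply: onW_bij; exact: enum_rank_bij.
under eq_bigr do rewrite mxE !enum_rankK -/(psi _) mulrDr mulrBr.
rewrite big_split sumrB/=; congr (_ + _).
rewrite (bigD1 x)//= eqxx mul1r [X in _ + X - _]big1 ?addr0; last first.
  move=> y yx; rewrite (_ : (enum_rank y == enum_rank x) = false) ?mul0r ?mulr0//.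
  by apply/negbTE; apply: contra yx => /eqP /enum_rank_inj ->.
rewrite mulr_sumr -sumrB -sumrN; apply: eq_bigr => y _; ring.
Qed.

(** Averaging the kernel equation against [pi] shows that a kernel vector has mean zero. It then has
    zero energy, so it is constant along edges, constant by irreducibility, and finally zero. *)
Lemma poisson_mx_unit w : (forall x y, 0 < w x y) -> (forall x y, w x y = w y x) ->
  \det (poisson_mx w) != 0.
Proof.
move=> w0 wC; rewrite -unitfE -unitmxE -row_free_unit -kermx_eq0.
apply/rowV0P => v /sub_kermxP vM.
pose psi y := v 0 (enum_rank y).
have E x : - (\sum_y (psi y - psi x) * w x y * Q x y) + \sum_y psi y * pi y = 0.
  by have := poisson_mxE w v x; rewrite vM mxE => <-.
have aV x y : (psi y - psi x) * w x y = - ((psi x - psi y) * w y x).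
  by rewrite wC; ring.
have m0 : \sum_y psi y * pi y = 0.
  have : \sum_x (- (\sum_y (psi y - psi x) * w x y * Q x y) + \sum_y psi y * pi y) * pi x = 0.
    by apply: big1 => x _; rewrite E mul0r.
  under eq_bigr do rewrite mulrDl mulNr.
  rewrite big_split sumrN/= sum_div0// oppr0 add0r -mulr_sumr pi_sum1 mulr1//.
have G := green psi aV.
have L0 x : \sum_y (psi y - psi x) * w x y * Q x y = 0.
  by have := E x; rewrite m0 addr0 => /eqP; rewrite oppr_eq0 => /eqP.
have {}G : \sum_x \sum_y (psi y - psi x) ^+ 2 * w x y * (Q x y * pi x) = 0.
  move: G; rewrite big1; last by move=> x _; rewrite L0 mulr0 mul0r.
  move=> /esym/eqP; rewrite mulf_eq0 oppr_eq0 invr_eq0 pnatr_eq0/= => /eqP G0.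
  rewrite -[RHS]G0; by apply: eq_bigr => x _; apply: eq_bigr => y _; rewrite expr2 !mulrA.
have term0 x y : 0 <= (psi y - psi x) ^+ 2 * w x y * (Q x y * pi x).
  by rewrite mulr_ge0 ?flow_ge0// mulr_ge0 ?sqr_ge0// ltW.
have edge x y : 0 < Q x y -> psi x = psi y.
  move=> Qxy; have /eqP := G; rewrite psumr_eq0; last by move=> a _; exact: sumr_ge0.
  move=> /allP /(_ x (mem_index_enum _)) /=; rewrite psumr_eq0//.
  move=> /allP /(_ y (mem_index_enum _)) /=.
  rewrite !mulf_eq0 orbb (gt_eqF (w0 x y)) (gt_eqF Qxy) (gt_eqF (pi_gt0 x)) !orbF.
  by rewrite subr_eq0 => /eqP.
apply/rowP => i; rewrite mxE.
have psic y : psi y = psi (enum_val i).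
  by apply: (@irreducible_ind (fun y => psi y = psi (enum_val i)) (enum_val i)) => // a b /edge ->.
have : psi (enum_val i) = 0.
  rewrite -m0; under eq_bigr do rewrite psic.
  by rewrite -mulr_sumr pi_sum1 mulr1.
by rewrite /psi enum_valK.
Qed.

(** Cramer's formula instead of a chosen solution: the result is a rational expression in [w] and
    [f], hence measurable when these depend measurably on time. *)
Definition poisson w f : X -> R := fun y =>
  ((\row_i f (enum_val i)) *m ((\det (poisson_mx w))^-1 *: \adj (poisson_mx w)))
    0 (enum_rank y).

(** For data of mean zero the solution also has mean zero, so the rank-one term of the matrix drops
    out. *)
Lemma poissonP w f x : (forall x y, 0 < w x y) -> (forall x y, w x y = w y x) ->
  \sum_y f y * pi y = 0 ->
  \sum_y (poisson w f y - poisson w f x) * w x y * Q x y = - f x.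
Proof.
move=> w0 wC f0.
have d0 := poisson_mx_unit w0 wC.
set v := (\row_i f (enum_val i)) *m ((\det (poisson_mx w))^-1 *: \adj (poisson_mx w)).
have vM : v *m poisson_mx w = \row_i f (enum_val i).
  rewrite /v -mulmxA -scalemxAl mul_adj_mx -mul_scalar_mx -scalar_mxM mulVf//.
  by rewrite mulmx1.
have E z : - (\sum_y (poisson w f y - poisson w f z) * w z y * Q z y) +
    \sum_y poisson w f y * pi y = f z.
  by have := poisson_mxE w v z; rewrite vM mxE enum_rankK => ->.
have aV a b : (poisson w f b - poisson w f a) * w a b =
    - ((poisson w f a - poisson w f b) * w b a) by rewrite wC; ring.
have m0 : \sum_y poisson w f y * pi y = 0.
  move: f0; under eq_bigr do rewrite -E mulrDl mulNr.
  by rewrite big_split sumrN/= sum_div0// oppr0 add0r -mulr_sumr pi_sum1 mulr1.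
by have := E x; rewrite m0 addr0 => <-; rewrite opprK.
Qed.

Lemma measurable_det d (T : measurableType d) (D : set T) n (A : T -> 'M[R]_n) :
  (forall i j, measurable_fun D (fun t => A t i j)) ->
  measurable_fun D (fun t => \det (A t)).
Proof.
move=> mA; rewrite /determinant; apply: measurable_sum => s.
apply: measurable_funM; first exact: measurable_cst.
by apply: measurable_prod => i _; exact: mA.
Qed.

Lemma measurable_poisson d (T : measurableType d) (D : set T)
    (w : T -> X -> X -> R) (f : T -> X -> R) x :
  (forall x y, measurable_fun D (fun t => w t x y)) ->
  (forall x, measurable_fun D (fun t => f t x)) ->
  measurable_fun D (fun t => poisson (w t) (f t) x).
Proof.
move=> mw mf.
have mM i j : measurable_fun D (fun t => poisson_mx (w t) i j).
  rewrite (_ : (fun t => _) = fun t =>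
    (i == j)%:R * (\sum_z w t (enum_val j) z * Q (enum_val j) z) -
     w t (enum_val j) (enum_val i) * Q (enum_val j) (enum_val i) + pi (enum_val i)).
    apply: measurable_funD; last exact: measurable_cst.
    apply: measurable_funB.
      apply: measurable_funM; first exact: measurable_cst.
      by apply: measurable_sum => z; apply: measurable_funM => //; exact: measurable_cst.
    by apply: measurable_funM => //; exact: measurable_cst.
  by apply/funext => t; rewrite mxE.
rewrite (_ : (fun t => _) = fun t => \sum_i f t (enum_val i) *
  ((\det (poisson_mx (w t)))^-1 * ((-1) ^+ (enum_rank x + i) *
    \det (row' (enum_rank x) (col' i (poisson_mx (w t))))))); last first.
  by apply/funext => t; rewrite /poisson mxE; apply: eq_bigr => i _; rewrite !mxE.
apply: measurable_sum => i; apply: measurable_funM => //.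
apply: measurable_funM.
  by apply: (measurableT_comp (@measurable_invr R setT)); exact: measurable_det.
apply: measurable_funM; first exact: measurable_cst.
apply: measurable_det => a b.
by rewrite (_ : (fun t => _) = fun t => poisson_mx (w t) (lift (enum_rank x) a) (lift i b))//;
  apply/funext => t; rewrite !mxE.
Qed.

(** Thomson's principle: among fluxes with the same divergence, the gradient flux has least energy.
    By parts, its energy equals its pairing with [V], which is at most half the sum of the two
    energies. *)
Lemma poisson_energy w V psi : (forall x y, 0 < w x y) -> (forall x y, w x y = w y x) ->
  (forall x y, V x y = - V y x) ->
  (forall x, \sum_y (psi y - psi x) * w x y * Q x y = \sum_y V x y * Q x y) ->
  \sum_x \sum_y (psi x - psi y) ^+ 2 * w x y * Q x y * pi x <=
  \sum_x \sum_y V x y ^+ 2 / w x y * Q x y * pi x.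
Proof.
move=> w0 wC aV E.
have aW x y : (psi y - psi x) * w x y = - ((psi x - psi y) * w y x).
  by rewrite wC; ring.
have G1 := green psi aV; have G2 := green psi aW.
have {G1 G2}G : \sum_x \sum_y (psi x - psi y) ^+ 2 * w x y * Q x y * pi x =
    \sum_x \sum_y (psi y - psi x) * V x y * Q x y * pi x.
  have : - 2^-1 * (\sum_x \sum_y (psi y - psi x) * ((psi y - psi x) * w x y) * Q x y * pi x) =
    - 2^-1 * \sum_x \sum_y (psi y - psi x) * V x y * Q x y * pi x :> R.
    by rewrite -G1 -G2; apply: eq_bigr => x _; rewrite E.
  move=> /mulfI; rewrite oppr_eq0 invr_eq0 pnatr_eq0 => /(_ isT) <-.
  by apply: eq_bigr => x _; apply: eq_bigr => y _; rewrite -(opprB (psi y)) sqrrN; ring.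
suff h : \sum_x \sum_y (psi y - psi x) * V x y * Q x y * pi x <=
   2^-1 * (\sum_x \sum_y (psi x - psi y) ^+ 2 * w x y * Q x y * pi x) +
   2^-1 * (\sum_x \sum_y V x y ^+ 2 / w x y * Q x y * pi x).
  by move: G h; clear; lra.
rewrite !mulr_sumr -big_split; apply: ler_sum => x _ /=.
rewrite !mulr_sumr -big_split; apply: ler_sum => y _ /=.
rewrite [leRHS](_ : _ = (2^-1 * (psi y - psi x) ^+ 2 * w x y +
  2^-1 * (V x y ^+ 2 / w x y)) * (Q x y * pi x)); last by ring.
rewrite -(mulrA _ (Q x y)); apply: ler_wpM2r; first exact: (flow_ge0 x y).
have h := sqr_ge0 ((psi y - psi x) * w x y - V x y).
have wn : w x y != 0 by rewrite gt_eqF.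
have zE : V x y ^+ 2 / w x y * w x y = V x y ^+ 2 by rewrite divfK.
rewrite -(ler_pM2r (w0 x y)); move: h zE; clear.
by move: (V x y ^+ 2 / w x y) => z h zE; nra.
Qed.

End GraphLaplacian.

(** * Transport paths and the distance *)

Section Paths.
Context {R : realType} {X : finType}.
Variables (Q : X -> X -> R) (pi : X -> R).
Hypothesis chain : irreducible_reversible_chain Q pi.
Implicit Types (a b c d t : R) (rho psi : R -> X -> R).
Local Notation mu := (@lebesgue_measure R).
Local Notation AC := absolutely_continuous_on.

Definition kinetic (rho psi : X -> R) : R := \sum_x \sum_y (psi x - psi y) ^+ 2 *
  log_mean (rho x) (rho y) * Q x y * pi x.

Lemma kinetic_ge0 (rho psi : X -> R) : 0 <= kinetic rho psi.
Proof.
apply: sumr_ge0 => x _; apply: sumr_ge0 => y _.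
by rewrite -mulrA mulr_ge0 ?(flow_ge0 chain)// mulr_ge0 ?sqr_ge0// log_mean_ge0.
Qed.

Definition curve_eq rho psi t := forall x, derivable (fun s => rho s x) t 1 /\
  derive1 (fun s => rho s x) t +
  \sum_y (psi t y - psi t x) * log_mean (rho t x) (rho t y) * Q x y = 0.

(** Free interval and free endpoints, so that paths can be cut, rescaled and glued. *)
Record path_on a b rho psi : Prop := PathOn {
  po_density : forall t, a <= t <= b -> densities pi (rho t);
  po_ac : forall x, AC a b (fun t => rho t x);
  po_measurable : forall x, measurable_fun (`[a, b]%classic : set R) (fun t => psi t x);
  po_eq : {ae mu, forall t, a <= t <= b -> curve_eq rho psi t} }.

Definition kinetic_integral a b rho psi : \bar R :=
  (\int[mu]_(t in `[a, b]) (kinetic (rho t) (psi t))%:E)%E.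

Lemma kinetic_integral_ge0 a b rho psi : (0 <= kinetic_integral a b rho psi)%E.
Proof. by apply: integral_ge0 => t _; rewrite lee_fin kinetic_ge0. Qed.

Lemma transport_pathP (rho0 rho1 : X -> R) rho psi : transport_path Q pi rho0 rho1 rho psi <->
  [/\ path_on 0 1 rho psi, rho 0 = rho0 & rho 1 = rho1].
Proof.
by split; [case => ? ? ? ? ? ?; split|case => -[? ? ? ?] ? ?; split].
Qed.

Lemma measurable_kinetic a b rho psi : path_on a b rho psi ->
  measurable_fun (`[a, b]%classic : set R) (fun t => kinetic (rho t) (psi t)).
Proof.
move=> [dens ac mpsi _]; apply: measurable_sum => x; apply: measurable_sum => y.
have r0 z t : `[a, b]%classic t -> 0 <= rho t z.
  by rewrite /= in_itv/= => /dens[].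
apply: measurable_funM; last exact: measurable_cst.
apply: measurable_funM; last exact: measurable_cst.
apply: measurable_funM.
  by apply: measurable_funX; apply: measurable_funB.
by apply: measurable_log_mean => //; [apply: ac_measurable|apply: ac_measurable|exact: r0|exact: r0].
Qed.

Lemma path_sub a b c d rho psi : a <= c -> d <= b ->
  path_on a b rho psi -> path_on c d rho psi.
Proof.
move=> ac db [dens acc mpsi eq].
have sub t : c <= t <= d -> a <= t <= b.
  by move=> /andP[ct td]; rewrite (le_trans ac ct) (le_trans td db).
split.
- by move=> t /sub /dens.
- by move=> x; exact: ac_sub (acc x).
- by move=> x; apply: measurable_funS (mpsi x) => // t /=; rewrite !in_itv/=; exact: sub.
- by apply: aeS eq => t h /sub /h.
Qed.

(** Either sign of [k] is allowed, which covers time reversal. The potential scales by [k], the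
    energy density by [k^2], and the change of variables contributes [1/|k|]. *)
Lemma path_affine a b c d (p k : R) rho psi : k != 0 ->
  (forall t, (c <= t <= d) = (a <= p + t * k <= b)) ->
  path_on a b rho psi ->
  path_on c d (fun t => rho (p + t * k)) (fun t x => k * psi (p + t * k) x) /\
  (kinetic_integral c d (fun t => rho (p + t * k)%R) (fun t x => k * psi (p + t * k) x)%R =
   `|k|%:E * kinetic_integral a b rho psi)%E.
Proof.
move=> k0 cdab pth; have [dens acc mpsi eq] := pth; split; first split.
- by move=> t; rewrite cdab => /dens.
- by move=> x; apply: ac_affine (acc x) => // t; rewrite cdab.
- move=> x; apply: measurable_funM; first exact: measurable_cst.
  apply: (measurable_comp (F := `[a, b]%classic)) (mpsi x) _ => //.
    by move=> _ [t /=] + <-; rewrite !in_itv/= cdab.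
  by apply: measurable_funTS; exact: measurable_affine.
- apply: aeS (ae_affine p k0 eq) => t h; rewrite cdab => /h{}h x.
  have [df dE] := h x.
  have /deriv_derive1[df' ->] := @deriv_comp R (fun s => rho s x) _ t _ _
     (derive1_deriv df) (deriv_affine t p k).
  split => //; move: dE.
  rewrite [X in _ -> _ + X = 0](_ : _ = k * \sum_y (psi (p + t * k) y - psi (p + t * k) x) *
     log_mean (rho (p + t * k) x) (rho (p + t * k) y) * Q x y); last first.
    by rewrite mulr_sumr; apply: eq_bigr => y _; rewrite -mulrBr !mulrA.
  have aux (u v w : R) : u + v = 0 -> u * w + w * v = 0.
    by rewrite (mulrC u) -mulrDr => ->; rewrite mulr0.
  exact: aux.
- rewrite /kinetic_integral.
  have kE t : (kinetic (rho (p + t * k)) (fun x => k * psi (p + t * k) x))%:E =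
    ((k ^+ 2)%:E * (kinetic (rho (p + t * k)) (psi (p + t * k)%R))%:E)%E.
    rewrite -EFinM; congr EFin; rewrite /kinetic mulr_sumr; apply: eq_bigr => x _.
    by rewrite mulr_sumr; apply: eq_bigr => y _; rewrite -mulrBr exprMn !mulrA.
  under eq_integral do rewrite kE.
  have cdE : `[c, d]%classic = (fun t : R => p + t * k) @^-1` `[a, b].
    by apply/seteqP; split => t /=; rewrite !in_itv/= cdab.
  have mk : measurable_fun (`[a, b]%classic : set R)
      (fun t => ((k ^+ 2)%:E * (kinetic (rho t) (psi t))%:E)%E).
    apply: (eq_measurable_fun (fun t => (k ^+ 2 * kinetic (rho t) (psi t))%:E)) => [t _|].
      by rewrite EFinM.
    apply/measurable_EFinP; apply: measurable_funM; first exact: measurable_cst.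
    exact: measurable_kinetic.
  rewrite cdE (ge0_integral_affine p (f := fun t => ((k ^+ 2)%:E * (kinetic (rho t) (psi t))%:E)%E))//; last first.
    by move=> t _; rewrite -EFinM lee_fin mulr_ge0 ?sqr_ge0// kinetic_ge0.
  rewrite ge0_integralZl//; last 3 first.
  - by apply/measurable_EFinP; exact: measurable_kinetic.
  - by move=> t _; rewrite lee_fin kinetic_ge0.
  - by rewrite lee_fin sqr_ge0.
  rewrite muleA -EFinM -real_normK ?num_real// expr2 mulrA mulVf ?mul1r//.
  by rewrite normr_eq0.
Qed.

Lemma kinetic_integral_split a c b rho psi : a <= c <= b ->
  measurable_fun (`[a, b]%classic : set R) (fun t => kinetic (rho t) (psi t)) ->
  kinetic_integral a b rho psi =
  (kinetic_integral a c rho psi + kinetic_integral c b rho psi)%E.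
Proof.
move=> /andP[ac cb] mk; rewrite /kinetic_integral.
have E : `[a, b]%classic = `[a, c[ `|` `[c, b] :> set R.
  by rewrite -itv_bndbnd_setU// ?bnd_simp.
have mk1 : measurable_fun (`[a, c[ : set R) (fun t => (kinetic (rho t) (psi t))%:E).
  apply/measurable_EFinP; apply: measurable_funS mk => //.
  by rewrite E; exact: subsetUl.
rewrite -[X in (_ = X + _)%E](@integral_itv_bndo_bndc R (BLeft a) c)//.
rewrite E ge0_integral_setU//.
- by rewrite -E; exact/measurable_EFinP.
- by move=> t _; rewrite lee_fin kinetic_ge0.
- rewrite disj_set2E; apply/eqP/seteqP; split => // t [/=]; rewrite !in_itv/=.
  by move=> /andP[_ tc] /andP[/(lt_le_trans tc)]; rewrite ltxx.
Qed.

Definition glue c (rho1 rho2 : R -> X -> R) t := if t <= c then rho1 t else rho2 t.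

Lemma path_glue a c b rho1 psi1 rho2 psi2 : a <= c <= b ->
  rho1 c = rho2 c -> path_on a c rho1 psi1 -> path_on c b rho2 psi2 ->
  path_on a b (glue c rho1 rho2) (glue c psi1 psi2) /\
  kinetic_integral a b (glue c rho1 rho2) (glue c psi1 psi2) =
  (kinetic_integral a c rho1 psi1 + kinetic_integral c b rho2 psi2)%E.
Proof.
move=> /andP[ac cb] eqc p1 p2.
have [d1 ac1 m1 e1] := p1; have [d2 ac2 m2 e2] := p2.
have gl (f1 f2 : R -> X -> R) t : t <= c -> glue c f1 f2 t = f1 t.
  by rewrite /glue => ->.
have gr (f1 f2 : R -> X -> R) t : c < t -> glue c f1 f2 t = f2 t.
  by rewrite /glue leNgt => ->.
have gr' t : c <= t -> glue c rho1 rho2 t = rho2 t.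
  by rewrite le_eqVlt => /predU1P[<-|]; [rewrite gl|exact: gr].
have pth : path_on a b (glue c rho1 rho2) (glue c psi1 psi2).
  split.
  - move=> t /andP[at_ tb]; case: (leP t c) => tc.
      by rewrite gl//; apply: d1; rewrite at_.
    by rewrite gr//; apply: d2; rewrite ltW.
  - move=> x; apply: (@ac_glue _ a c b); first by rewrite ac.
      by apply: ac_eq (ac1 x) => t /andP[_ tc]; rewrite gl.
    by apply: ac_eq (ac2 x) => t /andP[ct _]; rewrite gr'.
  - move=> x; rewrite (_ : `[a, b]%classic = `[a, c] `|` `]c, b] :> set R); last first.
      by rewrite -itv_bndbnd_setU// ?bnd_simp.
    apply/measurable_funU => //; split.
      apply: (eq_measurable_fun (fun t => psi1 t x)) => // t.
      by rewrite inE/= in_itv/= => /andP[_ tc]; rewrite gl.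
    apply: (eq_measurable_fun (fun t => psi2 t x)) => [t|].
      by rewrite inE/= in_itv/= => /andP[ct _]; rewrite gr.
    apply: measurable_funS (m2 x) => //.
    by apply: subset_itvr; rewrite bnd_simp.
  - have eqnear (t : R) (f g : R -> X -> R) (psi psi' : R -> X -> R) : (\forall s \near t, f s = g s) ->
        psi t = psi' t -> curve_eq f psi t -> curve_eq g psi' t.
      move=> fg pp h x; have [df dE] := h x.
      have fgx : {near t, (fun s => f s x) =1 (fun s => g s x)}.
        by near=> s; rewrite (near fg s).
      split; first exact: near_eq_derivable fgx df.
      have <- : derive1 (fun s => f s x) t = derive1 (fun s => g s x) t.
        by rewrite !derive1E; exact: near_eq_derive.
      by rewrite -(nbhs_singleton fg) -pp.
    (* The two halves may meet at [c] with different speeds, but [c] is negligible; away from it the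
       equation is local. *)
    apply: aeS2 (aeS2 (fun t => @conj _ _) e1 e2) (ae_neq c) => t [h1 h2] tc /andP[at_ tb].
    move: tc; rewrite neq_lt => /orP[tc|ct].
      apply: eqnear (h1 _); last by rewrite at_ ltW.
        by near=> s; rewrite gl//; apply: ltW; near: s; exact: lt_nbhsl.
      by rewrite gl// ltW.
    apply: eqnear (h2 _); last by rewrite tb ltW.
      by near=> s; rewrite gr//; near: s; exact: lt_nbhsr.
    by rewrite gr.
split => //.
have acb : a <= c <= b by rewrite ac.
rewrite (kinetic_integral_split acb (measurable_kinetic pth)).
have -> : kinetic_integral a c (glue c rho1 rho2) (glue c psi1 psi2) =
    kinetic_integral a c rho1 psi1.
  by apply: eq_integral => t; rewrite inE/= in_itv/= => /andP[_ tc]; rewrite !gl.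
have -> // : kinetic_integral c b (glue c rho1 rho2) (glue c psi1 psi2) =
    kinetic_integral c b rho2 psi2.
  rewrite /kinetic_integral.
  rewrite -[LHS]integral_itv_obnd_cbnd; last first.
    apply/measurable_EFinP.
    apply: measurable_funS (measurable_kinetic pth) => //.
    by apply: subset_itvr; rewrite bnd_simp.
  rewrite -[RHS]integral_itv_obnd_cbnd; last first.
    apply/measurable_EFinP.
    apply: measurable_funS (measurable_kinetic p2) => //.
    by apply: subset_itvr; rewrite bnd_simp.
  by apply: eq_integral => t; rewrite inE/= in_itv/= => /andP[ct _]; rewrite !gr.
Unshelve. all: by end_near. Qed.

End Paths.

(** * Upper bounds on the cost: concatenation, fluxes, continuity *)

Section TransportCost.
Context {R : realType} {X : finType}.
Variables (Q : X -> X -> R) (pi : X -> R).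
Hypothesis chain : irreducible_reversible_chain Q pi.
Implicit Types (a b c d t : R) (rho psi : R -> X -> R).
Local Notation mu := (@lebesgue_measure R).
Local Notation AC := absolutely_continuous_on.
Local Notation W2 := (transport_dist_sqr Q pi).

Lemma integral_cst01 (k : R) : (\int[mu]_(t in `[0%R, 1%R]) k%:E = k%:E)%E.
Proof.
have := @integral_cst _ _ R mu `[0%R, 1%R]%classic (measurable_itv _) k%:E.
by rewrite /cst /= => ->; rewrite lebesgue_measure_itv/= lte_fin ltr01 oppr0 adde0 mule1.
Qed.

Lemma actionE rho psi : action Q pi rho psi =
  ((2^-1)%:E * kinetic_integral Q pi 0 1 rho psi)%E.
Proof. by []. Qed.

Lemma W2_ge0 (rho0 rho1 : X -> R) : (0 <= W2 rho0 rho1)%E.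
Proof.
apply: le_ereal_inf_tmp => _ [rho [psi [_ ->]]].
apply: mule_ge0; first by rewrite lee_fin invr_ge0.
exact: (kinetic_integral_ge0 chain 0 1 rho psi).
Qed.

Lemma W2_lt_path (rho0 rho1 : X -> R) (e : R) : (W2 rho0 rho1 < e%:E)%E ->
  exists rho psi, [/\ path_on Q pi 0 1 rho psi, rho 0 = rho0, rho 1 = rho1 &
    (kinetic_integral Q pi 0 1 rho psi < (2 * e)%:E)%E].
Proof.
move=> /ereal_inf_lt[_ [rho [psi [/transport_pathP[pth r0 r1] ->]]]] lt.
exists rho, psi; split => //.
by move: lt; rewrite actionE muleC lte_pdivrMr// muleC EFinM.
Qed.

Lemma W2_le_kinetic a b rho psi : a < b -> path_on Q pi a b rho psi ->
  (W2 (rho a) (rho b) <= ((b - a) / 2)%:E * kinetic_integral Q pi a b rho psi)%E.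
Proof.
move=> ab pth; have k0 : 0 < b - a by rewrite subr_gt0.
have kn : b - a != 0 by rewrite gt_eqF.
have [|p E] := @path_affine _ _ _ _ chain a b 0 1 a (b - a) rho psi kn _ pth.
  move=> t; rewrite lerDl -lerBrDl pmulr_lge0//.
  by congr (_ && _); rewrite -[X in _ = (_ <= X)]mul1r ler_pM2r.
apply: ereal_inf_lbound; exists (fun t => rho (a + t * (b - a))),
  (fun t x => (b - a) * psi (a + t * (b - a)) x); split.
  by apply/transport_pathP; split => //; rewrite ?mul0r ?addr0// mul1r addrC subrK.
by rewrite actionE E gtr0_norm// muleA -EFinM mulrC.
Qed.

Lemma W2_reverse (rho0 rho1 : X -> R) : (W2 rho1 rho0 <= W2 rho0 rho1)%E.
Proof.
apply: le_ereal_inf_tmp => _ [rho [psi [/transport_pathP[pth <- <-] ->]]].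
have n0 : (-1 : R) != 0 by rewrite oppr_eq0 oner_eq0.
have [|p E] := @path_affine _ _ _ _ chain 0 1 0 1 1 (-1) rho psi n0 _ pth.
  by move=> t; rewrite mulrN1 subr_ge0 gerBl andbC.
apply: ereal_inf_lbound; exists (fun t => rho (1 + t * -1)),
  (fun t x => -1 * psi (1 + t * -1) x); split.
  by apply/transport_pathP; split => //; rewrite ?mul0r ?addr0// mul1r subrr.
by rewrite !actionE E normrN1 mul1e.
Qed.

Lemma W2C (rho0 rho1 : X -> R) : W2 rho0 rho1 = W2 rho1 rho0.
Proof. by apply/eqP; rewrite eq_le !W2_reverse. Qed.

Lemma W2_concat (rho0 rho1 rho2 : X -> R) (e1 e2 : R) : 0 < e1 -> 0 < e2 ->
  (W2 rho0 rho1 < (e1 ^+ 2)%:E)%E -> (W2 rho1 rho2 < (e2 ^+ 2)%:E)%E ->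
  (W2 rho0 rho2 <= ((e1 + e2) ^+ 2)%:E)%E.
Proof.
move=> e10 e20 /W2_lt_path[r1 [s1 [p1 r10 r11 k1]]] /W2_lt_path[r2 [s2 [p2 r20 r21 k2]]].
have ee : 0 < e1 + e2 by rewrite addr_gt0.
(* Time is shared in proportion to the lengths, [c = e1 / (e1 + e2)]: the costs [e1^2 / c] and
   [e2^2 / (1 - c)] then add up to exactly [(e1 + e2)^2]. *)
pose k := (e1 + e2) / e1; pose l := (e1 + e2) / e2.
have k0 : 0 < k by rewrite divr_gt0.
have l0 : 0 < l by rewrite divr_gt0.
pose c := e1 / (e1 + e2).
have ck : c * k = 1 by rewrite /c /k; field; rewrite !gt_eqF.
have cl : (1 - c) * l = 1 by rewrite /c /l; field; rewrite !gt_eqF.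
have c01 : 0 <= c <= 1.
  apply/andP; split; first by rewrite divr_ge0// ltW.
  by rewrite ler_pdivrMr// mul1r lerDl ltW.
have [|q1 E1] := @path_affine _ _ _ _ chain 0 1 0 c 0 k r1 s1 (lt0r_neq0 k0) _ p1.
  by move=> t; rewrite add0r pmulr_lge0// -ck ler_pM2r.
have [|q2 E2] := @path_affine _ _ _ _ chain 0 1 c 1 (1 - l) l r2 s2 (lt0r_neq0 l0) _ p2.
  move=> t; have -> : 1 - l + t * l = (t - c) * l by rewrite -[X in X - l]cl; ring.
  by rewrite pmulr_lge0// subr_ge0 -[X in _ = _ && (_ <= X)]cl ler_pM2r// lerD2r.
have e12 : (fun t => r1 (0 + t * k)) c = (fun t => r2 (1 - l + t * l)) c.
  rewrite /= add0r ck r11 -r20; congr r2.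
  by have := cl; rewrite mulrBl mul1r => h; lra.
have [q E] := path_glue chain c01 e12 q1 q2.
have := W2_le_kinetic ltr01 q; rewrite E E1 E2 /glue.
have /andP[-> c1] := c01.
have -> : (1 <= c) = false.
  by apply/negbTE; rewrite -ltNge ltr_pdivrMr// mul1r ltrDl.
rewrite mul0r addr0 r10 (_ : 1 - l + 1 * l = 1) ?r21; last by rewrite mul1r subrK.
move=> h; apply: (le_trans h).
rewrite subr0 (gtr0_norm k0) (gtr0_norm l0).
apply: (@le_trans _ _ ((1 / 2)%:E * (k%:E * (2 * e1 ^+ 2)%:E + l%:E * (2 * e2 ^+ 2)%:E))%E).
  apply: lee_wpmul2l; first by rewrite lee_fin.
  by apply: leeD; apply: lee_wpmul2l; rewrite ?lee_fin; exact: ltW.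
rewrite (_ : (_ * _)%E = (1 / 2 * (k * (2 * e1 ^+ 2) + l * (2 * e2 ^+ 2)))%:E)//.
rewrite lee_fin /k /l le_eqVlt; apply/orP; left; apply/eqP.
by field; rewrite !gt_eqF.
Qed.

(** Passes from fluxes to potentials: at each time the Poisson equation with conductances
    [log_mean (rho t x) (rho t y)] gives a measurable potential with the divergence of [V] and, by
    [poisson_energy], no more energy. Positivity is asked at interior times, so that the endpoints
    may lie on the boundary. *)
Lemma flux_path rho (V : R -> X -> X -> R) (g : R -> R) :
  (forall t, 0 <= t <= 1 -> densities pi (rho t)) ->
  (forall x, AC 0 1 (fun t => rho t x)) ->
  (forall t, 0 < t < 1 -> forall x y, V t x y = - V t y x) ->
  (forall x y, measurable_fun (`[0, 1]%classic : set R) (fun t => V t x y)) ->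
  {ae mu, forall t, 0 <= t <= 1 -> forall x, derivable (fun s => rho s x) t 1 /\
    derive1 (fun s => rho s x) t + \sum_y V t x y * Q x y = 0} ->
  (forall t, 0 < t < 1 -> forall x, 0 < rho t x) ->
  measurable_fun (`[0, 1]%classic : set R) g -> (forall t, 0 <= g t) ->
  {ae mu, forall t, 0 < t < 1 ->
    \sum_x \sum_y V t x y ^+ 2 / log_mean (rho t x) (rho t y) * Q x y * pi x <= g t} ->
  (W2 (rho 0%R) (rho 1%R) <= (2^-1)%:E * \int[mu]_(t in `[0%R, 1%R]) (g t)%:E)%E.
Proof.
move=> dens acc aV mV eqV rho0 mg g0 leg.
pose w t x y := log_mean (rho t x) (rho t y).
pose psi t := poisson Q pi (w t) (fun x => - \sum_y V t x y * Q x y).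
have mrho x : measurable_fun (`[0, 1]%classic : set R) (fun t => rho t x).
  exact: ac_measurable.
have r0 z t : `[0, 1]%classic t -> 0 <= rho t z.
  by rewrite /= in_itv/= => /dens[].
have wC t : 0 < t < 1 -> forall x y, w t x y = w t y x.
  by move=> t01 x y; rewrite /w log_meanC// ltW ?rho0.
have w0 t : 0 < t < 1 -> forall x y, 0 < w t x y.
  by move=> t01 x y; apply: log_mean_gt0; exact: rho0.
have psiP t : 0 < t < 1 -> forall x,
    \sum_y (psi t y - psi t x) * w t x y * Q x y = \sum_y V t x y * Q x y.
  move=> t01 x; have -> := poissonP chain x (w0 t t01) (wC t t01) _.
    by rewrite opprK.
  under eq_bigr do rewrite mulNr.
  by rewrite sumrN (sum_div0 chain (aV t t01)) oppr0.
have pth : path_on Q pi 0 1 rho psi.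
  split => //.
  - move=> x; apply: measurable_poisson => [a b|a].
      by apply: measurable_log_mean => //; exact: r0.
    apply: measurableT_comp => //; apply: measurable_sum => y.
    by apply: measurable_funM => //; exact: measurable_cst.
  - apply: aeS2 (aeS2 (fun t => @conj _ _) (ae_neq 0) (ae_neq 1)) eqV => t [t0 t1] h t01 x.
    have [df dE] := h t01 x; split => //.
    rewrite -[RHS]dE -psiP//; move: t01 => /andP[a b].
    by rewrite !lt_neqAle a b t1 eq_sym t0.
apply: (le_trans (W2_le_kinetic ltr01 pth)).
rewrite subr0 div1r; apply: lee_wpmul2l; first by rewrite lee_fin invr_ge0.
apply: ae_ge0_le_integral => //.
- by move=> t _; rewrite lee_fin (kinetic_ge0 chain).
- by apply/measurable_EFinP; exact: (measurable_kinetic pth).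
- by move=> t _; rewrite lee_fin.
- exact/measurable_EFinP.
- apply: aeS2 (aeS2 (fun t => @conj _ _) (ae_neq 0) (ae_neq 1)) leg => t [t0 t1] h.
  rewrite /= in_itv/= => /andP[a b].
  have t01 : 0 < t < 1 by rewrite !lt_neqAle a b t1 eq_sym t0.
  rewrite lee_fin; apply: le_trans (h t01).
  exact: (poisson_energy chain (w0 t t01) (wC t t01) (aV t t01) (psiP t t01)).
Qed.

Definition density_bound := \sum_x (pi x)^-1.

Lemma density_le (rho : X -> R) x : densities pi rho -> rho x <= (pi x)^-1.
Proof.
move=> [r0 r1]; rewrite -[(pi x)^-1]mul1r ler_pdivlMr ?(pi_gt0 chain)//.
rewrite -r1 (bigD1 x)//= lerDl sumr_ge0// => y _.
by rewrite mulr_ge0// ltW ?(pi_gt0 chain).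
Qed.

Lemma density_le_bound (rho : X -> R) x : densities pi rho -> rho x <= density_bound.
Proof.
move=> dr; apply: (le_trans (density_le x dr)).
rewrite /density_bound (bigD1 x)//= lerDl sumr_ge0// => y _.
by rewrite invr_ge0 ltW ?(pi_gt0 chain).
Qed.

Lemma density_bound_ge0 : 0 <= density_bound.
Proof. by apply: sumr_ge0 => x _; rewrite invr_ge0 ltW ?(pi_gt0 chain). Qed.

Lemma poisson_bound w : exists2 C : R, 0 <= C & forall (f : X -> R) (N : R),
  (forall x, `|f x| <= N) -> forall y, `|poisson Q pi w f y| <= C * N.
Proof.
pose co i y := ((\det (poisson_mx Q pi w))^-1 *: \adj (poisson_mx Q pi w)) i (enum_rank y).
exists (\sum_y \sum_i `|co i y|); first by apply: sumr_ge0 => y _; exact: sumr_ge0.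
move=> f N fN y; rewrite /poisson mxE.
apply: (le_trans (ler_norm_sum _ _ _)).
have N0 : 0 <= N by apply: le_trans (fN y).
rewrite (bigD1 y)//= mulrDl -[leLHS]addr0; apply: lerD; last first.
  by rewrite mulr_ge0// sumr_ge0// => z _; exact: sumr_ge0.
rewrite mulr_suml; apply: ler_sum => i _.
by rewrite [(\row__ _) _ _]mxE normrM mulrC; apply: ler_wpM2l.
Qed.

Definition bump (t : R) : R := t * (1 + -1 * t).
(** The cubic [3 t^2 - 2 t^3], chosen because its derivative is [6 * bump t]: the speed of the
    interpolation then carries a factor [bump]. *)
Definition smoothstep (t : R) : R := t * (t * (3 + -2 * t)).

Lemma deriv_bump t : is_derive t (1 : R) bump (1 - 2 * t).
Proof.
have := derivM (deriv_id t) (derivD (deriv_cst t 1) (derivZ (-1) (deriv_id t))).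
by move/deriv_eq; apply; ring.
Qed.

Lemma deriv_smoothstep t : is_derive t (1 : R) smoothstep (6 * bump t).
Proof.
have := derivM (deriv_id t) (derivM (deriv_id t)
  (derivD (deriv_cst t 3) (derivZ (-2) (deriv_id t)))).
by move/deriv_eq; apply; rewrite /bump; ring.
Qed.

Lemma bump_bounds t : 0 <= t <= 1 -> 0 <= bump t <= 1.
Proof.
move=> /andP[t0 t1]; rewrite /bump mulN1r mulr_ge0 ?subr_ge0//=.
by rewrite mulr_ile1 ?subr_ge0// gerBl.
Qed.

Lemma bump_gt0 t : 0 < t < 1 -> 0 < bump t.
Proof. by move=> /andP[t0 t1]; rewrite /bump mulN1r mulr_gt0 ?subr_gt0. Qed.

Lemma smoothstep_bounds t : 0 <= t <= 1 -> 0 <= smoothstep t <= 1.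
Proof.
move=> /andP[t0 t1]; apply/andP; split.
  by rewrite /smoothstep !mulr_ge0//; lra.
rewrite -subr_ge0 (_ : _ - _ = (1 - t) * ((1 - t) * (1 + 2 * t))); last first.
  by rewrite /smoothstep; ring.
by rewrite !mulr_ge0// ?subr_ge0// addr_ge0// mulr_ge0.
Qed.

Lemma bump0 : bump 0 = 0. Proof. by rewrite /bump mul0r. Qed.
Lemma bump1 : bump 1 = 0. Proof. by rewrite /bump; ring. Qed.
Lemma smoothstep0 : smoothstep 0 = 0. Proof. by rewrite /smoothstep mul0r. Qed.
Lemma smoothstep1 : smoothstep 1 = 1. Proof. by rewrite /smoothstep; ring. Qed.

(* The interpolation is pushed into the interior by [e * bump t ^+ 2], which
   vanishes at the endpoints no faster than the square of the speed. *)
Lemma W2_continuity : exists2 C : R, 0 < C &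
  forall (rho sigma : X -> R) (r e : R), densities pi rho -> densities pi sigma ->
    0 < e <= 1 -> (forall x, `|rho x - sigma x| <= r) ->
    (W2 rho sigma <= (C * ((r + e) ^+ 2 / e))%:E)%E.
Proof.
have [C1 C10 hC1] := poisson_bound (fun _ _ => 1).
pose M : R := density_bound; have M0 : 0 <= M := density_bound_ge0.
pose K := 2 * (1 + M) + 6.
have K0 : 0 <= K by rewrite /K addr_ge0// mulr_ge0// addr_ge0.
pose S := \sum_x \sum_y Q x y * pi x.
have S0 : 0 <= S by apply: sumr_ge0 => x _; apply: sumr_ge0 => y _; exact: (flow_ge0 chain).
exists (2 * (C1 * K) ^+ 2 * S + 1).
  by rewrite ltr_wpDl// mulr_ge0// mulr_ge0// sqr_ge0.
move=> rho sigma r e drho dsig /andP[e0 e1] hr.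
have [x0 _] : exists x0 : X, True.
  apply: contrapT => h; have := pi_sum1 chain; rewrite big1; last first.
    by move=> x _; exfalso; apply: h; exists x.
  by move=> /eqP; rewrite eq_sym oner_eq0.
have r0 : 0 <= r by apply: le_trans (hr x0).
pose b t := e * (bump t * bump t); pose c := smoothstep.
pose m t x : R := (1 + -1 * c t) * rho x + c t * sigma x.
pose rh t x : R := (1 + -1 * b t) * m t x + b t.
pose F t x : R := 2 * e * (1 - 2 * t) * (1 - m t x) + 6 * (1 - b t) * (sigma x - rho x).
have b01 t : 0 <= t <= 1 -> 0 <= b t <= 1.
  move=> /bump_bounds; rewrite /b; move: (bump t) => z /andP[z0 z1].
  have zz : 0 <= z * z <= 1 by rewrite mulr_ge0//= mulr_ile1.
  move/andP: zz => [zz0 zz1].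
  by rewrite mulr_ge0 ?(ltW e0)//= mulr_ile1// ltW.
have bgt t : 0 < t < 1 -> 0 < b t.
  by move=> /bump_gt0; rewrite /b; move: (bump t) => z z0; rewrite !mulr_gt0.
have m0 t x : 0 <= t <= 1 -> 0 <= m t x.
  move=> /smoothstep_bounds /andP[ct0 ct1].
  by rewrite /m mulN1r addr_ge0// mulr_ge0// ?subr_ge0//; [case: drho|case: dsig].
have mM t x : 0 <= t <= 1 -> m t x <= M.
  move=> /smoothstep_bounds /andP[ct0 ct1].
  have h1 := ler_wpM2l (_ : 0 <= 1 - c t) (density_le_bound x drho).
  have h2 := ler_wpM2l ct0 (density_le_bound x dsig).
  rewrite subr_ge0 in h1; have := h1 ct1.
  by move: h2; rewrite /m /c /M; move: (smoothstep t) (density_bound : R) => z N; clear; lra.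
have msum t : \sum_x m t x * pi x = 1.
  rewrite (eq_bigr (fun x => (1 + -1 * c t) * (rho x * pi x) + c t * (sigma x * pi x))).
    by rewrite big_split -!mulr_sumr/= (proj2 drho) (proj2 dsig); ring.
  by move=> x _; rewrite /m; ring.
have drh t x : is_derive t (1 : R) (fun s => rh s x) (bump t * F t x).
  have db := derivZ e (derivM (deriv_bump t) (deriv_bump t)).
  have dc := deriv_smoothstep t.
  have dm := derivD (derivM (derivD (deriv_cst t 1) (derivZ (-1) dc)) (deriv_cst t (rho x)))
     (derivM dc (deriv_cst t (sigma x))).
  have := derivD (derivM (derivD (deriv_cst t 1) (derivZ (-1) db)) dm) db.
  by move/deriv_eq; apply; rewrite /F /m /b /c; ring.
have F0 t : \sum_x F t x * pi x = 0.
  rewrite (eq_bigr (fun x => 2 * e * (1 - 2 * t) * (pi x - m t x * pi x) +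
     6 * (1 - b t) * (sigma x * pi x - rho x * pi x))); last first.
    by move=> x _; rewrite /F; ring.
  rewrite big_split -!mulr_sumr !sumrB/= msum (proj2 drho) (proj2 dsig) (pi_sum1 chain).
  by rewrite !subrr !mulr0 addr0.
have FK t x : 0 <= t <= 1 -> `|F t x| <= K * (r + e).
  move=> t01; have /andP[bt0 bt1] := b01 t t01.
  have mx0 := m0 t x t01; have mxM := mM t x t01.
  have h1 : `|2 * e * (1 - 2 * t) * (1 - m t x)| <= 2 * e * (1 + M).
    rewrite normrM; apply: ler_pM => //.
      rewrite normrM ger0_norm ?mulr_ge0// ?(ltW e0)// ler_piMr// ?mulr_ge0 ?(ltW e0)//.
      by move: t01 => /andP[t0 t1]; rewrite ler_norml; apply/andP; split; lra.
    by rewrite ler_norml; apply/andP; split; lra.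
  have h2 : `|6 * (1 - b t) * (sigma x - rho x)| <= 6 * r.
    rewrite normrM; apply: ler_pM => //; last by rewrite distrC.
    by rewrite normrM ger0_norm// ler_piMr// ler_norml; apply/andP; split; lra.
  apply: (le_trans (ler_normD _ _)); apply: (le_trans (lerD h1 h2)).
  rewrite /K -subr_ge0.
  rewrite (_ : _ - _ = 2 * (1 + M) * r + 6 * e); last by ring.
  by rewrite addr_ge0// ?mulr_ge0// ?addr_ge0// ltW.
(* Unit conductances are used here: the resulting gradient is bounded independently of how close the
   density comes to zero, with the factor [bump t] kept in front. *)
pose V t x y := bump t * (poisson Q pi (fun _ _ => 1) (F t) y - poisson Q pi (fun _ _ => 1) (F t) x).
have mbump (D : set R) : measurable_fun D bump.
  apply: measurable_funTS; apply: continuous_measurable_fun => t.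
  exact: deriv_continuous (deriv_bump t).
have mc (D : set R) : measurable_fun D c.
  apply: measurable_funTS; apply: continuous_measurable_fun => t.
  exact: deriv_continuous (deriv_smoothstep t).
have mF x (D : set R) : measurable_fun D (fun t => F t x).
  have mm : measurable_fun D (fun t => m t x).
    apply: measurable_funD; apply: measurable_funM => //; try exact: measurable_cst.
    by apply: measurable_funD; [exact: measurable_cst|apply: measurable_funM; [exact: measurable_cst|exact: mc]].
  apply: measurable_funD; apply: measurable_funM => //; try exact: measurable_cst.
  - apply: measurable_funM; first exact: measurable_cst.
    by apply: measurable_funB; [exact: measurable_cst|apply: measurable_funM; [exact: measurable_cst|exact: measurable_id]].
  - by apply: measurable_funB => //; exact: measurable_cst.
  - apply: measurable_funM; first exact: measurable_cst.
    apply: measurable_funB; first exact: measurable_cst.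
    by apply: measurable_funM; [exact: measurable_cst|apply: measurable_funM; exact: mbump].
have rhd t : 0 <= t <= 1 -> densities pi (rh t).
  move=> t01; have /andP[bt0 bt1] := b01 t t01; split.
    move=> x; rewrite /rh mulN1r addr_ge0// mulr_ge0 ?subr_ge0//; exact: m0.
  rewrite (eq_bigr (fun x => (1 + -1 * b t) * (m t x * pi x) + b t * pi x)); last first.
    by move=> x _; rewrite /rh; ring.
  by rewrite big_split -!mulr_sumr/= msum (pi_sum1 chain); ring.
have rhb t x : 0 <= t <= 1 -> b t <= rh t x.
  move=> t01; have /andP[bt0 bt1] := b01 t t01.
  by rewrite /rh mulN1r lerDr mulr_ge0 ?subr_ge0//; exact: m0.
pose g (t : R) := 4 * (C1 * K) ^+ 2 * S * ((r + e) ^+ 2 / e).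
have g0 : 0 <= 4 * (C1 * K) ^+ 2 * S * ((r + e) ^+ 2 / e).
  apply: mulr_ge0; last by rewrite divr_ge0 ?sqr_ge0 ?ltW.
  by apply: mulr_ge0 => //; apply: mulr_ge0 => //; exact: sqr_ge0.
have := @flux_path rh V g rhd _ _ _ _ _ _ _ _.
have -> : rh 0 = rho.
  by apply/funext => x; rewrite /rh /m /b /c bump0 smoothstep0; ring.
have -> : rh 1 = sigma.
  by apply/funext => x; rewrite /rh /m /b /c bump1 smoothstep1; ring.
move=> main; apply: le_trans (main _ _ _ _ _ _ _ _) _ => //.
- move=> x; apply: (@ac_deriv _ 0 1 _ (fun t => bump t * F t x) (K * (r + e))) => t t01.
  have /andP[bt0 bt1] := bump_bounds t01.
  by rewrite normrM ger0_norm// -[leRHS]mul1r ler_pM// FK.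
- by move=> t _ x y; rewrite /V -mulrN opprB.
- move=> x y; apply: measurable_funM => //.
  by apply: measurable_funB; apply: measurable_poisson => *; try exact: measurable_cst; exact: mF.
- apply: aeW => t t01 x; have [df ->] := deriv_derive1 (drh t x); split => //.
  have := @poissonP _ _ _ _ chain (fun _ _ => 1) (F t) x (fun _ _ => ltr01) (fun _ _ => erefl) (F0 t).
  under eq_bigr do rewrite mulr1.
  move=> PE; have -> : \sum_y V t x y * Q x y = bump t * \sum_y
      (poisson Q pi (fun _ _ => 1) (F t) y - poisson Q pi (fun _ _ => 1) (F t) x) * Q x y.
    by rewrite mulr_sumr; apply: eq_bigr => y _; rewrite /V mulrA.
  by rewrite PE; ring.
- move=> t /[dup] t01 /andP[t0 t1] x; apply: lt_le_trans (rhb t x _); last by rewrite !ltW.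
  exact: bgt.
- exact: measurable_cst.
- apply: aeW => t /[dup] t01' /andP[t0 t1]; have t01 : 0 <= t <= 1 by rewrite !ltW.
  have bp := bump_gt0 t01'.
  rewrite /g /S -(mulrA _ S) (mulrC S) mulrA mulr_sumr; apply: ler_sum => x _.
  rewrite mulr_sumr; apply: ler_sum => y _.
  rewrite -mulrA; apply: ler_wpM2r; first exact: (flow_ge0 chain).
  have bt := bgt t t01'.
  have lmb : b t <= log_mean (rh t x) (rh t y).
    by apply: log_mean_ge_min; [exact: ltW|exact: rhb|exact: rhb].
  have lm0 := lt_le_trans bt lmb.
  have V2 : V t x y ^+ 2 <= (bump t * (2 * (C1 * (K * (r + e))))) ^+ 2.
    rewrite -[leLHS]real_normK ?num_real// ler_sqr ?nnegrE//; last first.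
      move: (bump t) (ltW bp) => z z0.
      by do 4! [apply: mulr_ge0 => //]; rewrite addr_ge0// ltW.
    rewrite /V normrM gtr0_norm// ler_pM2l//.
    apply: (le_trans (ler_normB _ _)).
    by rewrite mulr_natl mulr2n; apply: lerD; apply: hC1 => z; exact: FK.
  rewrite ler_pdivrMr//; apply: (le_trans V2).
  apply: (@le_trans _ _ (4 * (C1 * K) ^+ 2 * ((r + e) ^+ 2 / e) * b t)).
    rewrite /b le_eqVlt; apply/orP; left; apply/eqP; field.
    by rewrite gt_eqF.
  apply: ler_wpM2l lmb; apply: mulr_ge0; last by rewrite divr_ge0 ?sqr_ge0 ?ltW.
  by apply: mulr_ge0 => //; exact: sqr_ge0.
- rewrite /g integral_cst01 -EFinM lee_fin /g; set z := _ / e.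
  have z0 : 0 <= z by rewrite /z divr_ge0 ?sqr_ge0 ?ltW.
  have : 0 <= (C1 * K) ^+ 2 * S * z by apply: mulr_ge0 => //; apply: mulr_ge0 => //; exact: sqr_ge0.
  by move: z0; move: ((C1 * K) ^+ 2) => q; clear; nra.
Qed.

End TransportCost.

(** * Distance to the constant density bounded by the vertex distances *)

Section DiameterBound.
Context {R : realType} {X : finType}.
Variables (Q : X -> X -> R) (pi : X -> R).
Hypothesis chain : irreducible_reversible_chain Q pi.
Implicit Types (a b c d t : R) (rho psi : R -> X -> R).
Local Notation mu := (@lebesgue_measure R).
Local Notation AC := absolutely_continuous_on.
Local Notation W2 := (transport_dist_sqr Q pi).

Lemma finite_lower_bound (f : X -> R) : (forall x, 0 < f x) ->
  exists m : R, 0 < m <= 2^-1 /\ forall x, m <= f x.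
Proof.
move=> f0; have S0 : 0 <= \sum_x (f x)^-1 by apply: sumr_ge0 => x _; rewrite invr_ge0 ltW.
have S2 : 0 < 2 + \sum_x (f x)^-1 by rewrite ltr_pwDl.
exists (2 + \sum_x (f x)^-1)^-1; split.
  by rewrite invr_gt0 S2/= lef_pV2 ?posrE// lerDl.
move=> x; rewrite -[leRHS]invrK lef_pV2 ?posrE ?invr_gt0//.
rewrite (bigD1 x)//= addrCA lerDl addr_ge0//.
by apply: sumr_ge0 => y _; rewrite invr_ge0 ltW.
Qed.

Lemma ae_finite (I : finType) (P : I -> R -> Prop) :
  (forall i, {ae mu, forall t, P i t}) -> {ae mu, forall t, forall i, P i t}.
Proof.
move=> h; have F := ae_filter_ringOfSetsType mu.
exact: (@filter_forall _ I P _ F h).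
Qed.

Lemma one_density : densities pi (fun=> 1).
Proof.
split => [x|]; first exact: ler01.
by under eq_bigr do rewrite mul1r; exact: (pi_sum1 chain).
Qed.

(** Joint convexity of [v^2 / th]: expand the nonnegative sum of [w i * (g i - v)^2] at
    [v = V / th]. *)
Lemma jensen_flux (I : finType) (w g : I -> R) (th : R) : (forall i, 0 <= w i) ->
  0 < th -> \sum_i w i <= th ->
  (\sum_i w i * g i) ^+ 2 / th <= \sum_i w i * g i ^+ 2.
Proof.
move=> w0 th0 hw; set V := \sum_i w i * g i.
pose v := V / th.
have : 0 <= \sum_i w i * (g i - v) ^+ 2.
  by apply: sumr_ge0 => i _; rewrite mulr_ge0 ?sqr_ge0.
have -> : \sum_i w i * (g i - v) ^+ 2 =
    (\sum_i w i * g i ^+ 2) - 2 * v * V + (\sum_i w i) * v ^+ 2.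
  rewrite /V mulr_sumr -sumrB mulr_suml -big_split/=.
  by apply: eq_bigr => i _; ring.
have h := ler_wpM2r (sqr_ge0 v) hw.
have -> : V ^+ 2 / th = th * v ^+ 2 by rewrite /v; field; rewrite gt_eqF.
have -> : V = th * v by rewrite /v; field; rewrite gt_eqF.
move: h; move: (\sum_i w i * g i ^+ 2) (\sum_i w i) => C B.
by clear; nra.
Qed.

(** Near-optimal paths between Dirac densities are mixed along the product coupling of
    [(rho - del) * pi] with [pi]. The remaining constant [del] stays at rest and keeps the mixture
    positive, as [flux_path] requires. Fluxes add up, and the energy of the mixture is controlled by
    [log_mean_concave] together with [jensen_flux]. *)
Lemma W2_to_uniform (D2 : R) (rho : X -> R) :
  (forall x y, (W2 (dirac_density pi x) (dirac_density pi y) <= D2%:E)%E) ->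
  positive_densities pi rho -> (W2 rho (fun=> 1%R) <= D2%:E)%E.
Proof.
move=> hD [[_ rho1] rho0].
apply/lee_addgt0Pr => e e0.
have [del [/andP[d0 d2] hdel]] := finite_lower_bound rho0.
have d1 : del < 1 by apply: le_lt_trans d2 _; rewrite invf_lt1// ltr1n.
pose a (i : X * X) := (rho i.1 - del) * pi i.1 * pi i.2.
have pi0 x := ltW (pi_gt0 chain x).
have a0 i : 0 <= a i by rewrite /a !mulr_ge0 ?subr_ge0.
have aS : \sum_i a i = 1 - del.
  rewrite -(pair_bigA _ (fun x y => (rho x - del) * pi x * pi y))/=.
  under eq_bigr do rewrite -mulr_sumr (pi_sum1 chain) mulr1 mulrBl.
  by rewrite sumrB rho1 -mulr_sumr (pi_sum1 chain) mulr1.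
have P (i : X * X) : exists rs : (R -> X -> R) * (R -> X -> R),
    [/\ path_on Q pi 0 1 rs.1 rs.2, rs.1 0 = dirac_density pi i.1,
        rs.1 1 = dirac_density pi i.2 &
        (kinetic_integral Q pi 0 1 rs.1 rs.2 <= (2 * (D2 + e))%:E)%E].
  have [|r [s [p r0 r1 k]]] := @W2_lt_path _ _ Q pi (dirac_density pi i.1) (dirac_density pi i.2) (D2 + e).
    by apply: le_lt_trans (hD _ _) _; rewrite lte_fin ltrDl.
  by exists (r, s); split => //; exact: ltW.
have {P}[rs P] := choice P.
pose r i := (rs i).1; pose s i := (rs i).2.
have pth i : path_on Q pi 0 1 (r i) (s i) by have [] := P i.
have r0 i : r i 0 = dirac_density pi i.1 by have [] := P i.
have r1 i : r i 1 = dirac_density pi i.2 by have [] := P i.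
have ki i : (kinetic_integral Q pi 0 1 (r i) (s i) <= (2 * (D2 + e))%:E)%E by have [] := P i.
have rpos i t z : 0 <= t <= 1 -> 0 <= r i t z by move=> /(po_density (pth i))[].
pose rh (t : R) z : R := del + \sum_i a i * r i t z.
pose V (t : R) z w : R := \sum_i a i * log_mean (r i t z) (r i t w) * (s i t w - s i t z).
pose g (t : R) : R := \sum_i a i * kinetic Q pi (r i t) (s i t).
have g0 t : 0 <= g t by apply: sumr_ge0 => i _; rewrite mulr_ge0 ?(kinetic_ge0 chain).
have -> : rho = rh 0.
  apply/funext => z; rewrite /rh; under eq_bigr do rewrite r0.
  rewrite -(pair_bigA _ (fun x y => (rho x - del) * pi x * pi y * dirac_density pi x z))/=.
  under eq_bigr do rewrite -mulr_suml -mulr_sumr (pi_sum1 chain) mulr1.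
  rewrite (bigD1 z)//= big1 => [|x xz].
    by rewrite /dirac_density eqxx addr0 mul1r mulfK ?gt_eqF ?(pi_gt0 chain)// addrC subrK.
  by rewrite /dirac_density eq_sym (negbTE xz) mul0r mulr0.
have -> : (fun=> 1) = rh 1.
  apply/funext => z; rewrite /rh; under eq_bigr do rewrite r1.
  rewrite -(pair_bigA _ (fun x y => (rho x - del) * pi x * pi y * dirac_density pi y z))/=.
  rewrite (eq_bigr (fun x => (rho x - del) * pi x)); last first.
    move=> x _; rewrite (bigD1 z)//= big1 => [|y yz].
      by rewrite /dirac_density eqxx addr0 mul1r mulfK ?gt_eqF ?(pi_gt0 chain).
    by rewrite /dirac_density eq_sym (negbTE yz) mul0r mulr0.
  under eq_bigr do rewrite mulrBl.
  by rewrite sumrB rho1 -mulr_sumr (pi_sum1 chain) mulr1 addrC subrK.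
have rhge t z : 0 <= t <= 1 -> del <= rh t z.
  by move=> t01; rewrite /rh lerDl sumr_ge0// => i _; rewrite mulr_ge0// rpos.
have main : (W2 (rh 0%R) (rh 1%R) <= (2^-1)%:E * \int[mu]_(t in `[0%R, 1%R]) (g t)%:E)%E.
  apply: (flux_path chain (V := V)) => //.
  - move=> t t01; split; first by move=> z; rewrite (le_trans (ltW d0))// rhge.
    rewrite (eq_bigr (fun z => del * pi z + \sum_i a i * (r i t z * pi z))); last first.
      move=> z _; rewrite /rh mulrDl mulr_suml; congr (_ + _); apply: eq_bigr => i _.
      by rewrite mulrA.
    rewrite big_split/= -mulr_sumr (pi_sum1 chain) mulr1 exchange_big/=.
    rewrite (eq_bigr a); first by rewrite aS addrC subrK.
    by move=> i _; rewrite -mulr_sumr (proj2 (po_density (pth i) t01)) mulr1.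
  - move=> z; apply: acD; first exact: ac_cst.
    by apply: ac_sum => i; apply: acZ; exact: po_ac (pth i) z.
  - move=> t /andP[t0 t1] z w; have t01 : 0 <= t <= 1 by rewrite !ltW.
    rewrite /V -sumrN; apply: eq_bigr => i _.
    by rewrite (@log_meanC _ (r i t z)) ?rpos// -mulrN opprB.
  - move=> z w; apply: measurable_sum => i; apply: measurable_funM.
      apply: measurable_funM; first exact: measurable_cst.
      apply: measurable_log_mean => //; try exact: ac_measurable (po_ac (pth i) _).
        by move=> t; rewrite /= in_itv/=; exact: rpos.
      by move=> t; rewrite /= in_itv/=; exact: rpos.
    by apply: measurable_funB; exact: po_measurable (pth i) _.
  - apply: aeS (ae_finite (fun i => po_eq (pth i))) => t h t01 z.
    have dr i : is_derive t (1 : R) (fun u => r i u z) (derive1 (fun u => r i u z) t).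
      by apply: derive1_deriv; have [] := h i t01 z.
    have := derivD (deriv_cst t del) (deriv_sum (index_enum _) (fun i => derivZ (a i) (dr i))).
    move=> /deriv_derive1[df ->]; split => //.
    rewrite add0r /V; under [X in _ + X]eq_bigr do rewrite mulr_suml.
    rewrite exchange_big -big_split/=; apply: big1 => i _.
    have [_ E] := h i t01 z.
    rewrite [X in _ + X](_ : _ = a i * \sum_y (s i t y - s i t z) * log_mean (r i t z) (r i t y) * Q z y).
      by rewrite -mulrDr E mulr0.
    by rewrite mulr_sumr; apply: eq_bigr => y _; ring.
  - move=> t /andP[t0 t1] z; apply: lt_le_trans d0 (rhge _ _ _); by rewrite !ltW.
  - apply: measurable_sum => i; apply: measurable_funM; first exact: measurable_cst.
    exact: (measurable_kinetic (pth i)).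
  - apply: aeW => t /andP[t0 t1]; have t01 : 0 <= t <= 1 by rewrite !ltW.
    rewrite /g /kinetic.
    under [leRHS]eq_bigr do rewrite mulr_sumr.
    rewrite [leRHS]exchange_big; apply: ler_sum => z _ /=.
    under [leRHS]eq_bigr do rewrite mulr_sumr.
    rewrite [leRHS]exchange_big; apply: ler_sum => w _ /=.
    rewrite [leRHS](_ : _ = (\sum_i a i * log_mean (r i t z) (r i t w) * (s i t w - s i t z) ^+ 2) *
      (Q z w * pi z)); last by rewrite mulr_suml; apply: eq_bigr => i _; ring.
    rewrite -(mulrA _ (Q z w)); apply: ler_wpM2r; first exact: (flow_ge0 chain).
    have rp u : 0 < rh t u by apply: lt_le_trans d0 (rhge _ _ _).
    apply: jensen_flux; first by move=> i; rewrite mulr_ge0// log_mean_ge0.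
      exact: log_mean_gt0.
    apply: log_mean_concave => //.
    + by move=> i; exact: rpos.
    + by move=> i; exact: rpos.
    + by rewrite /rh lerDr ltW.
    + by rewrite /rh lerDr ltW.
apply: (le_trans main).
have -> : (\int[mu]_(t in `[0%R, 1%R]) (g t)%:E = \sum_i (a i)%:E * kinetic_integral Q pi 0 1 (r i) (s i))%E.
  rewrite /g; under eq_integral do rewrite -sumEFin.
  rewrite ge0_integral_sum//.
  - apply: eq_bigr => i _; under eq_integral do rewrite EFinM.
    rewrite ge0_integralZl//.
    + by apply/measurable_EFinP; exact: (measurable_kinetic (pth i)).
    + by move=> t _; rewrite lee_fin (kinetic_ge0 chain).
    + by rewrite lee_fin.
  - move=> i; apply/measurable_EFinP; apply: measurable_funM; first exact: measurable_cst.
    exact: (measurable_kinetic (pth i)).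
  - by move=> i t _; rewrite lee_fin mulr_ge0// (kinetic_ge0 chain).
apply: (@le_trans _ _ ((2^-1)%:E * \sum_i (a i)%:E * (2 * (D2 + e))%:E)%E).
  apply: lee_wpmul2l; first by rewrite lee_fin invr_ge0.
  by apply: lee_sum => i _; apply: lee_wpmul2l; rewrite ?lee_fin.
under eq_bigr do rewrite -EFinM.
rewrite sumEFin -mulr_suml aS -EFinM lee_fin.
have De : 0 <= D2 + e.
  have [x0 _] : exists x0 : X, True.
    apply: contrapT => h; have := pi_sum1 chain; rewrite big1; last first.
      by move=> x _; exfalso; apply: h; exists x.
    by move=> /eqP; rewrite eq_sym oner_eq0.
  rewrite addr_ge0// ?(ltW e0)// -lee_fin.
  by apply: le_trans (hD x0 x0); exact: (W2_ge0 chain).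
rewrite (_ : 2^-1 * _ = (1 - del) * (D2 + e)); last by field.
by rewrite ler_piMl// gerBl ltW.
Qed.

End DiameterBound.

(** * Finiteness of the distance and existence of geodesics *)

Section Geodesics.
Context {R : realType} {X : finType}.
Variables (Q : X -> X -> R) (pi : X -> R).
Hypothesis chain : irreducible_reversible_chain Q pi.
Implicit Types (a b c d s t : R) (rho sigma tau : X -> R).
Local Notation W2 := (transport_dist_sqr Q pi).

(** Real-valued: [fine] loses nothing between densities, where the infimum is finite by
    [W2_fin_num]. *)
Definition dist rho sigma : R := Num.sqrt (fine (W2 rho sigma)).

Lemma dist_ge0 rho sigma : 0 <= dist rho sigma.
Proof. exact: sqrtr_ge0. Qed.

Lemma distC rho sigma : dist rho sigma = dist sigma rho.
Proof. by rewrite /dist (W2C chain). Qed.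

(** The continuity estimate with crude choices, [e = 1] and [r] the common bound on densities,
    already gives a finite value. *)
Lemma W2_fin_num rho sigma : densities pi rho -> densities pi sigma ->
  W2 rho sigma \is a fin_num.
Proof.
move=> dr ds; have [C C0 hC] := W2_continuity chain.
rewrite ge0_fin_numE ?(W2_ge0 chain)//.
have := hC rho sigma (density_bound pi) 1 dr ds _ _.
rewrite ltr01 lexx => /(_ isT) h.
apply: le_lt_trans (h _) (ltry _) => x.
have h1 := density_le_bound chain x dr; have h2 := density_le_bound chain x ds.
have [h3 _] := dr; have [h4 _] := ds.
by have := h3 x; have := h4 x; rewrite ler_norml; move: h1 h2; clear; lra.
Qed.

Lemma W2E rho sigma : densities pi rho -> densities pi sigma ->
  W2 rho sigma = (dist rho sigma ^+ 2)%:E.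
Proof.
move=> dr ds; rewrite /dist sqr_sqrtr ?fineK ?W2_fin_num//.
by rewrite -lee_fin fineK ?W2_fin_num// (W2_ge0 chain).
Qed.

Lemma transport_distE rho sigma : densities pi rho -> densities pi sigma ->
  transport_dist Q pi rho sigma = (dist rho sigma)%:E.
Proof.
by move=> dr ds; rewrite /transport_dist -[X in sqrte X]fineK ?W2_fin_num.
Qed.

Lemma dist_le rho sigma (e : R) : densities pi rho -> densities pi sigma -> 0 <= e ->
  (W2 rho sigma <= (e ^+ 2)%:E)%E -> dist rho sigma <= e.
Proof.
move=> dr ds e0; rewrite W2E// lee_fin => h.
by rewrite -ler_sqr ?nnegrE// dist_ge0.
Qed.

Lemma dist_triangle sigma rho tau : densities pi rho -> densities pi sigma ->
  densities pi tau -> dist rho tau <= dist rho sigma + dist sigma tau.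
Proof.
move=> dr ds dt; apply/ler_addgt0Pr => e e0.
have e20 : 0 < e / 2 by rewrite divr_gt0.
have lt a : 0 <= a -> a ^+ 2 < (a + e / 2) ^+ 2.
  move=> a0; have ae : 0 <= a + e / 2 by rewrite addr_ge0// ltW.
  by rewrite ltr_sqr ?nnegrE// ltrDl.
rewrite [e]splitr addrACA; apply: dist_le => //.
  by rewrite !addr_ge0 ?dist_ge0// ltW.
apply: (W2_concat chain) (_ : (W2 rho sigma < _)%E) (_ : (W2 sigma tau < _)%E).
- by rewrite ltr_wpDl ?dist_ge0.
- by rewrite ltr_wpDl ?dist_ge0.
- by rewrite W2E// lte_fin lt// dist_ge0.
- by rewrite W2E// lte_fin lt// dist_ge0.
Qed.

Lemma dist_continuity (e : R) : 0 < e -> exists2 del : R, 0 < del &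
  forall rho sigma, densities pi rho -> densities pi sigma ->
    (forall x, `|rho x - sigma x| <= del) -> dist rho sigma <= e.
Proof.
move=> e0; have [C C0 hC] := W2_continuity chain.
(* With [r = e = del], [W2_continuity] bounds the squared distance by [4 * C * del]. *)
pose del := Num.min 1 (e ^+ 2 / (4 * C)).
have C4 : 0 < 4 * C by rewrite mulr_gt0.
have d0 : 0 < del by rewrite lt_min ltr01 divr_gt0// exprn_gt0.
exists del => // rho sigma dr ds h.
apply: dist_le => //; first exact: ltW.
have := hC rho sigma del del dr ds _ h; rewrite d0 ge_min lexx/= => /(_ isT)/le_trans; apply.
have -> : C * ((del + del) ^+ 2 / del) = 4 * C * del by field; rewrite gt_eqF.
by rewrite lee_fin mulrC -ler_pdivlMr// ge_min lexx orbT.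
Qed.

Lemma dist_self rho : densities pi rho -> dist rho rho = 0.
Proof.
move=> dr; apply/eqP; rewrite eq_le dist_ge0 andbT.
apply/ler_addgt0Pr => e /dist_continuity[del d0]; rewrite add0r; apply => // x.
by rewrite subrr normr0 ltW.
Qed.

(** Stability in Cauchy-Schwarz. Three pieces of durations [s, t, u] have lengths [a, b, c] and
    energies [A, B, C]; if the total energy exceeds [w^2] by at most [e^2], the middle piece cannot
    be much longer than its share [t * w]. The core is the identity [(b - t w)^2 = t (w - b)^2 + (1
    - t) b^2 - t (1 - t) w^2]. *)
Lemma near_geodesic_algebra (a b c w s t u A B C e : R) :
  0 <= a -> 0 <= b -> 0 <= c -> 0 <= w -> 0 <= s -> 0 <= t -> 0 <= u ->
  0 <= A -> 0 <= B -> 0 <= C -> 0 <= e -> s + t + u = 1 ->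
  a ^+ 2 <= s * A -> b ^+ 2 <= t * B -> c ^+ 2 <= u * C ->
  A + B + C <= w ^+ 2 + e ^+ 2 -> w <= a + b + c -> b <= t * w + 2 * e.
Proof.
move=> a0 b0 c0 w0 s0 t0 u0 A0 B0 C0 e0 stu ha hb hc hE hw.
have t1 : t <= 1 by move: stu s0 u0; clear; lra.
have ac : 2 * (a * c) <= u * A + s * C.
  rewrite -ler_sqr ?nnegrE ?mulr_ge0 ?addr_ge0 ?mulr_ge0//.
  apply: (@le_trans _ _ (4 * ((s * A) * (u * C)))).
    rewrite !exprMn (_ : 2 ^+ 2 = 4); last by ring.
    by rewrite ler_pM2l//; apply: ler_pM => //; exact: sqr_ge0.
  rewrite -subr_ge0 (_ : _ - _ = (u * A - s * C) ^+ 2) ?sqr_ge0//; ring.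
have ac2 : (a + c) ^+ 2 <= (1 - t) * (A + C).
  have -> : 1 - t = s + u by move: stu; clear; lra.
  by move: ha hc ac; rewrite sqrrD mulr2n; clear; lra.
have [bw|wb] := leP b w.
  have wb2 : (w - b) ^+ 2 <= (1 - t) * (w ^+ 2 + e ^+ 2 - B).
    apply: (@le_trans _ _ ((a + c) ^+ 2)).
      rewrite ler_sqr ?nnegrE ?subr_ge0 ?addr_ge0//.
      by move: hw; clear; lra.
    apply: (le_trans ac2); apply: ler_wpM2l; first by rewrite subr_ge0.
    by move: hE; clear; lra.
  have h : (b - t * w) ^+ 2 <= e ^+ 2.
    have h1 := ler_wpM2l t0 wb2.
    have h2 : (1 - t) * b ^+ 2 <= (1 - t) * (t * B) by apply: ler_wpM2l => //; rewrite subr_ge0.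
    have h3 : t * (1 - t) * e ^+ 2 <= e ^+ 2.
      by rewrite ler_piMl ?sqr_ge0// mulr_ile1// ?subr_ge0// gerBl.
    have -> : (b - t * w) ^+ 2 = t * (w - b) ^+ 2 + (1 - t) * b ^+ 2 - t * (1 - t) * w ^+ 2 by ring.
    have E : t * ((1 - t) * (w ^+ 2 + e ^+ 2 - B)) =
      t * (1 - t) * w ^+ 2 + t * (1 - t) * e ^+ 2 - (1 - t) * (t * B) by ring.
    rewrite E in h1; move: h1 h2 h3.
    move: (t * (w - b) ^+ 2) ((1 - t) * b ^+ 2) (t * (1 - t) * w ^+ 2)
      (t * (1 - t) * e ^+ 2) ((1 - t) * (t * B)) (e ^+ 2) => z1 z2 z3 z4 z5 z6.
    by clear; lra.
  have : b - t * w <= e.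
    apply: (le_trans (ler_norm _)); rewrite -ler_sqr ?nnegrE// real_normK ?num_real//.
  by move: e0; clear; lra.
(* When [b > w], the energy bound gives [b <= w + e] and also forces [(1 - t) w <= e]. *)
have hb2 : b ^+ 2 <= t * (w ^+ 2 + e ^+ 2).
  apply: (le_trans hb); apply: ler_wpM2l => //; move: A0 C0 hE; clear; lra.
have hbw : b <= w + e.
  rewrite -ler_sqr ?nnegrE ?addr_ge0//; apply: (le_trans hb2).
  apply: (@le_trans _ _ (w ^+ 2 + e ^+ 2)).
    by rewrite ler_piMl// addr_ge0 ?sqr_ge0.
  rewrite -subr_ge0 (_ : _ - _ = 2 * (w * e)); last by ring.
  by rewrite mulr_ge0// mulr_ge0.
have wb2 : w ^+ 2 <= b ^+ 2 by rewrite ler_sqr ?nnegrE// ltW.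
have tw : (1 - t) * w <= e.
  have h0 : 0 <= 1 - t by rewrite subr_ge0.
  rewrite -ler_sqr ?nnegrE ?mulr_ge0//.
  apply: (@le_trans _ _ ((1 - t) * w ^+ 2)).
    rewrite exprMn; apply: ler_wpM2r; first exact: sqr_ge0.
    by rewrite expr2 ler_piMl// gerBl.
  apply: (@le_trans _ _ (t * e ^+ 2)); last by rewrite ler_piMl// sqr_ge0.
  by move: wb2 hb2; clear; lra.
by move: tw hbw; clear; lra.
Qed.

Lemma dist_le_kinetic a b (r p : R -> X -> R) (E : R) : a <= b -> path_on Q pi a b r p ->
  kinetic_integral Q pi a b r p = E%:E -> dist (r a) (r b) ^+ 2 <= (b - a) * (E / 2).
Proof.
move=> ab pth kE; have da : densities pi (r a) by apply: po_density pth _ _; rewrite lexx.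
have db : densities pi (r b) by apply: po_density pth _ _; rewrite lexx ab.
have [<-|ne] := eqVneq a b; first by rewrite dist_self// expr0n subrr mul0r.
have lt : a < b by rewrite lt_neqAle ne.
have := W2_le_kinetic chain lt pth; rewrite kE W2E// lee_fin => /le_trans; apply.
by rewrite -mulrA (mulrC 2^-1).
Qed.

Lemma near_geodesic (r p : R -> X -> R) (e : R) : 0 <= e -> path_on Q pi 0 1 r p ->
  (kinetic_integral Q pi 0 1 r p <= (2 * (dist (r 0%R) (r 1%R) ^+ 2 + e ^+ 2))%:E)%E ->
  forall s t, 0 <= s -> s <= t -> t <= 1 ->
    dist (r s) (r t) <= (t - s) * dist (r 0) (r 1) + 2 * e.
Proof.
move=> e0 pth kin s t s0 st t1.
have mk := measurable_kinetic pth.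
have t0 := le_trans s0 st; have s1 := le_trans st t1.
have E1 : (kinetic_integral Q pi 0 1 r p = kinetic_integral Q pi 0 s r p +
    (kinetic_integral Q pi s t r p + kinetic_integral Q pi t 1 r p))%E.
  rewrite -(kinetic_integral_split chain (a := s))//; last 2 first.
  - by rewrite st.
  - apply: measurable_funS mk => // x; rewrite /= !in_itv/= => /andP[sx ->].
    by rewrite (le_trans s0).
  by rewrite (kinetic_integral_split chain (c := s))// s0.
have fin u v : (0 <= kinetic_integral Q pi u v r p)%E by exact: (kinetic_integral_ge0 chain).
rewrite E1 in kin.
have lty (y : R) (P Z : \bar R) : (0 <= P)%E -> (0 <= Z)%E -> (P + Z <= y%:E)%E ->
    P \is a fin_num /\ Z \is a fin_num.
  move=> P0 Z0 h; rewrite !ge0_fin_numE//; split; apply: le_lt_trans (ltry y); apply: le_trans h.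
    exact: leeDl.
  exact: leeDr.
have [fA fBC] := lty _ _ _ (fin _ _) (adde_ge0 (fin _ _) (fin _ _)) kin.
have [fB fC] : kinetic_integral Q pi s t r p \is a fin_num /\
    kinetic_integral Q pi t 1 r p \is a fin_num.
  by apply: (lty (fine (kinetic_integral Q pi s t r p + kinetic_integral Q pi t 1 r p)%E)) => //;
    rewrite fineK.
have /esym kA := fineK fA; have /esym kB := fineK fB; have /esym kC := fineK fC.
move: (fine (kinetic_integral Q pi 0 s r p)) (fine (kinetic_integral Q pi s t r p))
  (fine (kinetic_integral Q pi t 1 r p)) kA kB kC => A B C kA kB kC.
have A0 : 0 <= A by rewrite -lee_fin -kA.
have B0 : 0 <= B by rewrite -lee_fin -kB.
have C0 : 0 <= C by rewrite -lee_fin -kC.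
have pA := dist_le_kinetic s0 (path_sub (lexx 0) s1 pth) kA.
have pB := dist_le_kinetic st (path_sub s0 t1 pth) kB.
have pC := dist_le_kinetic t1 (path_sub t0 (lexx 1) pth) kC.
rewrite kA kB kC -!EFinD lee_fin in kin.
have dd u : 0 <= u <= 1 -> densities pi (r u) by exact: po_density pth u.
have d0 : densities pi (r 0) by apply: dd; rewrite lexx ler01.
have d1 : densities pi (r 1) by apply: dd; rewrite lexx ler01.
have ds : densities pi (r s) by apply: dd; rewrite s0.
have dt : densities pi (r t) by apply: dd; rewrite t0.
apply: (@near_geodesic_algebra (dist (r 0) (r s)) _ (dist (r t) (r 1)) _ s (t - s) (1 - t)
  (A / 2) (B / 2) (C / 2)) => //; rewrite ?dist_ge0 ?subr_ge0 ?divr_ge0//.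
- by ring.
- by rewrite -[s in s * _]subr0.
- by move: kin; clear; lra.
- apply: (le_trans (dist_triangle d0 ds d1)).
  by rewrite -addrA lerD2l; exact: dist_triangle.
Qed.

Lemma ultra_bounded_limit (U : set_system nat) (f : nat -> R) (M : R) :
  UltraFilter U -> (forall k, 0 <= f k <= M) ->
  exists p : R, forall e : R, 0 < e -> U [set k | `|f k - p| < e].
Proof.
move=> UU fM; have PU : ProperFilter U := @ultra_proper _ _ UU.
have FM : (f @ U) `[0, M]%classic.
  rewrite /fmap /= (_ : f @^-1` `[0, M]%classic = setT); first exact: filterT.
  by apply/seteqP; split => // k _ /=; rewrite in_itv/= fM.
have [p [_ cp]] := @segment_compact R 0 M (f @ U) _ FM.
exists p => e e0; have [//|nB] := in_ultra_setVsetC [set k | `|f k - p| < e] UU.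
have [|y [/= y1 y2]] := cp (~` ball p e) (ball p e) _ (nbhsx_ballx p e e0).
  by apply: (@filterS nat U _ _ _ _ nB) => k h hb; apply: h; rewrite /= distrC; exact: hb.
by [].
Qed.

(** Near-minimal paths converge pointwise along an ultrafilter, at all times at once. Continuity of
    [dist] passes [near_geodesic] to the limit as upper bounds on distances, and the triangle
    inequality between the endpoints turns these into equalities. *)
Lemma geodesic_exists rho0 rho1 : densities pi rho0 -> densities pi rho1 ->
  exists rho : R -> X -> R, [/\ constant_speed_geodesic Q pi rho, rho 0 = rho0 & rho 1 = rho1].
Proof.
move=> dr0 dr1; set w := dist rho0 rho1.
have P (k : nat) : exists rp : (R -> X -> R) * (R -> X -> R),
    [/\ path_on Q pi 0 1 rp.1 rp.2, rp.1 0 = rho0, rp.1 1 = rho1 &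
    (kinetic_integral Q pi 0 1 rp.1 rp.2 <= (2 * (w ^+ 2 + k.+1%:R^-1 ^+ 2))%:E)%E].
  have [|r [p [pth r0 r1 h]]] := @W2_lt_path _ _ Q pi rho0 rho1 (w ^+ 2 + k.+1%:R^-1 ^+ 2).
    by rewrite W2E// lte_fin ltrDl exprn_gt0// invr_gt0.
  by exists (r, p); split => //; exact: ltW.
have {P}[rp P] := choice P.
pose r k := (rp k).1.
have pth k : path_on Q pi 0 1 (r k) (rp k).2 by have [] := P k.
have r0 k : r k 0 = rho0 by have [] := P k.
have r1 k : r k 1 = rho1 by have [] := P k.
have dr k t : 0 <= t <= 1 -> densities pi (r k t) by exact: po_density (pth k) t.
have near k s t : 0 <= s -> s <= t -> t <= 1 ->
    dist (r k s) (r k t) <= (t - s) * w + 2 * k.+1%:R^-1.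
  move=> s0 st t1; have := near_geodesic _ (pth k); rewrite -/(r k) r0 r1.
  by apply => //; rewrite ?invr_ge0//; have [] := P k.
have [U [UU sub]] := @ultraFilterLemma _ (\oo : set_system nat) _.
have PU : ProperFilter U := @ultra_proper _ _ UU.
have lim (tx : R * X) : exists p : R, 0 <= tx.1 <= 1 ->
    forall e : R, 0 < e -> U [set k | `|r k tx.1 tx.2 - p| < e].
  have [t01|nt] := boolP (0 <= tx.1 <= 1); last by exists 0.
  have [|p hp] := @ultra_bounded_limit U (fun k => r k tx.1 tx.2) (density_bound pi) UU.
    move=> k; have dk := dr k tx.1 t01; have [h _] := dk.
    by rewrite h (density_le_bound chain _ dk).
  by exists p.
have {lim}[L hL] := choice lim.
pose rho t x := L (t, x).
have close t (e : R) : 0 <= t <= 1 -> 0 < e -> U [set k | forall x, `|r k t x - rho t x| < e].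
  by move=> t01 e0; apply: filter_forall => x; exact: hL (t, x) t01 e e0.
have pick (A : set nat) : U A -> exists k, A k.
  by move=> /(@filter_ex _ U _).
have absd (x e : R) : (forall e : R, 0 < e -> `|x| < e) -> x = 0.
  move=> h; apply/eqP; rewrite -normr_le0; apply/ler_addgt0Pr => e' e'0.
  by rewrite add0r ltW// h.
have drho t : 0 <= t <= 1 -> densities pi (rho t).
  move=> t01; split.
    move=> x; rewrite leNgt; apply/negP => neg.
    have [|k hk] := pick _ (close t (- rho t x) t01 _); first by rewrite oppr_gt0.
    have [h _] := dr k t t01; have := hk x; have := h x.
    by move=> h1 /(le_lt_trans (ler_norm _)); move: h1; clear; lra.
  apply/eqP; rewrite -subr_eq0; apply/eqP/(absd _ 0) => e e0.
  have [k hk] := pick _ (close t e t01 e0).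
  have [_ h] := dr k t t01.
  rewrite -h -sumrB; apply: (le_lt_trans (ler_norm_sum _ _ _)).
  apply: (@lt_le_trans _ _ (\sum_x e * pi x)); last by rewrite -mulr_sumr (pi_sum1 chain) mulr1.
  have [x0 _] : exists x0 : X, True.
    apply: contrapT => hX; have := pi_sum1 chain; rewrite big1; last first.
      by move=> x _; exfalso; apply: hX; exists x.
    by move=> /eqP; rewrite eq_sym oner_eq0.
  rewrite (bigD1 x0)//= [ltRHS](bigD1 x0)//=; apply: ltr_leD.
    by rewrite -mulrBl normrM distrC (gtr0_norm (pi_gt0 chain x0)) ltr_pM2r ?(pi_gt0 chain).
  apply: ler_sum => x _.
  by rewrite -mulrBl normrM distrC (gtr0_norm (pi_gt0 chain x)) ler_pM2r ?(pi_gt0 chain)// ltW.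
have endpoint t rhot : 0 <= t <= 1 -> (forall k, r k t = rhot) -> rho t = rhot.
  move=> t01 h; apply/funext => x; apply/esym/eqP; rewrite -subr_eq0; apply/eqP/(absd _ 0) => e e0.
  by have [k hk] := pick _ (close t e t01 e0); have := hk x; rewrite h.
have rh0 : rho 0 = rho0 by apply: endpoint => //; rewrite lexx ler01.
have rh1 : rho 1 = rho1 by apply: endpoint => //; rewrite lexx ler01.
have up s t : 0 <= s -> s <= t -> t <= 1 -> dist (rho s) (rho t) <= (t - s) * w.
  move=> s0 st t1; have s01 : 0 <= s <= 1 by rewrite s0 (le_trans st).
  have t01 : 0 <= t <= 1 by rewrite t1 (le_trans s0).
  apply/ler_addgt0Pr => e e0.
  have e40 : 0 < e / 4 by rewrite divr_gt0.
  have [del d0 hdel] := dist_continuity e40.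
  have [N _ hN] := near_infty_natSinv_lt (PosNum e40).
  have inf : U [set k | (N <= k)%N] by apply: sub; exists N.
  have [k [[hk1 hk2] hk3]] := pick _ (filterI (filterI (close s del s01 d0) (close t del t01 d0)) inf).
  have h1 : dist (rho s) (r k s) <= e / 4.
    apply: hdel => // [||x]; [exact: drho|exact: dr|]; rewrite distrC; exact/ltW/hk1.
  have h2 : dist (r k t) (rho t) <= e / 4.
    apply: hdel => // [||x]; [exact: dr|exact: drho|]; exact/ltW/hk2.
  have h3 := near k s t s0 st t1.
  have h4 : k.+1%:R^-1 < e / 4 := hN k hk3.
  have h5 := dist_triangle (drho s s01) (dr k s s01) (drho t t01).
  have h6 := dist_triangle (dr k s s01) (dr k t t01) (drho t t01).
  by move: h1 h2 h3 h4 h5 h6; move: (k.+1%:R^-1) => z; clear; lra.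
have eqd s t : 0 <= s -> s <= t -> t <= 1 -> dist (rho s) (rho t) = (t - s) * w.
  move=> s0 st t1; have s01 : 0 <= s <= 1 by rewrite s0 (le_trans st).
  have t01 : 0 <= t <= 1 by rewrite t1 (le_trans s0).
  apply/eqP; rewrite eq_le up//=.
  have d00 : densities pi (rho 0) by rewrite rh0.
  have d11 : densities pi (rho 1) by rewrite rh1.
  have h1 := up 0 s (lexx 0) s0 (le_trans st t1).
  have h2 := up t 1 (le_trans s0 st) t1 (lexx 1).
  have h3 := dist_triangle d00 (drho s s01) d11.
  have h4 := dist_triangle (drho s s01) (drho t t01) d11.
  have h5 : w = dist (rho 0) (rho 1) by rewrite rh0 rh1.
  by move: h1 h2 h3 h4; rewrite -h5; clear; lra.
exists rho; split => //; split => // s t s01 t01.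
have d00 : densities pi (rho 0) by rewrite rh0.
have d11 : densities pi (rho 1) by rewrite rh1.
rewrite !transport_distE//; [|exact: drho|exact: drho].
rewrite rh0 rh1 -/w -EFinM; congr EFin.
move: s01 t01 => /andP[s0 s1] /andP[t0 t1].
have [st|/ltW ts] := leP s t.
  by rewrite eqd// distrC ger0_norm// subr_ge0.
by rewrite distC eqd// ger0_norm// subr_ge0.
Qed.

End Geodesics.

(** * HWI inequality *)

Section HWI.
Context {R : realType} {X : finType}.
Variables (Q : X -> X -> R) (pi : X -> R).
Hypothesis chain : irreducible_reversible_chain Q pi.
Implicit Types (a b c d s t : R) (rho sigma tau : X -> R).
Local Notation mu := (@lebesgue_measure R).
Local Notation W2 := (transport_dist_sqr Q pi).
Local Notation dist := (dist Q pi).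
Local Notation H := (entropy pi).
Local Notation Info rho := (dirichlet_form Q pi rho (fun x => ln (rho x))).

Lemma xlnx_tangent (s r : R) : 0 <= s -> 0 < r ->
  r * ln r + (ln r + 1) * (s - r) <= s * ln s.
Proof.
rewrite le_eqVlt => /predU1P[<- r0|s0 r0].
  by rewrite mul0r -subr_ge0 (_ : _ - _ = r) ?ltW//; ring.
have h : ln (r / s) <= r / s - 1.
  have := @le_ln1Dx R (r / s - 1); rewrite (_ : 1 + (r / s - 1) = r / s); last by ring.
  by apply; rewrite ltrBrDr addNr divr_gt0.
rewrite ln_div ?posrE// in h.
have h2 := ler_wpM2l (ltW s0) h.
have E : s * (r / s - 1) = r - s by field; rewrite gt_eqF.
by rewrite E in h2; lra.
Qed.

Lemma entropy_tangent rho sigma : positive_densities pi rho -> densities pi sigma ->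
  H rho - H sigma <= \sum_x ln (rho x) * (rho x - sigma x) * pi x.
Proof.
move=> [[_ r1] r0] [s0 s1].
have : 0 <= \sum_x pi x * (sigma x * ln (sigma x) -
   (rho x * ln (rho x) + (ln (rho x) + 1) * (sigma x - rho x))).
  apply: sumr_ge0 => x _; rewrite mulr_ge0 ?(ltW (pi_gt0 chain x))// subr_ge0.
  exact: xlnx_tangent.
have -> : \sum_x pi x * (sigma x * ln (sigma x) -
   (rho x * ln (rho x) + (ln (rho x) + 1) * (sigma x - rho x))) =
   H sigma - H rho + (\sum_x ln (rho x) * (rho x - sigma x) * pi x) +
   ((\sum_x rho x * pi x) - \sum_x sigma x * pi x).
  by rewrite /entropy -!sumrB -!big_split/=; apply: eq_bigr => x _; ring.
by rewrite r1 s1 subrr addr0; lra.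
Qed.

(** Half the kinetic energy of the potential [ln rho], the form in which it is compared with the
    energy of a path. *)
Lemma InfoE rho : (forall x, 0 < rho x) -> Info rho =
  2^-1 * \sum_x \sum_y (ln (rho y) - ln (rho x)) ^+ 2 * log_mean (rho x) (rho y) * Q x y * pi x.
Proof.
move=> r0; rewrite /dirichlet_form; congr (_ * _).
apply: eq_bigr => x _; apply: eq_bigr => y _.
by rewrite -(log_mean_ln (r0 x) (r0 y)); ring.
Qed.

Lemma Info_ge0 rho : (forall x, 0 < rho x) -> 0 <= Info rho.
Proof.
move=> r0; rewrite InfoE// mulr_ge0 ?invr_ge0//.
apply: sumr_ge0 => x _; apply: sumr_ge0 => y _.
by rewrite -mulrA mulr_ge0 ?(flow_ge0 chain)// mulr_ge0 ?sqr_ge0// log_mean_ge0.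
Qed.

Lemma amgm (u v b : R) : 0 < b -> u * v <= 2^-1 * (b * u ^+ 2 + v ^+ 2 / b).
Proof.
move=> b0; rewrite -subr_ge0.
have -> : 2^-1 * (b * u ^+ 2 + v ^+ 2 / b) - u * v = 2^-1 * ((b * u - v) ^+ 2 / b).
  by field; rewrite gt_eqF.
by rewrite mulr_ge0 ?invr_ge0// divr_ge0 ?sqr_ge0 ?ltW.
Qed.

Lemma integral_affine_kinetic a b (r p : R -> X -> R) (K k l : R) :
  path_on Q pi a b r p -> 0 <= k -> 0 <= l -> a <= b ->
  kinetic_integral Q pi a b r p = K%:E ->
  (\int[mu]_(t in `[a, b]) (k + l * kinetic Q pi (r t) (p t))%:E =
   (k * (b - a) + l * K)%:E)%E.
Proof.
move=> pth k0 l0 ab kE.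
under eq_integral do rewrite EFinD EFinM.
have mk := measurable_kinetic pth.
rewrite ge0_integralD//; last 2 first.
- by move=> t _; rewrite -EFinM lee_fin mulr_ge0// (kinetic_ge0 chain).
- apply: (eq_measurable_fun (fun t => (l * kinetic Q pi (r t) (p t))%:E)) => [t _|].
    by rewrite EFinM.
  by apply/measurable_EFinP; apply: measurable_funM => //; exact: measurable_cst.
rewrite ge0_integralZl//; last 2 first.
- exact/measurable_EFinP.
- by move=> t _; rewrite lee_fin (kinetic_ge0 chain).
rewrite -[X in (_ + _ * X)%E]/(kinetic_integral Q pi a b r p) kE.
have := @integral_cst _ _ R mu `[a, b]%classic (measurable_itv _) k%:E.
rewrite /cst /= => ->; rewrite lebesgue_measure_itv/= lte_fin.
case: (ltP a b) => // ba.
have -> : b = a by apply/eqP; rewrite eq_le ba ab.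
by rewrite mule0 add0e -EFinM subrr mulr0 add0r.
Qed.

(** By the continuity equation, the speed at [x] is at most the sum of
    [|p y - p x| * log_mean * Q x y]. Splitting each term by [amgm] with weight [b] bounds its
    integral by a density term of order [b] plus a multiple of [K / b], again of order [b]. *)
Lemma path_displacement : exists2 C : R, 0 < C & forall (r p : R -> X -> R) (K b : R),
  path_on Q pi 0 1 r p -> kinetic_integral Q pi 0 1 r p = K%:E -> 0 < b -> K <= b ^+ 2 ->
  forall t x, 0 <= t <= 1 -> `|r t x - r 0 x| <= C * b.
Proof.
pose M := density_bound pi; have M0 : 0 <= M := density_bound_ge0 chain.
pose C x := 2^-1 * (M * (\sum_y Q x y) + (pi x)^-1).
have C0 x : 0 <= C x.
  rewrite mulr_ge0 ?invr_ge0// addr_ge0 ?invr_ge0 ?(ltW (pi_gt0 chain x))//.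
  by rewrite mulr_ge0// sumr_ge0// => y _; exact: (rate_ge0 chain).
have S0 : 0 <= \sum_x C x by exact: sumr_ge0.
exists (\sum_x C x + 1); first by rewrite ltr_wpDl.
move=> r p K b pth kE b0 Kb t x /andP[t0 t1].
apply: (@le_trans _ _ (C x * b)); last first.
  apply: ler_wpM2r; first exact: ltW.
  rewrite (bigD1 x)//= -addrA lerDl addr_ge0//; exact: sumr_ge0.
have pth' := path_sub (lexx 0) t1 pth.
pose g s := 2^-1 * b * M * (\sum_y Q x y) + (2^-1 / b / pi x) * kinetic Q pi (r s) (p s).
have piV : 0 <= (pi x)^-1 by rewrite invr_ge0 ltW ?(pi_gt0 chain).
have k0 : 0 <= 2^-1 * b * M * (\sum_y Q x y).
  by rewrite !mulr_ge0 ?invr_ge0 ?(ltW b0)// sumr_ge0// => y _; exact: (rate_ge0 chain).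
have l0 : 0 <= 2^-1 / b / pi x by rewrite !mulr_ge0 ?invr_ge0 ?(ltW b0) ?(ltW (pi_gt0 chain x)).
have mk := measurable_kinetic pth.
have Kt : (kinetic_integral Q pi 0 t r p <= K%:E)%E.
  rewrite -kE [leRHS](kinetic_integral_split chain (c := t)) ?t0//.
  by apply: leeDl; exact: (kinetic_integral_ge0 chain).
have fKt : kinetic_integral Q pi 0 t r p \is a fin_num.
  rewrite ge0_fin_numE ?(kinetic_integral_ge0 chain)//.
  exact: le_lt_trans Kt (ltry _).
rewrite -(fineK fKt) lee_fin in Kt.
have := @ac_norm_le_integral R 0 t (fun s => r s x) g t0 (po_ac pth' x) _ _ _.
rewrite (integral_affine_kinetic pth' k0 l0 t0 (esym (fineK fKt))) lee_fin.
move=> h; apply: (le_trans (h _ _ _)) => {h}.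
- apply: measurable_funD; first exact: measurable_cst.
  by apply: measurable_funM; [exact: measurable_cst|exact: (measurable_kinetic pth')].
- by move=> s _; rewrite addr_ge0// mulr_ge0// (kinetic_ge0 chain).
- apply: aeS (po_eq pth') => s hs s0t; have [df dE] := hs s0t x; split => //.
  have -> : derive1 (fun s => r s x) s = - \sum_y (p s y - p s x) * log_mean (r s x) (r s y) * Q x y.
    by apply/eqP; rewrite -addr_eq0 dE.
  rewrite normrN; apply: (le_trans (ler_norm_sum _ _ _)).
  have ds := po_density pth' s0t.
  have lmM y : log_mean (r s x) (r s y) <= M.
    by apply: log_mean_le_max; rewrite (density_le_bound chain _ ds) andbT; case: ds.
  apply: (@le_trans _ _ (\sum_y (2^-1 * b * M * Q x y +
      (2^-1 / b) * ((p s x - p s y) ^+ 2 * log_mean (r s x) (r s y) * Q x y)))).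
    apply: ler_sum => y _.
    rewrite normrM (ger0_norm (rate_ge0 chain x y)) normrM (ger0_norm (log_mean_ge0 _ _)).
    have h := amgm 1 `|p s y - p s x| b0.
    rewrite mul1r expr1n mulr1 real_normK ?num_real// in h.
    have hQ : 0 <= log_mean (r s x) (r s y) * Q x y.
      by rewrite mulr_ge0 ?log_mean_ge0 ?(rate_ge0 chain).
    have := ler_wpM2r hQ h; rewrite mulrA => /le_trans; apply.
    rewrite mulrDr mulrDl; apply: lerD.
      rewrite -!mulrA ler_wpM2l ?invr_ge0// ler_wpM2l ?(ltW b0)//.
      by rewrite ler_wpM2r ?(rate_ge0 chain).
    rewrite -(opprB (p s x)) sqrrN le_eqVlt; apply/orP; left; apply/eqP; ring.
  rewrite big_split/= -!mulr_sumr lerD2l -mulrA; apply: ler_wpM2l.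
    by rewrite mulr_ge0 ?invr_ge0 ?(ltW b0).
  rewrite ler_pdivlMl ?(pi_gt0 chain)// /kinetic mulr_sumr.
  rewrite [leRHS](bigD1 x)//= -[leLHS]addr0; apply: lerD.
    by apply: ler_sum => y _; rewrite mulrC.
  apply: sumr_ge0 => z _; apply: sumr_ge0 => y _.
  by rewrite -mulrA mulr_ge0 ?(flow_ge0 chain)// mulr_ge0 ?sqr_ge0// log_mean_ge0.
- apply: (@le_trans _ _ (2^-1 * b * M * (\sum_y Q x y) + 2^-1 / b / pi x * b ^+ 2)).
    apply: lerD; first by rewrite subr0 ler_piMr.
    by apply: ler_wpM2l => //; exact: le_trans Kt Kb.
  rewrite /C le_eqVlt; apply/orP; left; apply/eqP.
  by field; rewrite !gt_eqF ?(pi_gt0 chain).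
Qed.

(* The entropy is replaced by its tangent at [rho], a linear functional of the
   path, so that the path need not stay positive. *)
Lemma entropy_slope rho (eta : R) : positive_densities pi rho -> 0 < eta ->
  exists2 kap : R, 0 < kap & forall sigma a, densities pi sigma -> 0 < a ->
    dist rho sigma ^+ 2 < kap ->
    H rho - H sigma <= 2^-1 * (a * ((1 + eta) * Info rho) + dist rho sigma ^+ 2 / a).
Proof.
move=> pr eta0; have [dr r0] := pr.
have [C C0 hC] := path_displacement.
have [m [/andP[m0 _] hm]] := finite_lower_bound r0.
(* The displacement bound [C * b] becomes [eta * m], so the path stays below [(1 + eta) * rho] and
   its logarithmic means below [1 + eta] times those of [rho]. *)
pose b := eta * m / C.
have b0 : 0 < b by rewrite divr_gt0// mulr_gt0.
exists (b ^+ 2 / 2); first by rewrite divr_gt0// exprn_gt0.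
move=> sigma a ds a0 hk.
(* The infimum need not be attained: argue with [E] above the squared distance, then let [E]
   decrease to it. *)
suff key (E : R) : dist rho sigma ^+ 2 < E -> E < b ^+ 2 / 2 ->
    H rho - H sigma <= 2^-1 * (a * ((1 + eta) * Info rho) + E / a).
  set d2 := dist rho sigma ^+ 2 in hk key *.
  apply/ler_addgt0Pr => e e0.
  pose E := Num.min (d2 + 2 * a * e) ((d2 + b ^+ 2 / 2) / 2).
  have a2e : 0 < 2 * a * e by rewrite !mulr_gt0.
  have lo : d2 < E.
    by rewrite /E lt_min ltrDl a2e/=; move: hk; move: (b ^+ 2) => z; clear; lra.
  have hi : E < b ^+ 2 / 2.
    apply: (@le_lt_trans _ _ ((d2 + b ^+ 2 / 2) / 2)); first by rewrite ge_min lexx orbT.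
    by move: hk; move: (b ^+ 2) => z; clear; lra.
  apply: (le_trans (key E lo hi)).
  have hE : E / a <= d2 / a + 2 * e.
    have -> : d2 / a + 2 * e = (d2 + 2 * a * e) / a by field; rewrite gt_eqF.
    by rewrite ler_pM2r ?invr_gt0// ge_min lexx.
  by move: hE; move: (a * _) (E / a) (d2 / a) => z1 z2 z3; clear; lra.
move=> lo hi.
have [|r [p [pth rr0 rr1 kin]]] := @W2_lt_path _ _ Q pi rho sigma E.
  by rewrite (W2E chain)// lte_fin.
have fK : kinetic_integral Q pi 0 1 r p \is a fin_num.
  rewrite ge0_fin_numE ?(kinetic_integral_ge0 chain)//.
  exact: lt_trans kin (ltry _).
rewrite -(fineK fK) lte_fin in kin; set K := fine _ in kin.
have kE : kinetic_integral Q pi 0 1 r p = K%:E by rewrite fineK.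
have Kb : K <= b ^+ 2 by move: kin hi; move: (b ^+ 2) => z; clear; lra.
have close t x : 0 <= t <= 1 -> r t x <= (1 + eta) * rho x.
  move=> t01; have := hC r p K b pth kE b0 Kb t x t01; rewrite rr0.
  have -> : C * b = eta * m by rewrite /b mulrC divfK// gt_eqF.
  have h := ler_wpM2l (ltW eta0) (hm x).
  by move=> /(le_trans (ler_norm _)); move: h; clear; lra.
pose u x y := ln (rho y) - ln (rho x).
pose F t := \sum_x - (ln (rho x) * pi x) * r t x.
pose k := 2^-1 * (a * ((1 + eta) * Info rho)).
pose l := 2^-1 * (2^-1 / a).
have I0 := Info_ge0 r0.
have k0 : 0 <= k.
  by rewrite /k mulr_ge0 ?invr_ge0// mulr_ge0 ?(ltW a0)// mulr_ge0// addr_ge0// ltW.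
have l0 : 0 <= l by rewrite /l !mulr_ge0 ?invr_ge0 ?(ltW a0).
have := @ac_le_integral R 0 1 F (fun t => k + l * kinetic Q pi (r t) (p t)) ler01 _ _ _ _.
rewrite (integral_affine_kinetic pth k0 l0 ler01 kE) lee_fin subr0 mulr1.
have -> : F 1 - F 0 = \sum_x ln (rho x) * (rho x - sigma x) * pi x.
  by rewrite /F rr0 rr1 -sumrB; apply: eq_bigr => x _; ring.
move=> h; apply: (le_trans (entropy_tangent pr ds)); apply: (le_trans (h _ _ _ _)) => {h}.
- by apply: ac_sum => x; apply: acZ; exact: po_ac pth x.
- apply: measurable_funD; first exact: measurable_cst.
  by apply: measurable_funM; [exact: measurable_cst|exact: (measurable_kinetic pth)].
- by move=> s _; rewrite addr_ge0// mulr_ge0// (kinetic_ge0 chain).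
- apply: aeS (po_eq pth) => t ht t01.
  have dF := deriv_sum (index_enum _) (fun x => derivZ (- (ln (rho x) * pi x)) (derive1_deriv (proj1 (ht t01 x)))).
  have [df ->] := deriv_derive1 dF; split => //.
  have dens := po_density pth t01.
  have rt0 x : 0 <= r t x by case: dens.
  pose V x y := (p t y - p t x) * log_mean (r t x) (r t y).
  have aV x y : V x y = - V y x.
    by rewrite /V (log_meanC (rt0 x) (rt0 y)) -mulNr opprB.
  rewrite (eq_bigr (fun x => ln (rho x) * (\sum_y V x y * Q x y) * pi x)); last first.
    move=> x _; have := proj2 (ht t01 x); rewrite -/(V _ _) => /eqP.
    by rewrite addr_eq0 => /eqP ->; rewrite mulrN mulNr opprK mulrAC.
  rewrite (green chain (fun x => ln (rho x)) aV) mulNr -mulrN.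
  rewrite /k /l -mulrA -mulrDr; apply: ler_wpM2l; first by rewrite invr_ge0.
  apply: (@le_trans _ _ (2^-1 * (\sum_x \sum_y (a * (u x y ^+ 2 * log_mean (r t x) (r t y) * Q x y * pi x) +
     a^-1 * ((p t x - p t y) ^+ 2 * log_mean (r t x) (r t y) * Q x y * pi x))))).
    rewrite -sumrN mulr_sumr; apply: ler_sum => x _; rewrite -sumrN mulr_sumr; apply: ler_sum => y _.
    have h := amgm (- u x y) (p t y - p t x) a0.
    have hw : 0 <= log_mean (r t x) (r t y) * (Q x y * pi x).
      by rewrite mulr_ge0 ?log_mean_ge0 ?(flow_ge0 chain).
    have := ler_wpM2r hw h.
    congr (_ <= _); first by rewrite /V /u; ring.
    by rewrite sqrrN -(opprB (p t x)) sqrrN; ring.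
  rewrite (eq_bigr (fun x => a * (\sum_y u x y ^+ 2 * log_mean (r t x) (r t y) * Q x y * pi x) +
     a^-1 * \sum_y (p t x - p t y) ^+ 2 * log_mean (r t x) (r t y) * Q x y * pi x)); last first.
    by move=> x _; rewrite big_split -!mulr_sumr.
  rewrite big_split -!mulr_sumr/= mulrDr; apply: lerD; last first.
    by rewrite /kinetic mulrA.
  rewrite InfoE// !mulrA [2^-1 * a]mulrC -!mulrA; apply: ler_wpM2l; first exact: ltW.
  rewrite mulrCA; apply: ler_wpM2l; first by rewrite invr_ge0.
  rewrite mulr_sumr; apply: ler_sum => x _; rewrite mulr_sumr; apply: ler_sum => y _.
  rewrite -/(u x y) [leRHS](_ : _ = u x y ^+ 2 * ((1 + eta) * log_mean (rho x) (rho y)) *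
    (Q x y * pi x)); last by ring.
  rewrite -(mulrA _ (Q x y)); apply: ler_wpM2r; first exact: (flow_ge0 chain).
  apply: ler_wpM2l; first exact: sqr_ge0.
  rewrite -(log_meanZ _ (ltW (r0 x)) (ltW (r0 y))); last by rewrite addr_gt0.
  by apply: log_mean_le; rewrite rt0 close.
- rewrite /k /l -mulrA -mulrDr; apply: ler_wpM2l; first by rewrite invr_ge0.
  rewrite lerD2l mulrAC ler_pM2r ?invr_gt0//.
  by move: kin; clear; lra.
Qed.

Lemma hwi rho sigma a : Ric_ge Q pi 0 -> positive_densities pi rho -> densities pi sigma ->
  0 < a -> 2 * (H rho - H sigma) <= a * Info rho + dist rho sigma ^+ 2 / a.
Proof.
move=> ric pr ds a0; have [dr r0] := pr.
have I0 := Info_ge0 r0.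
apply/ler_addgt0Pr => e e0.
pose eta := e / (a * Info rho + 1).
have aI : 0 < a * Info rho + 1 by rewrite ltr_wpDl// mulr_ge0// ltW.
have eta0 : 0 < eta by rewrite divr_gt0.
have [kap kap0 slope] := entropy_slope pr eta0.
have [g [geo g0 g1]] := geodesic_exists chain dr ds.
set w2 := dist rho sigma ^+ 2.
have w20 : 0 <= w2 by exact: sqr_ge0.
(* Small enough that [g s] is in the range of [entropy_slope]: [s^2 * w2 <= s * w2 < kap]. *)
pose s := kap / (kap + w2 + 1).
have den : 0 < kap + w2 + 1 by rewrite addr_gt0// ltr_pwDl.
have s0 : 0 < s by rewrite divr_gt0.
have s1 : s <= 1 by rewrite ler_pdivrMr// mul1r -addrA lerDl addr_ge0.
have sw : s ^+ 2 * w2 < kap.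
  apply: (@le_lt_trans _ _ (s * w2)).
    by rewrite ler_wpM2r// expr2 ler_piMl// ltW.
  rewrite /s mulrAC ltr_pdivrMr// ltr_pM2l//.
  by move: kap0 w20; clear; lra.
have s01 : 0 <= s <= 1 by rewrite ltW.
have [dg geoE] := geo.
have dgs : dist rho (g s) ^+ 2 = s ^+ 2 * w2.
  have := geoE 0 s; rewrite lexx ler01 s01 => /(_ isT isT).
  rewrite g0 g1 !(transport_distE chain)//; last exact: dg.
  by rewrite -EFinM sub0r normrN gtr0_norm// => -[->]; rewrite exprMn.
have := ric g geo s s01.
rewrite g0 g1 mul0r !mul0r mul0e sube0 lee_fin => cvx.
(* Since the squared distance to [g s] is [s^2 * w2], the parameter [s * a] makes both terms of the
   slope bound linear in [s]; convexity is linear in [s] too, and [s] cancels. *)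
have := slope (g s) (s * a) (dg s s01) (mulr_gt0 s0 a0).
rewrite dgs => /(_ sw) sl.
have E : s ^+ 2 * w2 / (s * a) = s * (w2 / a) by field; rewrite !gt_eqF.
rewrite E in sl.
have e1 : eta * (a * Info rho) <= e.
  rewrite /eta mulrAC ler_pdivrMr// ler_pM2l//.
  by clear; lra.
have : s * (2 * (H rho - H sigma)) <= s * (a * Info rho + w2 / a + eta * (a * Info rho)).
  move: cvx sl; move: (w2 / a) (Info rho) (H rho) (H sigma) (H (g s)) => z1 z2 z3 z4 z5.
  by clear; nra.
rewrite ler_pM2l// => /le_trans; apply.
by rewrite lerD2l.
Qed.

End HWI.

(** * Heat flow *)

Section ExponentialSeries.
Context {R : realType}.
Implicit Types (a : R ^nat) (c N t : R).

(** This growth gives convergence on the whole line and is stable under termwise differentiation,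
    with the same [c]. *)
Definition exp_bounded c N a := forall n, `|a n| <= N * (c ^+ n / n`!%:R).

Lemma exp_bounded_cvg c N a t : 0 <= c -> exp_bounded c N a -> cvgn (pseries a t).
Proof.
move=> c0 ha; have N0 : 0 <= N.
  by have := ha 0%N; rewrite expr0 fact0 divr1 mulr1; apply: le_trans.
apply: normed_cvg.
apply: (@series_le_cvg _ _ (N *: exp_coeff (c * `|t|))) => [n|n|n|].
- exact: normr_ge0.
- by rewrite /exp_coeff /= mulr_ge0// divr_ge0// exprn_ge0// mulr_ge0.
- rewrite -[leLHS]/(`|a n * t ^+ n|) -[leRHS]/(N * ((c * `|t|) ^+ n / n`!%:R)).
  rewrite normrM normrX exprMn mulrAC mulrA.
  by apply: ler_wpM2r; rewrite ?exprn_ge0// (le_trans (ha n)).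
- exact/is_cvg_seriesZ/is_cvg_series_exp_coeff.
Qed.

Lemma exp_bounded_diffs c N a : exp_bounded c N a ->
  exp_bounded c (N * c) (pseries_diffs a).
Proof.
move=> ha n; rewrite /pseries_diffs normrM normr_nat.
apply: (le_trans (ler_wpM2l (ler0n _ n.+1) (ha n.+1))).
rewrite factS exprS natrM le_eqVlt; apply/orP; left; apply/eqP; field.
by rewrite nat1r !pnatr_eq0/= -lt0n fact_gt0.
Qed.

Lemma deriv_pseries c N a t : 0 <= c -> exp_bounded c N a ->
  is_derive t (1 : R) (fun s => limn (pseries a s)) (limn (pseries (pseries_diffs a) t)).
Proof.
move=> c0 ha; apply: (@pseries_snd_diffs R a (`|t| + 1)).
- exact: exp_bounded_cvg ha.
- exact: exp_bounded_cvg (exp_bounded_diffs ha).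
- exact: exp_bounded_cvg (exp_bounded_diffs (exp_bounded_diffs ha)).
- by rewrite [ltRHS]ger0_norm ?ltrDl// addr_ge0.
Qed.

Lemma pseries_sum_cvg (I : Type) (r : seq I) (b : I -> R) (a : I -> R ^nat) (l : I -> R) t :
  (forall i, pseries (a i) t @ \oo --> l i) ->
  pseries (fun n => \sum_(i <- r) b i * a i n) t @ \oo --> \sum_(i <- r) b i * l i.
Proof.
move=> h; elim: r => [|i r ih].
  rewrite big_nil (_ : pseries _ t = fun=> 0); first exact: cvg_cst.
  by apply/funext => n; rewrite /pseries /series /= big1// => k _; rewrite big_nil mul0r.
rewrite big_cons (_ : pseries _ t = (b i *: pseries (a i) t) \+
    pseries (fun n => \sum_(i <- r) b i * a i n) t).
  by apply: cvgD => //; apply: cvgZr.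
apply/funext => n; rewrite -[RHS]/(b i * (\sum_(0 <= k < n) a i k * t ^+ k) +
  \sum_(0 <= k < n) (\sum_(j <- r) b j * a j k) * t ^+ k).
rewrite /pseries /series /= mulr_sumr -big_split/=.
by apply: eq_bigr => k _; rewrite big_cons mulrDl mulrA.
Qed.

Lemma pseries_ge_coef0 c N a t : 0 <= c -> exp_bounded c N a -> 0 <= t ->
  (forall n, 0 <= a n) -> a 0%N <= limn (pseries a t).
Proof.
move=> c0 ha t0 a0; apply: limr_ge; first exact: exp_bounded_cvg ha.
near=> n; have n0 : (0 < n)%N by near: n; exists 1%N.
rewrite /pseries /series /= -(prednK n0) big_nat_recl//= expr0 mulr1 lerDl.
by apply: sumr_ge0 => k _; rewrite mulr_ge0 ?exprn_ge0.
Unshelve. all: by end_near. Qed.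

End ExponentialSeries.

(** * The heat semigroup and its kernel *)

Section HeatFlow.
Context {R : realType} {X : finType}.
Variables (Q : X -> X -> R) (pi : X -> R).
Hypothesis chain : irreducible_reversible_chain Q pi.
Implicit Types (s t : R) (f g rho : X -> R).

Definition total_rate : R := \sum_x \sum_y Q x y.

Definition uniformized f x : R :=
  \sum_y (Q x y + (y == x)%:R * (total_rate - \sum_z Q x z)) * f y.

Definition heat_coef f x n : R := iter n uniformized f x / n`!%:R.

(* Uniformization: the generator is [uniformized - total_rate], and the
   entries of [uniformized] are nonnegative. *)
Definition heat t f x : R :=
  expR (- total_rate * t) * limn (pseries (heat_coef f x) t).

Lemma total_rate_ge0 : 0 <= total_rate.
Proof.
by apply: sumr_ge0 => x _; apply: sumr_ge0 => y _; exact: (rate_ge0 chain).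
Qed.

Lemma uniformized_entry_ge0 x y :
  0 <= Q x y + (y == x)%:R * (total_rate - \sum_z Q x z).
Proof.
rewrite addr_ge0 ?(rate_ge0 chain)// mulr_ge0// subr_ge0 /total_rate.
rewrite [leRHS](bigD1 x)//= lerDl; apply: sumr_ge0 => z _.
by apply: sumr_ge0 => w _; exact: (rate_ge0 chain).
Qed.

Lemma uniformizedE f x :
  uniformized f x = \sum_y Q x y * (f y - f x) + total_rate * f x.
Proof.
rewrite /uniformized; under eq_bigr do rewrite mulrDl.
rewrite big_split/= [X in _ + X](bigD1 x)//= eqxx mul1r [X in _ + (_ + X)]big1; last first.
  by move=> y /negbTE ->; rewrite !mul0r.
rewrite addr0 mulrBl; under [in RHS]eq_bigr do rewrite mulrBr.
by rewrite sumrB -mulr_suml; ring.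
Qed.

Lemma iter_uniformized_ge0 f n x : (forall x, 0 <= f x) -> 0 <= iter n uniformized f x.
Proof.
move=> f0; elim: n x => //= n ih x; apply: sumr_ge0 => y _.
by rewrite mulr_ge0 ?uniformized_entry_ge0.
Qed.

Lemma iter_uniformized_norm f N n x : (forall x, `|f x| <= N) ->
  `|iter n uniformized f x| <= N * total_rate ^+ n.
Proof.
move=> fN; elim: n x => [|n ih] x; first by rewrite expr0 mulr1 fN.
rewrite /= (le_trans (ler_norm_sum _ _ _))//.
apply: (@le_trans _ _ (\sum_y (Q x y + (y == x)%:R * (total_rate - \sum_z Q x z)) *
    (N * total_rate ^+ n))).
  apply: ler_sum => y _; rewrite normrM (ger0_norm (uniformized_entry_ge0 x y)).
  by rewrite ler_wpM2l ?uniformized_entry_ge0.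
have := uniformizedE (fun=> N * total_rate ^+ n) x; rewrite /uniformized => ->.
by rewrite big1 ?add0r ?exprS 1?mulrCA// => y _; rewrite subrr mulr0.
Qed.

Lemma heat_coef_bounded f : exists N : R, forall x, exp_bounded total_rate N (heat_coef f x).
Proof.
exists (\sum_y `|f y|) => x n; rewrite normrM normfV normr_nat mulrA.
rewrite ler_wpM2r ?invr_ge0//; apply: iter_uniformized_norm => y.
by rewrite (bigD1 y)//= lerDl sumr_ge0.
Qed.

Lemma heat0 f : heat 0 f = f.
Proof.
apply/funext => x; rewrite /heat mulr0 expR0 mul1r.
apply: cvg_lim => //; apply: cvg_near_cst; near=> n.
have n0 : (0 < n)%N by near: n; exists 1%N.
rewrite /pseries /series /= -(prednK n0) big_nat_recl//= expr0 mulr1 big1 ?addr0.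
  by rewrite /heat_coef /= fact0 divr1.
by move=> k _; rewrite expr0n mulr0.
Unshelve. all: by end_near. Qed.

Lemma deriv_heat f x t : is_derive t (1 : R) (fun s => heat s f x)
  (\sum_y (heat t f y - heat t f x) * Q x y).
Proof.
have [N hN] := heat_coef_bounded f.
have dE : is_derive t (1 : R) (fun s => expR (- total_rate * s))
    (expR (- total_rate * t) * - total_rate).
  apply: (deriv_comp (f := expR) (g := fun s => - total_rate * s)).
  have := derivZ (- total_rate) (deriv_id t); by move/deriv_eq; apply; rewrite mulr1.
have := derivM dE (deriv_pseries t total_rate_ge0 (hN x)).
move/deriv_eq; apply.
have -> : limn (pseries (pseries_diffs (heat_coef f x)) t) =
    \sum_y (Q x y + (y == x)%:R * (total_rate - \sum_z Q x z)) *
       limn (pseries (heat_coef f y) t).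
  have E : pseries_diffs (heat_coef f x) = fun n =>
      \sum_y (Q x y + (y == x)%:R * (total_rate - \sum_z Q x z)) * heat_coef f y n.
    apply/funext => n; rewrite /pseries_diffs /heat_coef iterS /uniformized.
    rewrite mulr_suml mulr_sumr; apply: eq_bigr => y _.
    rewrite factS natrM; field.
    by rewrite nat1r !pnatr_eq0/= -lt0n fact_gt0.
  rewrite E; apply: cvg_lim => //; apply: pseries_sum_cvg => y.
  exact: exp_bounded_cvg total_rate_ge0 (hN y).
have := uniformizedE (fun y => limn (pseries (heat_coef f y) t)) x.
rewrite /uniformized => ->.
have -> : \sum_y (heat t f y - heat t f x) * Q x y = expR (- total_rate * t) *
  \sum_y Q x y * (limn (pseries (heat_coef f y) t) - limn (pseries (heat_coef f x) t)).
  by rewrite mulr_sumr; apply: eq_bigr => y _; rewrite /heat; ring.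
by ring.
Qed.

(** The left side is the zeroth term of a series with nonnegative terms; it already yields strict
    positivity of the flow. *)
Lemma heat_ge t f x : 0 <= t -> (forall x, 0 <= f x) ->
  expR (- total_rate * t) * f x <= heat t f x.
Proof.
move=> t0 f0; have [N hN] := heat_coef_bounded f.
rewrite ler_pM2l ?expR_gt0//.
have := pseries_ge_coef0 total_rate_ge0 (hN x) t0.
rewrite {2}/heat_coef /= fact0 divr1; apply => n.
by rewrite divr_ge0// iter_uniformized_ge0.
Qed.

Lemma heat_ge0 t f x : 0 <= t -> (forall x, 0 <= f x) -> 0 <= heat t f x.
Proof.
by move=> t0 f0; apply: le_trans (heat_ge x t0 f0); rewrite mulr_ge0 ?expR_ge0.
Qed.

Lemma heat_gt0 t f x : 0 <= t -> (forall x, 0 < f x) -> 0 < heat t f x.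
Proof.
move=> t0 f0; apply: lt_le_trans (heat_ge x t0 (fun x => ltW (f0 x))).
by rewrite mulr_gt0 ?expR_gt0.
Qed.

(* The pairing of [heat (s - r) f] with [heat (t + r) g] does not depend on [r]. *)
Lemma heat_inner f g s t :
  \sum_x heat s f x * heat t g x * pi x = \sum_x f x * heat (s + t) g x * pi x.
Proof.
pose F r := \sum_x heat (s + (-1) * r) f x * heat (t + r) g x * pi x.
have dh h u (k a : R) x : is_derive a (1 : R) (fun r => heat (u + k * r) h x)
    (k * \sum_y (heat (u + k * a) h y - heat (u + k * a) h x) * Q x y).
  have dl : is_derive a (1 : R) (fun r => u + k * r) k.
    by have := deriv_affine a u k; rewrite (_ : (fun s => _) = fun r => u + k * r)//;
      apply/funext => r; rewrite mulrC.
  have := deriv_comp (f := fun r => heat r h x) (g := fun r => u + k * r) (deriv_heat h x (u + k * a)) dl.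
  by move/deriv_eq; apply; rewrite mulrC.
have dF r : is_derive r (1 : R) F 0.
  have := deriv_sum (index_enum X) (fun x => derivM (derivM (dh f s (-1) r x) (dh g t 1 r x)) (deriv_cst r (pi x))).
  move/deriv_eq => h; have := h; rewrite /F => {}h.
  rewrite (_ : (fun r => _) = (fun r => \sum_x heat (s + (-1) * r) f x * heat (t + 1 * r) g x * pi x)); last first.
    by apply/funext => a; under [RHS]eq_bigr do rewrite mul1r.
  apply: h; set a := s + _; set b := t + _.
  transitivity (\sum_x \sum_y ((heat a f x * heat b g y - heat b g x * heat a f y) * (Q x y * pi x))).
    apply: eq_bigr => x _; rewrite mulr0 add0r mul1r mulN1r mulrN !mulr_sumr -sumrB mulr_sumr.
    by apply: eq_bigr => y _; ring.
  apply: sum_antisym => x y; rewrite (flowC chain y x); ring.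
have := @is_derive_0_is_cst R F s 0 dF; rewrite /F.
rewrite mulr0 !addr0 mulN1r subrr heat0.
by rewrite (addrC s t) => ->.
Qed.

Lemma heat_mass f t : \sum_x heat t f x * pi x = \sum_x f x * pi x.
Proof.
have dF r : is_derive r (1 : R) (fun r => \sum_x heat r f x * pi x) 0.
  have := deriv_sum (index_enum X) (fun x => derivM (deriv_heat f x r) (deriv_cst r (pi x))).
  move/deriv_eq; apply.
  have E := sum_div0 chain (V := fun x y => heat r f y - heat r f x).
  rewrite -[RHS]E; last by move=> x y; rewrite opprB.
  by apply: eq_bigr => x _; rewrite mulr0 add0r mulrC.
by rewrite (is_derive_0_is_cst t 0 dF) heat0.
Qed.

Lemma dirac_inner f x : \sum_z dirac_density pi x z * f z * pi z = f x.
Proof.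
rewrite (bigD1 x)//= big1 ?addr0; last first.
  by move=> z /negbTE zx; rewrite /dirac_density zx !mul0r.
by rewrite /dirac_density eqxx mul1r mulrAC mulVf ?mul1r// gt_eqF ?(pi_gt0 chain).
Qed.

Lemma dirac_densities x : densities pi (dirac_density pi x).
Proof.
split; first by move=> z; rewrite divr_ge0// ltW ?(pi_gt0 chain).
by rewrite -[RHS](dirac_inner (fun=> 1) x); apply: eq_bigr => z _; rewrite mulr1.
Qed.

(** [heat_inner] against a Dirac density: the evolved Dirac is the kernel of [heat t]. Linearity and
    invariance of constants follow from this formula. *)
Lemma heat_kernel f t x :
  heat t f x = \sum_y heat t (dirac_density pi x) y * f y * pi y.
Proof.
rewrite -(dirac_inner (heat t f) x).
by have := heat_inner (dirac_density pi x) f t 0; rewrite heat0 addr0 => ->.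
Qed.

Lemma heat1 t : heat t (fun=> 1) = fun=> 1.
Proof.
apply/funext => x; rewrite heat_kernel.
under eq_bigr do rewrite mulr1.
by rewrite heat_mass; have [_ ->] := dirac_densities x.
Qed.

Lemma heat_linear t (a b : R) f g x :
  heat t (fun z => a * f z + b * g z) x = a * heat t f x + b * heat t g x.
Proof.
rewrite heat_kernel (heat_kernel f) (heat_kernel g) !mulr_sumr -big_split/=.
by apply: eq_bigr => y _; ring.
Qed.

Lemma heat_density t rho : 0 <= t -> densities pi rho -> densities pi (heat t rho).
Proof.
by move=> t0 [r0 r1]; split; [move=> x; exact: heat_ge0|rewrite heat_mass].
Qed.

Lemma heat_positive t rho : 0 <= t -> positive_densities pi rho ->
  positive_densities pi (heat t rho).
Proof.
by move=> t0 [dr r0]; split; [exact: heat_density|move=> x; exact: heat_gt0].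
Qed.

End HeatFlow.

(** * Entropy along the heat flow and the resulting inequality *)

Section EntropyDecay.
Context {R : realType} {X : finType}.
Variables (Q : X -> X -> R) (pi : X -> R).
Hypothesis chain : irreducible_reversible_chain Q pi.
Implicit Types (s t : R) (f g rho : X -> R).
Local Notation mu := (@lebesgue_measure R).
Local Notation heat := (heat Q).
Local Notation dist := (dist Q pi).
Local Notation H := (entropy pi).
Local Notation Info rho := (dirichlet_form Q pi rho (fun x => ln (rho x))).

Lemma entropy1 : H (fun=> 1) = 0.
Proof. by rewrite /entropy big1// => x _; rewrite ln1 mulr0. Qed.

Lemma entropy_ge0 rho : densities pi rho -> 0 <= H rho.
Proof.
move=> [r0 r1]; have : 0 <= \sum_x pi x * (rho x * ln (rho x) - (rho x - 1)).
  apply: sumr_ge0 => x _; rewrite mulr_ge0 ?(ltW (pi_gt0 chain x))// subr_ge0.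
  by have := xlnx_tangent (r0 x) ltr01; rewrite ln1 mulr0 !add0r mul1r.
have -> : \sum_x pi x * (rho x * ln (rho x) - (rho x - 1)) =
    H rho - (\sum_x rho x * pi x) + \sum_x pi x.
  by rewrite /entropy -sumrB -big_split/=; apply: eq_bigr => x _; ring.
by rewrite r1 (pi_sum1 chain) subrK.
Qed.

Lemma deriv_ln_heat rho x t : 0 <= t -> (forall x, 0 < rho x) ->
  is_derive t (1 : R) (fun s => ln (heat s rho x))
    ((heat t rho x)^-1 * \sum_y (heat t rho y - heat t rho x) * Q x y).
Proof.
move=> t0 r0; apply: (deriv_comp (f := @ln R) (g := fun s => heat s rho x)).
  by apply: is_derive1_ln; exact: (heat_gt0 chain).
exact: (deriv_heat chain).
Qed.

(** De Bruijn's identity: differentiating the logarithm leaves a total divergence, which vanishes,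
    and [green] turns the other term into the Dirichlet form. *)
Lemma deriv_entropy_heat rho t : 0 <= t -> (forall x, 0 < rho x) ->
  is_derive t (1 : R) (fun s => H (heat s rho)) (- Info (heat t rho)).
Proof.
move=> t0 r0; have h0 x := heat_gt0 chain x t0 r0.
have := deriv_sum (index_enum X) (fun x => derivM (derivZ (pi x) (deriv_heat chain rho x t))
  (deriv_ln_heat x t0 r0)).
move/deriv_eq; apply.
have aV x y : heat t rho y - heat t rho x = - (heat t rho x - heat t rho y) by rewrite opprB.
have G := green chain (fun x => ln (heat t rho x)) aV.
have E := sum_div0 chain aV.
transitivity (\sum_x (\sum_y (heat t rho y - heat t rho x) * Q x y) * pi x +
   \sum_x ln (heat t rho x) * (\sum_y (heat t rho y - heat t rho x) * Q x y) * pi x).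
  rewrite -big_split/=; apply: eq_bigr => x _.
  by field; rewrite gt_eqF.
rewrite E G add0r mulNr /dirichlet_form; congr (- (_ * _)).
by apply: eq_bigr => x _; apply: eq_bigr => y _; ring.
Qed.

Lemma entropy_heat_decay rho (D : R) t : Ric_ge Q pi 0 -> positive_densities pi rho -> 0 < D ->
  (forall sigma, positive_densities pi sigma -> dist sigma (fun=> 1) <= D) ->
  0 < t -> H (heat t rho) <= D ^+ 2 / t.
Proof.
move=> ric pr D0 hD t0; have [dr r0] := pr.
pose u s := H (heat s rho); have t0' := ltW t0.
have u0 s : 0 <= s -> 0 <= u s.
  by move=> s0; apply: entropy_ge0; exact: heat_density.
have D20 : 0 < D ^+ 2 by exact: exprn_gt0.
(* The argument differentiates [1 / u], so the case where the entropy has vanished by time [t] is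
   set aside. *)
rewrite -/(u t); have [->|ut] := eqVneq (u t) 0; first by rewrite divr_ge0// ltW.
have {}ut : 0 < u t by rewrite lt_neqAle eq_sym ut u0.
have du s : 0 <= s -> is_derive s (1 : R) u (- Info (heat s rho)).
  by move=> s0; exact: deriv_entropy_heat.
have I0 s : 0 <= s -> 0 <= Info (heat s rho).
  by move=> s0; apply: (Info_ge0 chain) => x; exact: (heat_gt0 chain).
have us s : 0 <= s <= t -> 0 < u s.
  move=> /andP[s0 st]; apply: lt_le_trans ut _.
  have := @deriv_le_sub R u (fun=> 0) (fun s => - Info (heat s rho)) (fun=> 0) s t st.
  rewrite subrr subr_le0; apply.
  - by move=> r /andP[sr _]; apply: du; exact: le_trans sr.
  - by move=> r /andP[sr _]; rewrite oppr_le0 I0// (le_trans s0).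
have uI s : 0 <= s <= t -> u s ^+ 2 <= D ^+ 2 * Info (heat s rho).
  move=> st; have s0 : 0 <= s by case/andP: st.
  have us0 := us s st; have ps := heat_positive chain s0 pr.
  (* With [a = D^2 / u s] the distance term of HWI is at most [u s], half of its left side. *)
  have a0 : 0 < D ^+ 2 / u s by rewrite divr_gt0.
  have := hwi chain ric ps (one_density chain) a0; rewrite entropy1 subr0 -/(u s).
  have hd : dist (heat s rho) (fun=> 1) ^+ 2 <= D ^+ 2.
    by rewrite ler_sqr ?nnegrE ?hD ?(dist_ge0 Q pi)// ltW.
  have : dist (heat s rho) (fun=> 1) ^+ 2 / (D ^+ 2 / u s) <= u s.
    by rewrite ler_pdivrMr// mulrC divfK ?gt_eqF.
  move=> h1 h2; have h3 : u s <= D ^+ 2 / u s * Info (heat s rho).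
    by rewrite -(lerD2r (u s)) -mulr2n -mulr_natl (le_trans h2)// lerD2l.
  by rewrite mulrAC ler_pdivlMr// -expr2 in h3.
have := @deriv_le_sub R (fun s => D ^- 2 * s) (fun s => (u s)^-1)
  (fun=> D ^- 2 * 1) (fun s => - u s ^- 2 *: - Info (heat s rho)) 0 t t0'.
rewrite mulr0 subr0 => h.
have {}h : D ^- 2 * t <= (u t)^-1.
  apply: le_trans (h _ _ _) _.
  - move=> s st; apply: is_deriveV; first by rewrite gt_eqF ?us.
    by apply: du; case/andP: st.
  - move=> s st; rewrite mulr1 -[leRHS]/(- u s ^- 2 * - Info (heat s rho)) mulrNN.
    by rewrite ler_pdivlMl ?exprn_gt0 ?us// ler_pdivrMr// mulrC uI.
  by rewrite lerBlDr lerDl invr_ge0 u0.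
rewrite ler_pdivlMr//; move: h; rewrite ler_pdivrMl// => h.
by rewrite -ler_pdivlMl// mulrC.
Qed.

(* In terms of [p = sqrt a] and [q = sqrt b] this is
   [(p q - 1/2)^2 + (p + q - 2)^2 / 2 >= 0]. *)
Lemma product_ge (a b : R) : 0 < a -> 0 < b ->
  3 / 2 * (a + b) - 9 / 4 - a * ln a - b * ln b <= a * b.
Proof.
(* From [p * ln p >= p - 1] at [p = Num.sqrt z], multiplied by [p]. *)
suff key (z : R) : 0 < z -> z - Num.sqrt z <= 2^-1 * (z * ln z).
  move=> a0 b0; have := key a a0; have := key b b0.
  have aE := sqr_sqrtr (ltW a0); have bE := sqr_sqrtr (ltW b0).
  move: aE bE; move: (Num.sqrt a) (Num.sqrt b) (a * ln a) (b * ln b) => p q u v <- <-.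
  have h1 := sqr_ge0 (p + q - 2); have h2 := sqr_ge0 (p * q - 2^-1).
  move: h1 h2; clear; nra.
move=> z0; have s0 : 0 < Num.sqrt z by rewrite sqrtr_gt0.
have := xlnx_tangent (ltW s0) ltr01; rewrite ln1 mulr0 !add0r mul1r => h.
have := ler_wpM2l (ltW s0) h; have zE := sqr_sqrtr (ltW z0).
have -> : ln z = ln (Num.sqrt z) *+ 2 by rewrite -lnXn// zE.
move: zE; move: (Num.sqrt z) => p <-; move: (ln p) => l.
rewrite (_ : 2^-1 * (p ^+ 2 * (l *+ 2)) = p * (p * l)); last by field.
by rewrite mulrBr mulr1 expr2.
Qed.

(** By symmetry the kernel at time [T + T] is the pairing of two Dirac densities heated for time
    [T]. Integrating [product_ge] bounds such a pairing below by [3 - 9/4 - 1/4 - 1/4 = 1/4]. *)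
Lemma heat_kernel_ge (T : R) : 0 <= T ->
  (forall rho, positive_densities pi rho -> H (heat T rho) <= 4^-1) ->
  forall x y, 4^-1 <= heat (T + T) (dirac_density pi x) y.
Proof.
move=> T0 hT x y.
have corr f g : positive_densities pi f -> positive_densities pi g ->
    4^-1 <= \sum_x f x * heat (T + T) g x * pi x.
  move=> pf pg; rewrite -heat_inner//.
  have [[_ F1] F0] := heat_positive chain T0 pf; have hF := hT f pf.
  have [[_ G1] G0] := heat_positive chain T0 pg; have hG := hT g pg.
  set F := heat T f in F1 F0 hF *; set G := heat T g in G1 G0 hG *.
  apply: (@le_trans _ _ (\sum_x (3 / 2 * (F x + G x) - 9 / 4 - F x * ln (F x) - G x * ln (G x)) * pi x)).
    have -> : \sum_x (3 / 2 * (F x + G x) - 9 / 4 - F x * ln (F x) - G x * ln (G x)) * pi x =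
        3 / 2 * (\sum_x F x * pi x) + 3 / 2 * (\sum_x G x * pi x) - 9 / 4 * (\sum_x pi x) - H F - H G.
      rewrite /entropy !mulr_sumr -big_split -!sumrB/=.
      by apply: eq_bigr => z _; ring.
    rewrite F1 G1 (pi_sum1 chain); move: hF hG; move: (H F) (H G) => u v; lra.
  apply: ler_sum => z _; rewrite ler_wpM2r ?(ltW (pi_gt0 chain z))//.
  exact: product_ge.
set K := heat _ _ _.
have K0 : 0 <= K.
  by apply: (heat_ge0 chain); [exact: addr_ge0|case: (dirac_densities chain x)].
apply/ler_addgt0Pr => e e0.
(* Dirac densities are mixed with a weight [d] of the constant density to become positive; this
   changes the bound by at most [2 * d <= e]. *)
pose d := Num.min (e / 2) 2^-1.
have d0 : 0 < d by rewrite lt_min; apply/andP; split; [exact: divr_gt0|rewrite invr_gt0].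
have de : d <= e / 2 by rewrite ge_min lexx.
have d1 : d <= 2^-1 by rewrite ge_min lexx orbT.
pose f z v := (1 - d) * dirac_density pi z v + d * 1.
have pf z : positive_densities pi (f z).
  have [q0 q1] := dirac_densities chain z.
  have fp v : 0 < f z v.
    rewrite /f ltr_wpDl ?mulr1// mulr_ge0// subr_ge0.
    by apply: le_trans d1 _; rewrite invf_le1// ler1n.
  split=> //; split; first by move=> v; exact: ltW.
  rewrite (_ : \sum_v _ = (1 - d) * (\sum_v dirac_density pi z v * pi v) + d * \sum_v pi v).
    by rewrite q1 (pi_sum1 chain); ring.
  by rewrite !mulr_sumr -big_split/=; apply: eq_bigr => v _; rewrite /f; ring.
have := corr (f y) (f x) (pf y) (pf x).
set h := heat (T + T) (f x).
have h1 : \sum_v h v * pi v = 1 by rewrite (heat_mass chain); case: (pf x) => -[].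
have hy : h y = (1 - d) * K + d.
  by rewrite /h (heat_linear chain) (heat1 chain) mulr1.
have -> : \sum_v f y v * h v * pi v =
    (1 - d) * (\sum_v dirac_density pi y v * h v * pi v) + d * \sum_v h v * pi v.
  by rewrite !mulr_sumr -big_split/=; apply: eq_bigr => v _; rewrite /f; ring.
rewrite (dirac_inner chain) h1 mulr1.
rewrite hy; move: d0 d1 de K0 e0; clearbody d K; clear; nra.
Qed.

Lemma entropy_heat_contraction (T : R) rho : 0 <= T -> densities pi rho ->
  (forall x, 0 < rho x) ->
  (forall x y, 4^-1 <= heat T (dirac_density pi x) y) ->
  H (heat T rho) <= 3 / 4 * H rho.
Proof.
move=> T0 [_ r1] r0 hK.
pose phi (s : R) := s * ln s.
have step x : phi (heat T rho x) <= heat T (fun y => phi (rho y)) x - 4^-1 * H rho.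
  set a := heat T rho x; have a0 : 0 < a by exact: (heat_gt0 chain).
  pose K y := heat T (dirac_density pi x) y.
  have K1 : \sum_y K y * pi y = 1.
    by rewrite (heat_mass chain); case: (dirac_densities chain x).
  have aE : \sum_y K y * rho y * pi y = a by rewrite /a (heat_kernel chain).
  have : 0 <= \sum_y (K y - 4^-1) * (phi (rho y) - (phi a + (ln a + 1) * (rho y - a))) * pi y.
    apply: sumr_ge0 => y _; rewrite mulr_ge0 ?(ltW (pi_gt0 chain y))// mulr_ge0 ?subr_ge0 ?hK//.
    by apply: xlnx_tangent => //; exact: ltW.
  have -> : \sum_y (K y - 4^-1) * (phi (rho y) - (phi a + (ln a + 1) * (rho y - a))) * pi y =
     (\sum_y K y * phi (rho y) * pi y) - 4^-1 * H rho -
     (phi a - (ln a + 1) * a) * (\sum_y K y * pi y) - (ln a + 1) * (\sum_y K y * rho y * pi y) +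
     4^-1 * ((phi a - (ln a + 1) * a) * (\sum_y pi y) + (ln a + 1) * (\sum_y rho y * pi y)).
    rewrite /entropy !mulr_sumr -!sumrB -!big_split !mulr_sumr -!big_split/=.
    by apply: eq_bigr => y _; rewrite /phi; ring.
  rewrite K1 aE r1 (pi_sum1 chain) -/(K _) (heat_kernel chain (fun y => phi (rho y))) -/(K _).
  (* The remainder due to the subtracted constant is a quarter of the tangent at [a] evaluated at
     [1], hence at most [1 * ln 1 = 0]. *)
  have := xlnx_tangent ler01 a0; rewrite ln1 mulr0 -/(phi a).
  move: (\sum_y _) (H rho) (phi a) (ln a) => u v p l; clear; nra.
have : \sum_x phi (heat T rho x) * pi x <=
    \sum_x (heat T (fun y => phi (rho y)) x - 4^-1 * H rho) * pi x.
  by apply: ler_sum => x _; rewrite ler_wpM2r ?(ltW (pi_gt0 chain x)).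
have -> : \sum_x phi (heat T rho x) * pi x = H (heat T rho).
  by apply: eq_bigr => x _; rewrite /phi; ring.
under eq_bigr do rewrite mulrBl.
rewrite sumrB -mulr_sumr (pi_sum1 chain) mulr1 (heat_mass chain).
have -> : \sum_x phi (rho x) * pi x = H rho by apply: eq_bigr => x _; rewrite /phi; ring.
by move: (H rho) (H _) => u v; lra.
Qed.

Lemma dist_heat rho (T : R) : 0 < T -> positive_densities pi rho ->
  dist rho (heat T rho) ^+ 2 <= T * (H rho - H (heat T rho)).
Proof.
move=> T0 pr; have [dr r0] := pr.
pose r t := heat t rho; pose p t x := - ln (r t x).
have h0 t x : 0 <= t -> 0 < r t x by move=> t0; exact: (heat_gt0 chain).
have cl x t : 0 <= t -> {for t, continuous (fun s => ln (r s x))}.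
  by move=> t0; exact: deriv_continuous (deriv_ln_heat x t0 r0).
have curve t : 0 <= t -> curve_eq Q r p t.
  move=> t0 x; have [df ->] := deriv_derive1 (deriv_heat chain rho x t); split => //.
  rewrite -big_split/= big1// => y _.
  rewrite -mulrDl -[X in X + _](log_mean_ln (h0 t x t0) (h0 t y t0)) /p; ring.
have pth : path_on Q pi 0 T r p.
  split.
  - by move=> t /andP[t0 _]; exact: heat_density.
  - move=> x; apply: (@ac_deriv _ _ _ _ _ (\sum_y (density_bound pi + density_bound pi) * Q x y)).
      by move=> t _; exact: (deriv_heat chain).
    move=> t /andP[t0 _]; have dt := heat_density chain t0 dr.
    apply: (le_trans (ler_norm_sum _ _ _)); apply: ler_sum => y _.
    rewrite normrM (ger0_norm (rate_ge0 chain x y)) ler_wpM2r ?(rate_ge0 chain)//.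
    apply: (le_trans (ler_normB _ _)).
    by apply: lerD; rewrite gtr0_norm ?(h0 t)//; exact: (density_le_bound chain).
  - move=> x; apply: subspace_continuous_measurable_fun; first exact: measurable_itv.
    apply: continuous_in_subspaceT => t; rewrite inE /= in_itv/= => /andP[t0 _].
    exact: (cvgN (cl x t t0)).
  - by apply: aeW => t /andP[t0 _]; exact: curve.
have kin t : 0 <= t -> kinetic Q pi (r t) (p t) = 2 * Info (r t).
  move=> t0; rewrite InfoE; last by move=> x; exact: h0.
  rewrite mulrA divff ?mul1r//; apply: eq_bigr => x _; apply: eq_bigr => y _.
  by rewrite /p opprK addrC.
have dI t : 0 <= t <= T -> {for t, continuous (fun s => 2 * Info (r s))}.
  move=> /andP[t0 _].
  have dB (u v : R -> R) a b : is_derive t (1 : R) u a -> is_derive t (1 : R) v b ->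
      is_derive t (1 : R) (fun s => u s - v s) (a - b).
    by move=> hf hg; exact: is_deriveB.
  exact: (deriv_continuous (derivZ _ (derivZ _ (deriv_sum _ (fun x => deriv_sum _ (fun y =>
    derivM (derivM (derivM
      (dB _ _ _ _ (deriv_heat chain rho y t) (deriv_heat chain rho x t))
      (dB _ _ _ _ (deriv_ln_heat y t0 r0) (deriv_ln_heat x t0 r0)))
      (deriv_cst t (Q x y))) (deriv_cst t (pi x)))))))).
have kE : kinetic_integral Q pi 0 T r p = (2 * (H rho - H (heat T rho)))%:E.
  transitivity (\int[mu]_(t in `[0%R, T]) (2 * Info (r t))%:E)%E.
    by apply: eq_integral => t; rewrite inE /= in_itv/= => /andP[t0 _]; rewrite kin.
  have dH t : 0 <= t <= T -> is_derive t (1 : R) (fun s => -2 * H (r s)) (2 * Info (r t)).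
    move=> /andP[t0 _]; have := derivZ (-2) (deriv_entropy_heat t0 r0).
    by move/deriv_eq; apply; rewrite mulrNN.
  rewrite (integral_deriv T0 dH).
    by rewrite /r (heat0); congr (_%:E); ring.
  by apply: continuous_in_subspaceT => t; rewrite inE /= in_itv/=; exact: dI.
have := dist_le_kinetic chain (ltW T0) pth kE.
rewrite /r (heat0) subr0 => /le_trans; apply.
by rewrite mulrAC divff// mul1r.
Qed.

Lemma mlsi_of_vertex_bound (D : R) : 0 < D -> Ric_ge Q pi 0 ->
  (forall x y, dist (dirac_density pi x) (dirac_density pi y) <= D) ->
  MLSI Q pi (64^-1 / D ^+ 2).
Proof.
move=> D0 ric hD rho pr; have [dr r0] := pr.
have D20 : 0 < D ^+ 2 by exact: exprn_gt0.
have to1 sigma : positive_densities pi sigma -> dist sigma (fun=> 1) <= D.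
  move=> ps; have [ds _] := ps.
  apply: (dist_le chain ds (one_density chain) (ltW D0)).
  apply: (W2_to_uniform chain) => // x y.
  rewrite (W2E chain) ?lee_fin; [|exact: (dirac_densities chain)..].
  by rewrite ler_sqr ?nnegrE ?hD ?(dist_ge0 Q pi)// ltW.
(* At this time the decay bound [D^2 / S] equals [1/4], the level required by [heat_kernel_ge]. *)
pose S := 4 * D ^+ 2; have S0 : 0 < S by rewrite mulr_gt0.
have hS sigma : positive_densities pi sigma -> H (heat S sigma) <= 4^-1.
  move=> ps; apply: (le_trans (entropy_heat_decay ric ps D0 to1 S0)).
  by rewrite /S le_eqVlt; apply/orP; left; apply/eqP; field; rewrite gt_eqF.
have T0 : 0 < S + S by exact: addr_gt0.
have contr := entropy_heat_contraction (ltW T0) dr r0 (heat_kernel_ge (ltW S0) hS).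
have near := dist_heat T0 pr.
have := hwi chain ric pr (heat_density chain (ltW T0) dr) T0.
move: near; rewrite mulrC -ler_pdivrMr// => near h.
(* A gain of one quarter of the entropy over time [S + S] costs a factor [4 * (S + S) = 32 * D^2].
   Equating it with [(2 * lambda)^-1] fixes the constant [1/64]. *)
have -> : (2 * (64^-1 / D ^+ 2))^-1 = 4 * (S + S).
  by rewrite /S; field; rewrite gt_eqF.
by rewrite -(mulrA 4); move: contr near h; move: (H _) (H rho)
  (dist _ _ ^+ 2 / _) (_ * dirichlet_form _ _ _ _) => z1 z2 z3 z4; lra.
Qed.

End EntropyDecay.

Theorem theorem1p3 (R : realType) :
  exists c' : R, 0 < c' /\
    forall (X : finType) (Q : X -> X -> R) (pi : X -> R) (D : R),
      irreducible_reversible_chain Q pi ->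
      0 < D ->
      Ric_ge Q pi 0 ->
      (vertex_diameter Q pi <= D%:E)%E ->
      MLSI Q pi (c' / D ^+ 2).
Proof.
exists 64^-1; split; first by rewrite invr_gt0.
move=> X Q pi D chain D0 ric diam.
apply: (mlsi_of_vertex_bound chain) => // x y.
rewrite -lee_fin -(transport_distE chain); [|exact: (dirac_densities chain)..].
by apply: le_trans diam; apply: ereal_sup_ubound; exists x, y.
Qed.
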